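(* Let $T>0$. If $\gamma>3/2$, then $V^\gamma$ is continuously embedded into $\bigl[C([0,1]\times\mathbb{R})\bigr]^2$.
   Context: Let $S^T=\mathbb{R}/T\mathbb{Z}$, $\omega=2\pi/T$, $\varphi_k(t)=e^{ik\omega t}$. $C^\infty(S^T)^*$ is the space of distributions on $S^T$, with dual pairing $[\cdot,\cdot]$. For $\gamma\in\mathbb{R}$, $H^\gamma(S^T)$ is the space of $u\in C^\infty(S^T)^*$ with $\|u\|_{H^\gamma(S^T)}^2=T^{-1}\sum_{k\in\mathbb{Z}}(1+k^2)^\gamma|[u,\varphi_{-k}]|^2<\infty$. $H^{0,\gamma}=L^2(0,1;H^\gamma(S^T))$ has norm $\|u\|_{H^{0,\gamma}}^2=T^{-1}\sum_{k\in\mathbb{Z}}(1+k^2)^\gamma\int_0^1|[u(x,\cdot),\varphi_{-k}]|^2dx$. All functions are complex valued. $W^\gamma=H^{0,\gamma}\times H^{0,\gamma}$ with $\|(u,v)\|_{W^\gamma}^2=\|u\|_{H^{0,\gamma}}^2+\|v\|_{H^{0,\gamma}}^2$. $V^\gamma=\{(u,v)\in W^\gamma : (\partial_tu+\partial_xu,\partial_tv-\partial_xv)\in W^\gamma\}$ (generalized derivatives) with $\|(u,v)\|_{V^\gamma}^2=\|(u,v)\|_{W^\gamma}^2+\|(\partial_tu+\partial_xu,\partial_tv-\partial_xv)\|_{W^\gamma}^2$. Elements of these spaces are regarded as $T$-periodic in $t$, and the (bounded, $T$-periodic in $t$) continuous functions on $[0,1]\times\mathbb{R}$ carry the supremum norm.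 *)

(* Defs.v *)
From mathcomp Require Export all_boot all_order all_algebra.
From mathcomp Require Export all_classical all_reals all_analysis.
From mathcomp Require Export complex.

Set Implicit Arguments.
Unset Strict Implicit.
Unset Printing Implicit Defensive.

Import Order.TTheory GRing.Theory Num.Theory.
Import numFieldNormedType.Exports.

Local Open Scope classical_set_scope.
Local Open Scope ring_scope.
Local Open Scope complex_scope.

(* R[i]^o rather than R[i]: the bare type R[i] carries no topology here, and
   its canonical module structure is not the one over itself. *)
Notation Cplx R := (R[i]^o).

Section ComplexCalculus.
Context {R : realType}.
Implicit Types f g : R -> Cplx R.

Local Notation mu := (@lebesgue_measure R).

Definition cderive (n : nat) f : R -> Cplx R :=
  fun t => (derive1n n (fun s => complex.Re (f s)) t)
        +i* (derive1n n (fun s => complex.Im (f s)) t).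

Definition cintegral (D : set R) f : Cplx R :=
  (\int[mu]_(x in D) complex.Re (f x))
    +i* (\int[mu]_(x in D) complex.Im (f x)).

Definition smooth f : Prop :=
  forall n t, derivable (derive1n n (fun s => complex.Re (f s))) t 1 /\
              derivable (derive1n n (fun s => complex.Im (f s))) t 1.

Fixpoint Cn2 (n : nat) (f : R -> R -> R) : Prop :=
  if n is m.+1 then
    [/\ forall x t, derivable (fun y => f y t) x 1 /\ derivable (f x) t 1,
        Cn2 m (fun x t => derive1 (fun y => f y t) x) &
        Cn2 m (fun x t => derive1 (f x) t)]
  else continuous (fun p : R * R => f p.1 p.2).

Definition smooth2 (f : R -> R -> Cplx R) : Prop :=
  forall n, Cn2 n (fun x t => complex.Re (f x t)) /\
            Cn2 n (fun x t => complex.Im (f x t)).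

Definition pderive_x (f : R -> R -> Cplx R) : R -> R -> Cplx R :=
  fun x t => cderive 1 (fun y => f y t) x.

Definition pderive_t (f : R -> R -> Cplx R) : R -> R -> Cplx R :=
  fun x t => cderive 1 (f x) t.

End ComplexCalculus.

(* Functions and functionals on S^T = R/TZ are handled through T-periodic
   functions on R; below, test is C^oo(S^T) and test2 is C_c^oo(]0,1[ x S^T).
   A functional is a total map on R -> Cplx R, of which only the values on
   smooth T-periodic functions are meaningful. *)
Definition functional (R : realType) : Type := (R -> Cplx R) -> Cplx R.
Definition distr_field (R : realType) : Type := R -> functional R.

Section Spaces.
Context {R : realType}.
Variables T gamma : R.

Local Notation mu := (@lebesgue_measure R).
Local Notation I01 := `](0:R), (1:R)[%classic.
Local Notation normc := (@Normc.normc R).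

Definition test (phi : R -> Cplx R) : Prop :=
  smooth phi /\ forall t, phi (t + T) = phi t.

(* The topology of C^oo(S^T) is given by the seminorms
   max_(j <= N) sup_t |phi^(j)(t)|; in the continuity clause M stands for an
   arbitrary upper bound of the seminorm. *)
Definition distribution (u : functional R) : Prop :=
  (forall (a : Cplx R) phi psi, test phi -> test psi ->
     u (fun t => a * phi t + psi t) = a * u phi + u psi) /\
  (exists (K : R) (N : nat), forall phi (M : R), test phi ->
     (forall j t, (j <= N)%N -> normc (cderive j phi t) <= M) ->
     normc (u phi) <= K * M).

Definition eq_distr (u v : functional R) : Prop :=
  forall phi, test phi -> u phi = v phi.

(* The distribution defined by a function; no factor 1/T, in agreement with
   the weight 1/T in the norms below. *)
Definition distr_of (f : R -> Cplx R) : functional R :=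
  fun phi => cintegral `[0, T]%classic (fun t => f t * phi t).

Definition omega : R := 2 * pi / T.

Definition expfun (k : int) : R -> Cplx R :=
  fun t => cos (k%:~R * omega * t) +i* sin (k%:~R * omega * t).

Definition weight (k : int) : R := (1 + k%:~R ^+ 2) `^ gamma.

Definition Hnorm2 (u : functional R) : \bar R :=
  ((T^-1)%:E * \esum_(k in [set: int])
     (weight k * normc (u (expfun (- k))) ^+ 2)%:E)%E.

Definition Hgamma (u : functional R) : Prop :=
  distribution u /\ (Hnorm2 u < +oo)%E.

(* Bochner measurability of maps ]0,1[ -> H^gamma(S^T).  The measurable sets
   are the Borel sets and lebesgue_measure is not complete, so convergence is
   required at every x rather than almost everywhere; every class of maps
   modulo equality a.e. has such a representative. *)
Definition Hsimple (s : distr_field R) : Prop :=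
  exists (n : nat) (A : 'I_n -> set R) (h : 'I_n -> functional R),
    [/\ forall i, measurable (A i), forall i, Hgamma (h i) &
        forall x, I01 x -> forall phi,
          s x phi = \sum_(i < n | x \in A i) h i phi].

Definition Hmeasurable (u : distr_field R) : Prop :=
  exists s : nat -> distr_field R,
    (forall n, Hsimple (s n)) /\
    (forall x, I01 x ->
       Hnorm2 (fun phi => u x phi - s n x phi) @[n --> \oo] --> 0%E).

Definition H0norm2 (u : distr_field R) : \bar R :=
  ((T^-1)%:E * \esum_(k in [set: int])
     ((weight k)%:E *
      \int[mu]_(x in I01) (normc (u x (expfun (- k))) ^+ 2)%:E))%E.

(* Elements of H^(0,gamma) = L^2(0,1;H^gamma(S^T)) are represented by
   everywhere defined Borel maps; eq_field is equality of the classes. *)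
Definition H0gamma (u : distr_field R) : Prop :=
  [/\ forall x, I01 x -> Hgamma (u x), Hmeasurable u & (H0norm2 u < +oo)%E].

Definition eq_field (u v : distr_field R) : Prop :=
  {ae mu, forall x, I01 x -> eq_distr (u x) (v x)}.

Definition test2 (phi : R -> R -> Cplx R) : Prop :=
  [/\ smooth2 phi, forall x t, phi x (t + T) = phi x t &
      exists a b : R, [/\ 0 < a, b < 1 &
        forall x t, phi x t != 0 -> a <= x <= b]].

Definition pairing2 (u : distr_field R) (phi : R -> R -> Cplx R) : Cplx R :=
  cintegral I01 (fun x => u x (phi x)).

Definition gen_dt (u : distr_field R) (phi : R -> R -> Cplx R) : Cplx R :=
  - pairing2 u (pderive_t phi).

Definition gen_dx (u : distr_field R) (phi : R -> R -> Cplx R) : Cplx R :=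
  - pairing2 u (pderive_x phi).

(* f = dt u + c dx u as distributions on ]0,1[ x S^T; used with c = 1, -1 *)
Definition is_transport (c : R) (u f : distr_field R) : Prop :=
  forall phi, test2 phi -> pairing2 f phi = gen_dt u phi + c%:C * gen_dx u phi.

(* The element dt u + c dx u of H^(0,gamma), unique up to eq_field when it
   exists; 0 otherwise. *)
Definition transport (c : R) (u : distr_field R) : distr_field R :=
  xget (fun _ _ => 0) [set f | H0gamma f /\ is_transport c u f].

Definition Wgamma (w : distr_field R * distr_field R) : Prop :=
  H0gamma w.1 /\ H0gamma w.2.

Definition Wnorm2 (w : distr_field R * distr_field R) : \bar R :=
  (H0norm2 w.1 + H0norm2 w.2)%E.

Definition eq_W (w w' : distr_field R * distr_field R) : Prop :=
  eq_field w.1 w'.1 /\ eq_field w.2 w'.2.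

Definition Vgamma (w : distr_field R * distr_field R) : Prop :=
  Wgamma w /\ exists z, [/\ Wgamma z, is_transport 1 w.1 z.1 &
                            is_transport (-1) w.2 z.2].

Definition Vnorm (w : distr_field R * distr_field R) : R :=
  Num.sqrt (fine (Wnorm2 w + Wnorm2 (transport 1 w.1, transport (-1) w.2))%E).

Definition lin_W (a : Cplx R) (w w' : distr_field R * distr_field R) : distr_field R * distr_field R :=
  (fun x phi => a * w.1 x phi + w'.1 x phi,
   fun x phi => a * w.2 x phi + w'.2 x phi).

Local Notation strip := [set p : R * R | 0 <= p.1 <= 1].

(* Bounded continuous functions on [0,1] x R that are T-periodic in t; values
   outside the strip are irrelevant. *)
Definition Cper (f : R -> R -> Cplx R) : Prop :=
  [/\ {within strip, continuous (fun p : R * R => f p.1 p.2)},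
      forall x t, 0 <= x <= 1 -> f x (t + T) = f x t &
      exists M : R, forall x t, 0 <= x <= 1 -> normc (f x t) <= M].

Definition Cnorm (f : R -> R -> Cplx R) : R :=
  sup [set normc (f p.1 p.2) | p in strip].

Definition eq_strip (f g : R -> R -> Cplx R) : Prop :=
  forall x t, 0 <= x <= 1 -> f x t = g x t.

(* u and f define the same element of L^2(0,1;C^oo(S^T)^* ) *)
Definition represents (f : R -> R -> Cplx R) (u : distr_field R) : Prop :=
  eq_field u (fun x => distr_of (f x)).

End Spaces.

(* V^gamma is a subset of C^2 (each class has a representative in C^2), and
   the inclusion J is a well-defined injective linear bounded map; C^2 carries
   the maximum of the two supremum norms. *)
Definition V_continuously_embedded_in_C2 (R : realType) (T gamma : R) : Prop :=
  exists J : distr_field R * distr_field R -> (R -> R -> Cplx R) * (R -> R -> Cplx R),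
  [/\ forall w, Vgamma T gamma w ->
        [/\ Cper T (J w).1, Cper T (J w).2,
            represents T (J w).1 w.1 & represents T (J w).2 w.2],
      forall (a : Cplx R) w w', Vgamma T gamma w -> Vgamma T gamma w' ->
        eq_strip (J (lin_W a w w')).1
                 (fun x t => a * (J w).1 x t + (J w').1 x t) /\
        eq_strip (J (lin_W a w w')).2
                 (fun x t => a * (J w).2 x t + (J w').2 x t),
      forall w w', Vgamma T gamma w -> Vgamma T gamma w' ->
        (eq_strip (J w).1 (J w').1 /\ eq_strip (J w).2 (J w').2
          <-> eq_W T w w') &
      exists K : R, forall w, Vgamma T gamma w ->
        Num.max (Cnorm (J w).1) (Cnorm (J w).2) <= K * Vnorm T gamma w].

(* Main.v *)
Require Import Defs.
From mathcomp Require Import ring lra zify measurable_realfun.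
Import Order.TTheory GRing.Theory Num.Theory.
Import numFieldNormedType.Exports.

Set Implicit Arguments.
Unset Strict Implicit.
Unset Printing Implicit Defensive.

Local Open Scope ring_scope.
Local Open Scope classical_set_scope.

(** Why the embedding holds.

    Let u be one component, with Fourier modes u_k(x) in the time variable, let f
    be the function with d_t u + c d_x u = f, where c = 1 or c = -1, and let f_k
    be its modes.  Along the characteristics the equation becomes an ordinary one:
    v = e^(i k omega c x) u_k satisfies v' = c e^(i k omega c x) f_k in the
    generalized sense on ]0,1[ (transport_mode: test with a cut-off in x times
    an exponential in x and t; the zeroth order terms cancel because c^2 = 1).
    A function with integrable generalized derivative is almost everywhere a
    primitive of it (weak_derivative_primitive: test with smoothed indicators of
    intervals whose ends are Lebesgue points).  So u_k has a continuous
    representative g_k, and |g_k(x)| <= |g_k(y)| + 2 int |f_k| for all x, y.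

    Integrating in y and applying Young's inequality with a free scale s > 0 gives
    |g_k| <= 2 s (int |u_k|^2 + int |f_k|^2) + 2/s  (mode_representative).
    With s = l (1+k^2)^gamma the first parts sum to 2 l T (|u|^2 + |f|^2) in the
    norms of H^(0,gamma), and the second parts sum to a constant over l since
    the inverse weights are summable.  The series T^-1 sum_k g_k(x) e^(i k omega t) therefore converges
    uniformly, to a continuous T-periodic function J u, and l = 1/V, with V the
    norm in V^gamma, bounds its supremum by a multiple of V (Jfun_norm).

    It remains to see that J u is u.  For almost every x, the distribution u(x)
    and the function J u(x, .) have the same Fourier coefficients
    (Jfun_coefficient), and a distribution on the circle is determined by
    its coefficients (distribution_ext): it has finite order, and the Fejér means
    of a test function converge to it uniformly with all derivatives
    (fejer_approx, fejer_derive1n).  Linearity and injectivity of J follow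
    from the uniqueness of the continuous representatives g_k on [0,1]. *)

(** * Smooth functions of one real variable *)

Section RealSmooth.
Context {R : realType}.
Implicit Types f g : R -> R.

(** A record rather than the quantified statement itself, which unification
    would unfold in every side condition. *)
Record rsmooth f : Prop := Rsmooth
  { rsmooth_derivable : forall n (t : R), derivable f^`(n) t 1 }.

Lemma is_derive_derive1 f df :
  (forall x : R, is_derive x (1 : R) f (df x)) -> f^`() = df.
Proof. by move=> h; apply/funext => x; rewrite derive1E; have [_ ->] := h x. Qed.

(** A class of functions that is stable under differentiation consists of
    smooth functions; for products, flat functions and trigonometric functions
    such a class is exhibited below. *)
Lemma rsmooth_coind (P : (R -> R) -> Prop) :
  (forall f, P f -> exists df, P df /\ forall x : R, is_derive x (1 : R) f (df x)) ->
  forall f, P f -> rsmooth f.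
Proof.
move=> PP f Pf; constructor=> n; elim: n f Pf => [|n IH] f /PP[df [Pdf fdf]] t.
  by have := fdf t; rewrite derive1n0 => -[].
by rewrite derive1Sn (is_derive_derive1 fdf); exact: IH.
Qed.

Lemma rsmooth_is_derive f (x : R) : rsmooth f -> is_derive x (1 : R) f (f^`() x).
Proof.
by case=> /(_ 0%N x); rewrite derive1n0 derive1E => h; exact: DeriveDef.
Qed.

Lemma rsmooth_derive1 f : rsmooth f -> rsmooth f^`().
Proof. by case=> sf; constructor=> n t; rewrite -derive1Sn; exact: sf. Qed.

Lemma rsmooth_derive1n n f : rsmooth f -> rsmooth f^`(n).
Proof.
move=> sf; elim: n => [|n IH]; first by rewrite derive1n0.
by rewrite derive1nS; exact: rsmooth_derive1.
Qed.

Lemma rsmooth_continuous f : rsmooth f -> continuous f.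
Proof.
move=> sf x; apply: differentiable_continuous; apply/derivable1_diffP.
by have := rsmooth_is_derive x sf => -[].
Qed.

Lemma rsmooth_primitive f df : (forall x : R, is_derive x (1 : R) f (df x)) ->
  rsmooth df -> rsmooth f.
Proof.
move=> fdf [sdf]; constructor=> -[|n] t; first by rewrite derive1n0; have [] := fdf t.
by rewrite derive1Sn (is_derive_derive1 fdf); exact: sdf.
Qed.

Inductive smooth_algebra : (R -> R) -> Prop :=
| SmoothGen f of rsmooth f : smooth_algebra f
| SmoothAdd f g of smooth_algebra f & smooth_algebra g :
    smooth_algebra (fun x => f x + g x)
| SmoothMul f g of smooth_algebra f & smooth_algebra g :
    smooth_algebra (fun x => f x * g x).

(** The Leibniz rule keeps the derivatives of sums and products of smooth
    functions inside the algebra that smooth functions generate. *)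
Lemma smooth_algebra_rsmooth f : smooth_algebra f -> rsmooth f.
Proof.
apply: rsmooth_coind => {}f; elim=> {f} [f sf|f g _ [df [Pf fdf]] _ [dg [Pg gdg]]
  |f g Pf' [df [Pf fdf]] Pg' [dg [Pg gdg]]].
- exists f^`(); split; first by apply: SmoothGen; exact: rsmooth_derive1.
  by move=> x; exact: rsmooth_is_derive.
- exists (fun x => df x + dg x); split; first exact: SmoothAdd.
  by move=> x; exact: is_deriveD.
- exists (fun x => f x * dg x + g x * df x); split.
    by apply: SmoothAdd; exact: SmoothMul.
  by move=> x; exact: is_deriveM.
Qed.

Lemma rsmoothD f g : rsmooth f -> rsmooth g -> rsmooth (fun x => f x + g x).
Proof.
by move=> sf sg; apply: smooth_algebra_rsmooth; apply: SmoothAdd; exact: SmoothGen.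
Qed.

Lemma rsmoothM f g : rsmooth f -> rsmooth g -> rsmooth (fun x => f x * g x).
Proof.
by move=> sf sg; apply: smooth_algebra_rsmooth; apply: SmoothMul; exact: SmoothGen.
Qed.

Lemma rsmooth_cst (a : R) : rsmooth (fun _ => a).
Proof.
apply: (@rsmooth_coind (fun f => exists a, f = fun=> a)); last by exists a.
move=> _ [b ->]; exists (fun=> 0); split; first by exists 0.
by move=> x; exact: is_derive_cst.
Qed.

Lemma rsmoothN f : rsmooth f -> rsmooth (fun x => - f x).
Proof.
move=> sf; have -> : (fun x => - f x) = (fun x => -1 * f x).
  by apply/funext => x; rewrite mulN1r.
exact/rsmoothM/sf/rsmooth_cst.
Qed.

Lemma rsmoothB f g : rsmooth f -> rsmooth g -> rsmooth (fun x => f x - g x).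
Proof. by move=> sf sg; apply: rsmoothD => //; exact: rsmoothN. Qed.

Lemma is_derive_scale (a x df : R) f : is_derive x (1 : R) f df ->
  is_derive x (1 : R) (fun y => a * f y) (a * df).
Proof. by move=> h; exact: (is_deriveZ a h). Qed.

Lemma is_derive_affine (a b x : R) : is_derive x (1 : R) (fun x => a * x + b) a.
Proof.
have h1 : is_derive x (1 : R) (fun x : R => a * x) (a * 1).
  exact: is_derive_scale (is_derive_id x 1).
have h2 : is_derive x (1 : R) (fun=> b) 0 by exact: is_derive_cst.
by have := is_deriveD h1 h2; rewrite mulr1 addr0.
Qed.

Lemma is_derive_comp_affine f (a b x df : R) : is_derive (a * x + b) (1 : R) f df ->
  is_derive x (1 : R) (fun x => f (a * x + b)) (a * df).
Proof.
move=> h; rewrite mulrC.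
exact: (@is_derive1_comp R f (fun x => a * x + b) x df a h (is_derive_affine a b x)).
Qed.

Lemma rsmooth_comp_affine f (a b : R) : rsmooth f -> rsmooth (fun x => f (a * x + b)).
Proof.
move=> sf; apply: (@rsmooth_coind (fun h => exists g c, rsmooth g /\
    h = fun x => c * g (a * x + b))); last first.
  by exists f, 1; split=> //; apply/funext => x; rewrite mul1r.
move=> _ [g [c [sg ->]]]; exists (fun x => c * a * g^`()%classic (a * x + b)); split.
  by exists g^`(), (c * a); split=> //; exact: rsmooth_derive1.
move=> x; rewrite -mulrA.
have h := is_derive_comp_affine (rsmooth_is_derive (a * x + b) sg).
exact: is_derive_scale h.
Qed.

Lemma rsmooth_sum (I : Type) (s : seq I) (F : I -> R -> R) :
  (forall i, rsmooth (F i)) -> rsmooth (fun t => \sum_(i <- s) F i t).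
Proof.
move=> sF; elim: s => [|i s IH].
  by rewrite (_ : (fun _ => _) = fun=> 0); [exact: rsmooth_cst|apply/funext=> t; rewrite big_nil].
rewrite (_ : (fun _ => _) = fun t => F i t + \sum_(j <- s) F j t).
  exact: rsmoothD.
by apply/funext=> t; rewrite big_cons.
Qed.

Lemma is_derive_cosM (c x : R) :
  is_derive x (1 : R) (fun x => cos (c * x)) (- (c * sin (c * x))).
Proof.
have h := is_derive_comp_affine (is_derive_cos (c * x + 0)).
rewrite -mulrN; rewrite addr0 in h.
by rewrite (_ : (fun _ => _) = fun x => cos (c * x + 0))//;
  apply/funext=> y; rewrite addr0.
Qed.

Lemma is_derive_sinM (c x : R) :
  is_derive x (1 : R) (fun x => sin (c * x)) (c * cos (c * x)).
Proof.
have h := is_derive_comp_affine (is_derive_sin (c * x + 0)).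
rewrite addr0 in h.
by rewrite (_ : (fun _ => _) = fun x => sin (c * x + 0))//;
  apply/funext=> y; rewrite addr0.
Qed.

Lemma is_derive_trig (a b c x : R) :
  is_derive x (1 : R) (fun x => a * cos (c * x) + b * sin (c * x))
    ((c * b) * cos (c * x) + (- (c * a)) * sin (c * x)).
Proof.
have h1 := is_derive_scale a (is_derive_cosM c x).
have h2 := is_derive_scale b (is_derive_sinM c x).
have := is_deriveD h1 h2; rewrite /GRing.scale/=.
by rewrite (_ : a * _ + b * _ = (c * b) * cos (c * x) + - (c * a) * sin (c * x))//; ring.
Qed.

Lemma rsmooth_trig (a b c : R) : rsmooth (fun x => a * cos (c * x) + b * sin (c * x)).
Proof.
apply: (@rsmooth_coind (fun f => exists a b, f = fun x => a * cos (c * x) + b * sin (c * x)));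
  last by exists a, b.
move=> _ [d [e ->]]; eexists; split; last by move=> x; exact: is_derive_trig.
by exists (c * e), (- (c * d)).
Qed.

Lemma rsmooth_cos (c : R) : rsmooth (fun x => cos (c * x)).
Proof.
rewrite (_ : (fun _ => _) = fun x => 1 * cos (c * x) + 0 * sin (c * x)).
  exact: rsmooth_trig.
by apply/funext=> x; rewrite mul1r mul0r addr0.
Qed.

Lemma rsmooth_sin (c : R) : rsmooth (fun x => sin (c * x)).
Proof.
rewrite (_ : (fun _ => _) = fun x => 0 * cos (c * x) + 1 * sin (c * x)).
  exact: rsmooth_trig.
by apply/funext=> x; rewrite mul1r mul0r add0r.
Qed.

End RealSmooth.

Section FlatFunction.
Context {R : realType}.

(** The functions whose derivatives at 0 all vanish by exponential decay; the
    polynomial factor makes the family stable under differentiation. *)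
Definition flat (p : {poly R}) (x : R) : R :=
  if 0 < x then p.[x^-1] * expR (- x^-1) else 0.

(** Coefficientwise, y^n <= n! e^y. *)
Lemma horner_le_expR (p : {poly R}) :
  exists C : R, 0 <= C /\ forall y, 0 <= y -> `|p.[y]| <= C * expR y.
Proof.
exists (\sum_(i < size p) `|p`_i| * (i`!)%:R); split.
  by apply: sumr_ge0 => i _; rewrite mulr_ge0.
move=> y y0; rewrite horner_coef (le_trans (ler_norm_sum _ _ _))//.
rewrite mulr_suml; apply: ler_sum => i _; rewrite normrM normrX (ger0_norm y0).
rewrite -mulrA ler_wpM2l//; case: (nat_of_ord i) => [|n].
  by rewrite expr0 fact0 mul1r -expR0 ler_expR.
have := expR_ge1Dxn n y0 => h.
have h2 : y ^+ n.+1 / (n.+1)`!%:R <= expR y by lra.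
by move: h2; rewrite ler_pdivrMr ?ltr0n ?fact_gt0// mulrC.
Qed.

(** By the exponential bound applied to p X, flat p is even O(x) at 0. *)
Lemma flat_continuous0 (p : {poly R}) : {for (0 : R), continuous (flat p)}.
Proof.
have [C [C0 hC]] := horner_le_expR (p * 'X).
have hf x : `|flat p x| <= C * `|x|.
  rewrite /flat; case: ifPn => x0; last by rewrite normr0 mulr_ge0.
  have := hC x^-1; rewrite hornerM hornerX invr_ge0 (ltW x0) => /(_ isT).
  have xV : 0 <= x^-1 by rewrite invr_ge0 ltW.
  rewrite normrM (ger0_norm xV) => h.
  rewrite normrM (ger0_norm (expR_ge0 _)) (gtr0_norm x0).
  move: h; rewrite ler_pdivrMr// => h.
  by rewrite expRN ler_pdivrMr ?expR_gt0// mulrAC.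
have f0 : flat p 0 = 0 by rewrite /flat ltxx.
rewrite /prop_for /continuous_at f0.
apply/cvgr0Pnorm_le => e e0; near=> x.
rewrite (le_trans (hf x))//.
have hx : `|x| <= e / (C + 1).
  near: x; apply: (@cvgr0_norm_le _ _ _ (nbhs (0 : R)) _ id); first exact: cvg_id.
  by rewrite divr_gt0// ltr_wpDl.
rewrite (le_trans (ler_wpM2l C0 hx))// mulrA ler_pdivrMr ?ltr_wpDl// mulrC ler_wpM2l//.
  exact: ltW.
by rewrite lerDl.
Unshelve. all: by end_near. Qed.

Lemma flat_is_derive (p : {poly R}) (x : R) :
  is_derive x (1 : R) (flat p) (flat ((p - p^`()) * 'X^2) x).
Proof.
have [x0|x0|x0] := ltgtP x 0.
- rewrite [X in is_derive _ _ _ X]/flat ltNge (ltW x0)/=.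
  apply: (@near_eq_is_derive _ _ _ (fun=> 0)).
  near=> y; rewrite /flat ltNge (_ : y <= 0)//.
  by near: y; exact: lt_le_nbhsl.
- rewrite [X in is_derive _ _ _ X]/flat x0.
  have hv : is_derive x (1 : R) (fun y => y^-1) (- x ^- 2).
    have := @is_deriveV R id x 1 1 (lt0r_neq0 x0) (is_derive_id _ _).
    by rewrite /GRing.scale/= mulr1.
  have h1 := is_derive1_comp (is_derive_poly p x^-1) hv.
  have hN := is_deriveN hv.
  have h2 := @is_derive1_comp R expR (- (fun y : R => y^-1)) x _ _ (is_derive_expR (- x^-1)) hN.
  have := is_deriveM h1 h2.
  rewrite (_ : _ *: _ + _ = ((p - p^`()) * 'X^2).[x^-1] * expR (- x^-1)) //.
    move=> hd; apply: (near_eq_is_derive _ hd).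
    near=> y; rewrite /flat (_ : 0 < y)//.
    by near: y; exact: lt_nbhsr.
  rewrite hornerM hornerXn hornerD hornerN /GRing.scale/= exprVn; ring.
- rewrite x0 [X in is_derive _ _ _ X]/flat ltxx; apply/is_derive1_caratheodory.
  (* the difference quotient at 0 belongs to the same family *)
  exists (flat (p * 'X)); split.
  + move=> z; rewrite subr0 {2}/flat ltxx subr0 /flat; case: ifPn; last by rewrite mul0r.
    move=> z0; rewrite hornerM hornerX; have z1 := lt0r_neq0 z0.
    set e := expR _; set q := p.[_]; rewrite (_ : q * z^-1 * e * z = q * e * (z^-1 * z)); last by ring.
    by rewrite mulVf ?mulr1.
  + exact: flat_continuous0.
  + by rewrite /flat ltxx.
Unshelve. all: by end_near. Qed.

Lemma rsmooth_flat p : rsmooth (flat p).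
Proof.
apply: (@rsmooth_coind _ (fun f => exists p, f = flat p)); last by exists p.
move=> _ [q ->]; exists (flat ((q - q^`()) * 'X^2)); split; first by eexists.
by move=> x; exact: flat_is_derive.
Qed.

(** The two factors switch off smoothly at -1 and at 1. *)
Definition bump (x : R) : R := flat 1 (1 + x) * flat 1 (1 - x).

Lemma rsmooth_bump : rsmooth bump.
Proof.
have h := rsmoothM (rsmooth_comp_affine 1 1 (rsmooth_flat 1)) (rsmooth_comp_affine (-1) 1 (rsmooth_flat 1)).
rewrite (_ : bump = fun x => flat 1 (1 * x + 1) * flat 1 (-1 * x + 1))//.
by apply/funext => x; rewrite /bump; congr (flat _ _ * flat _ _); ring.
Qed.

Lemma bump_ge0 x : 0 <= bump x.
Proof.
rewrite /bump /flat; do 2 case: ifPn => _; rewrite ?mulr0 ?mul0r// !hornerC !mul1r.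
by rewrite mulr_ge0 ?expR_ge0.
Qed.

Lemma bump_out x : 1 <= `|x| -> bump x = 0.
Proof.
rewrite /bump /flat; do 2 case: ifPn; rewrite ?mulr0 ?mul0r//.
by move=> h1 h2; rewrite ler_normr; case/orP; lra.
Qed.

Lemma bump0_gt0 : 0 < bump 0.
Proof.
by rewrite /bump /flat addr0 subr0 ltr01 !hornerC !mul1r mulr_gt0 ?expR_gt0.
Qed.

Lemma bump_ubound : exists C : R, 0 < C /\ forall x, bump x <= C.
Proof.
have fle1 x : 0 <= flat 1 x <= 1.
  rewrite /flat; case: ifPn => x0; last by rewrite lexx ler01.
  by rewrite hornerC mul1r expR_ge0 -expR0 ler_expR oppr_le0 invr_ge0 ltW.
exists 1; split=> // x; rewrite /bump -[leRHS]mulr1.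
by apply: ler_pM; case/andP: (fle1 (1 + x)) (fle1 (1 - x)) => ? ? /andP[].
Qed.

End FlatFunction.

(** * Weak derivatives on an interval *)

Section RealIntegrals.
Context {R : realType}.
Local Notation mu := (@lebesgue_measure R).
Implicit Types (f g : R -> R) (D : set R).

Lemma ae_imp (P Q : set R) : (forall x, P x -> Q x) ->
  {ae mu, forall x, P x} -> {ae mu, forall x, Q x}.
Proof. by move=> PQ; apply: filterS; first exact: (ae_filter_ringOfSetsType mu). Qed.

Lemma ae_and (P Q : set R) : {ae mu, forall x, P x} -> {ae mu, forall x, Q x} ->
  {ae mu, forall x, P x /\ Q x}.
Proof. by move=> aP aQ; apply: filterI => //; exact: (ae_filter_ringOfSetsType mu). Qed.

Lemma ae_forall_nat (P : nat -> set R) : (forall n, {ae mu, forall x, P n x}) ->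
  {ae mu, forall x, forall n, P n x}.
Proof.
move=> aP; have := negligible_bigcup aP; apply: negligibleS => x /= nP.
by apply: contrapT => h; apply: nP => n; apply: contrapT => nPn; apply: h; exists n.
Qed.

Lemma integrable_mul_bounded D f g (M : R) : measurable D ->
  mu.-integrable D (EFin \o f) -> measurable_fun D g ->
  (forall x, D x -> `|g x| <= M) ->
  mu.-integrable D (EFin \o (fun x => f x * g x)).
Proof.
move=> mD fi mg gM.
have := @integrableMl _ _ R mu D mD (EFin \o f) g fi mg.
rewrite (_ : ((EFin \o f) \* (EFin \o g))%E = EFin \o (fun x => f x * g x)); last first.
  by apply/funext => x /=; rewrite EFinM.
apply; exists M; split; first exact: num_real.
by move=> y My x Dx; exact: le_trans (gM _ Dx) (ltW My).
Qed.

Lemma integrable_scale D f (c : R) : measurable D ->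
  mu.-integrable D (EFin \o f) -> mu.-integrable D (EFin \o (fun x => c * f x)).
Proof.
move=> mD fi; rewrite (_ : EFin \o _ = (fun x => c%:E * (EFin \o f) x)%E).
  exact: integrableZl.
by apply/funext => x /=; rewrite EFinM.
Qed.

Lemma integrable_add D f g : measurable D ->
  mu.-integrable D (EFin \o f) -> mu.-integrable D (EFin \o g) ->
  mu.-integrable D (EFin \o (fun x => f x + g x)).
Proof.
move=> mD fi gi; rewrite (_ : EFin \o _ = (fun x => (EFin \o f) x + (EFin \o g) x)%E).
  exact: integrableD.
by apply/funext => x /=; rewrite EFinD.
Qed.

Lemma integrable_continuous_itv f (a b : R) : continuous f ->
  mu.-integrable `[a, b] (EFin \o f).
Proof.
move=> cf; apply: continuous_compact_integrable; first exact: segment_compact.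
exact: continuous_subspaceT.
Qed.

Lemma continuous_measurable f D : continuous f -> measurable D -> measurable_fun D f.
Proof. by move=> cf mD; apply: measurable_funS (continuous_measurable_fun cf). Qed.

Lemma Rintegral_change_domain D D' f :
  (forall x, D x -> ~ D' x -> f x = 0) -> (forall x, D' x -> ~ D x -> f x = 0) ->
  \int[mu]_(x in D) f x = \int[mu]_(x in D') f x.
Proof.
move=> h1 h2; rewrite Rintegral_mkcond [RHS]Rintegral_mkcond.
apply: eq_Rintegral => x _; rewrite /patch.
case: ifPn => [/set_mem Dx|/negP nD]; case: ifPn => [/set_mem D'x|/negP nD'] //.
  by apply: h1 => // ?; apply: nD'; exact/mem_set.
by apply/esym/h2 => // ?; apply: nD; exact/mem_set.
Qed.

Lemma derivable_oo_LR (F : R -> R) (a b : R) : (forall x : R, derivable F x 1) ->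
  derivable_oo_LRcontinuous F a b.
Proof.
move=> dF; have cF : continuous F.
  by move=> x; apply: differentiable_continuous; apply/derivable1_diffP.
by split=> //; [exact/cvg_at_right_filter/cF|exact/cvg_at_left_filter/cF].
Qed.

Lemma Rintegral_FTC f (F : R -> R) (a b : R) : a <= b -> continuous f ->
  (forall x : R, is_derive x (1 : R) F (f x)) ->
  \int[mu]_(x in `[a, b]) f x = F b - F a.
Proof.
rewrite le_eqVlt => /predU1P[->|ab] cf dF.
  by rewrite set_itv1 Rintegral_set1 subrr.
rewrite /Rintegral (@continuous_FTC2 _ f F)//.
- exact: continuous_subspaceT.
- by apply: derivable_oo_LR => x; have [] := dF x.
- by move=> x _; rewrite (is_derive_derive1 dF).
Qed.

Lemma Rintegral_FTC_oo f (F : R -> R) (a b : R) : a <= b -> continuous f ->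
  (forall x : R, is_derive x (1 : R) F (f x)) ->
  \int[mu]_(x in `]a, b[) f x = F b - F a.
Proof.
move=> ab cf dF; rewrite -(Rintegral_FTC ab cf dF).
rewrite Rintegral_itv_bndo_bndc; last first.
  by apply: integrableS (integrable_continuous_itv a b cf) => //;
    apply: subset_itv; rewrite bnd_simp.
rewrite Rintegral_itv_obnd_cbnd//.
  by apply: integrableS (integrable_continuous_itv a b cf) => //;
    apply: subset_itv; rewrite bnd_simp.
Qed.

End RealIntegrals.

Section SmoothStep.
Context {R : realType}.
Local Notation mu := (@lebesgue_measure R).

Let bump_cont : continuous (@bump R).
Proof. exact/rsmooth_continuous/rsmooth_bump. Qed.

Let bump_int (D : set R) : measurable D -> mu.-integrable D (EFin \o bump).
Proof.
move=> mD; apply: (@integrableS _ _ _ _ setT) => //.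
have mI : measurable (`[-1, 1]%classic : set R) by [].
have := (integrable_mkcond (mu := mu) (EFin \o @bump R) mI).1
  (integrable_continuous_itv (-1) 1 bump_cont).
rewrite (_ : (EFin \o @bump R) \_ `[-1, 1] = EFin \o @bump R)//; apply/funext => x; rewrite /patch; case: ifPn => // /negP xI.
rewrite /= bump_out// leNgt; apply/negP => x1; apply: xI.
by apply/mem_set; rewrite /= in_itv/=; move: x1; rewrite ltr_norml => /andP[/ltW -> /ltW ->].
Qed.

Definition bump_mass : R := \int[mu]_(x in `]-oo, 1]) bump x.
Definition step0 (x : R) : R := \int[mu]_(t in `]-oo, x]) bump t.

Lemma step0_is_derive (x : R) : is_derive x (1 : R) step0 (bump x).
Proof.
have x1 : x < x + 1 by rewrite ltrDl.
have mx : measurable [set` Interval -oo%O (BRight (x + 1))] by [].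
have [h1 h2] := continuous_FTC1 x1 (bump_int mx) (ltNyr x) (@bump_cont x).
by rewrite -h2 derive1E; exact: DeriveDef.
Qed.

Lemma step0_left x : x <= -1 -> step0 x = 0.
Proof.
move=> x1; rewrite /step0 (@eq_Rintegral _ _ _ _ _ (fun=> 0)) ?Rintegral_cst ?mul0r//.
move=> t /set_mem/=; rewrite in_itv/= => tx; rewrite bump_out//.
by rewrite ler_normr; apply/orP; right; lra.
Qed.

Lemma step0_right x : 1 <= x -> step0 x = bump_mass.
Proof.
move=> x1; apply: Rintegral_change_domain => t /=; rewrite !in_itv/= => h1 /negP.
  by rewrite -ltNge => h2; rewrite bump_out// ler_normr; apply/orP; left; lra.
by rewrite -ltNge; lra.
Qed.

Lemma step0_homo : {homo step0 : x y / x <= y}.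
Proof.
move=> x y xy; rewrite -subr_ge0 /step0 Rintegral_itvB//.
- by apply: Rintegral_ge0 => t _; exact: bump_ge0.
- exact: bump_int.
Qed.

Lemma step0_ge0 x : 0 <= step0 x.
Proof. by apply: Rintegral_ge0 => t _; exact: bump_ge0. Qed.

(** If the mass were 0, the monotone primitive would vanish near 0, and so would
    its derivative, the bump. *)
Lemma bump_mass_gt0 : 0 < bump_mass.
Proof.
rewrite lt_neqAle -{2}(step0_right (lexx 1)) step0_ge0 andbT; apply/eqP => m0.
have h : \forall y \near (0 : R), (fun=> 0) y = step0 y.
  near=> x; apply/esym/eqP; rewrite eq_le step0_ge0 andbT m0 -(step0_right (lexx 1)).
  apply: step0_homo; near: x; exact: lt_le_nbhsl.
have [_ e] := step0_is_derive 0.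
have b0 : bump (0 : R) = 0 by rewrite -[LHS]e -(near_eq_derive (1 : R) h) derive_cst.
by have := @bump0_gt0 R; rewrite b0 ltxx.
Unshelve. all: by end_near. Qed.

(** The normalized primitive of the bump: a smooth Heaviside function. *)
Definition step (x : R) : R := bump_mass^-1 * step0 x.
Definition rho (x : R) : R := bump_mass^-1 * bump x.

Lemma rsmooth_rho : rsmooth rho.
Proof. by apply: rsmoothM; [exact: rsmooth_cst|exact: rsmooth_bump]. Qed.

Lemma step_is_derive (x : R) : is_derive x (1 : R) step (rho x).
Proof. exact: is_derive_scale (step0_is_derive x). Qed.

Lemma rsmooth_step : rsmooth step.
Proof. exact: rsmooth_primitive step_is_derive rsmooth_rho. Qed.

Lemma step_left x : x <= -1 -> step x = 0.
Proof. by move=> x1; rewrite /step step0_left// mulr0. Qed.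

Lemma step_right x : 1 <= x -> step x = 1.
Proof. by move=> x1; rewrite /step step0_right// mulVf// gt_eqF// bump_mass_gt0. Qed.

Lemma step_bounds x : 0 <= step x <= 1.
Proof.
have m0 := bump_mass_gt0; rewrite mulr_ge0 ?invr_ge0 ?step0_ge0 ?(ltW m0)//=.
have [x1|x1] := lerP 1 x; first by rewrite step_right.
rewrite -(step_right (lexx 1)) /step ler_pM2l ?invr_gt0//.
by apply: step0_homo; exact: ltW.
Qed.

Lemma rho_ge0 x : 0 <= rho x.
Proof. by rewrite mulr_ge0 ?bump_ge0// invr_ge0 ltW// bump_mass_gt0. Qed.

Lemma rho_out x : 1 <= `|x| -> rho x = 0.
Proof. by move=> x1; rewrite /rho bump_out// mulr0. Qed.

Lemma rho_ubound : exists C : R, 0 < C /\ forall x, rho x <= C.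
Proof.
have [C [C0 hC]] := @bump_ubound R; have m0 := bump_mass_gt0.
exists (bump_mass^-1 * C); split; first by rewrite mulr_gt0// invr_gt0.
by move=> x; rewrite ler_wpM2l// invr_ge0 ltW.
Qed.

End SmoothStep.

Section WeakDerivative.
Context {R : realType}.
Local Notation mu := (@lebesgue_measure R).
Local Notation I01 := `](0:R), (1:R)[%classic.

Definition stepat (a r x : R) : R := step (r^-1 * x + - (r^-1 * a)).
Definition kernel (a r x : R) : R := r^-1 * rho (r^-1 * x + - (r^-1 * a)).

Lemma stepat_is_derive (a r x : R) : is_derive x (1 : R) (stepat a r) (kernel a r x).
Proof. by apply: is_derive_comp_affine; exact: step_is_derive. Qed.

Lemma rsmooth_stepat (a r : R) : rsmooth (stepat a r).
Proof. by apply: rsmooth_comp_affine; exact: rsmooth_step. Qed.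

Lemma kernel_continuous (a r : R) : continuous (kernel a r).
Proof.
apply: rsmooth_continuous; apply: rsmoothM; first exact: rsmooth_cst.
by apply: rsmooth_comp_affine; exact: rsmooth_rho.
Qed.

Lemma stepat_left (a r x : R) : 0 < r -> x <= a - r -> stepat a r x = 0.
Proof.
move=> r0 xa; rewrite /stepat step_left// -mulrBr mulrC ler_pdivrMr//; lra.
Qed.

Lemma stepat_right (a r x : R) : 0 < r -> a + r <= x -> stepat a r x = 1.
Proof.
move=> r0 xa; rewrite /stepat step_right// -mulrBr mulrC ler_pdivlMr//; lra.
Qed.

Lemma stepat_bounds (a r x : R) : 0 <= stepat a r x <= 1.
Proof. exact: step_bounds. Qed.

Lemma kernel_ge0 (a r x : R) : 0 < r -> 0 <= kernel a r x.
Proof. by move=> r0; rewrite mulr_ge0 ?rho_ge0// invr_ge0 ltW. Qed.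

Lemma kernel_out (a r x : R) : 0 < r -> ~ ball a r x -> kernel a r x = 0.
Proof.
move=> r0 h; rewrite /kernel rho_out ?mulr0// -mulrBr normrM gtr0_norm ?invr_gt0//.
rewrite mulrC ler_pdivlMr// mul1r distrC leNgt; apply/negP => h'; exact: h.
Qed.

Lemma kernel_mass (a r : R) : 0 < r -> \int[mu]_(x in ball a r) kernel a r x = 1.
Proof.
move=> r0; have ar : a - r <= a + r by lra.
rewrite ball_itv (Rintegral_FTC_oo ar (@kernel_continuous a r) (stepat_is_derive a r)).
by rewrite stepat_right// stepat_left// subr0.
Qed.

(** The kernel is at most a multiple of 1/r on the ball of radius r, so the
    average against it is within a multiple of the mean oscillation. *)
Lemma mollify_davg : exists2 C : R, 0 < C & forall (v : R -> R) (a r : R) (D : set R),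
  0 < r -> measurable D -> ball a r `<=` D -> mu.-integrable D (EFin \o v) ->
  (`|\int[mu]_(x in D) (v x * kernel a r x) - v a|%:E <= C%:E * davg v a r)%E.
Proof.
have [C [C0 hC]] := @rho_ubound R.
exists (2 * C); first by rewrite mulr_gt0.
move=> v a r D r0 mD sub vi.
have mB : measurable (ball a r) by rewrite ball_itv.
have viB : mu.-integrable (ball a r) (EFin \o v) by exact: integrableS vi.
have mk : measurable_fun (ball a r) (kernel a r).
  exact: continuous_measurable (@kernel_continuous a r) mB.
have kB x : `|kernel a r x| <= C / r.
  rewrite ger0_norm ?kernel_ge0// /kernel mulrC ler_wpM2r// invr_ge0 ltW//.
have bfin : (mu (ball a r) < +oo)%E by rewrite lebesgue_measure_ball ?ltW// ltry.
have ci (c : R) : mu.-integrable (ball a r) (EFin \o (fun=> c)).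
  apply: measurable_bounded_integrable => //; exists `|c|; split; first exact: num_real.
  by move=> y cy x _ /=; exact: ltW.
have cen : mu.-integrable (ball a r) (EFin \o (fun x => v x - v a)).
  exact: integrableB viB (ci (v a)).
have cenN : mu.-integrable (ball a r) (EFin \o (fun x => `|v x - v a|)).
  exact: (integrable_norm cen).
have -> : \int[mu]_(x in D) (v x * kernel a r x) = \int[mu]_(x in ball a r) (v x * kernel a r x).
  apply: Rintegral_change_domain => x; first by move=> _ h; rewrite kernel_out// mulr0.
  by move=> /sub.
have -> : v a = \int[mu]_(x in ball a r) (v a * kernel a r x).
  rewrite RintegralZl// ?kernel_mass ?mulr1//.
  by have := integrable_mul_bounded mB (ci 1) mk (fun x _ => kB x);
    congr integrable; apply/funext => x /=; rewrite mul1r.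
rewrite -RintegralB//; last 2 first.
- exact: integrable_mul_bounded viB mk (fun x _ => kB x).
- exact: integrable_mul_bounded (ci (v a)) mk (fun x _ => kB x).
have ik : mu.-integrable (ball a r) (EFin \o (fun x => (v x - v a) * kernel a r x)).
  exact: integrable_mul_bounded cen mk (fun x _ => kB x).
have -> : davg v a r = ((r *+ 2)^-1 * \int[mu]_(x in ball a r) `|v x - v a|)%:E.
  rewrite /davg /iavg lebesgue_measure_ball ?(ltW r0)// EFinM inver mulrn_eq0/= (gt_eqF r0).
  by congr (_ * _)%E; rewrite /Rintegral fineK//; apply: integrable_fin_num.
rewrite -EFinM lee_fin.
rewrite (_ : \int[mu]_(x in ball a r) (_ - _) = \int[mu]_(x in ball a r) ((v x - v a) * kernel a r x));
  last by apply: eq_Rintegral => x _; rewrite mulrBl.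
apply: (le_trans (le_normr_Rintegral (mu := mu) mB ik)).
rewrite (_ : 2 * C * _ = C / r * \int[mu]_(x in ball a r) `|v x - v a|); last first.
  by rewrite mulrA -mulr_natl; congr (_ * _); field; exact: lt0r_neq0.
rewrite -RintegralZl//; apply: le_Rintegral => //.
- exact: integrable_norm ik.
- exact: integrable_scale.
- by move=> x _; rewrite normrM mulrC ler_wpM2r.
Qed.

(** The cut-off functions converge to the indicator of ]a, b] off two balls
    whose measure tends to 0; absolute continuity of the integral does the rest. *)
Lemma cutoff_integral (h : R -> R) (a b e : R) : mu.-integrable setT (EFin \o h) ->
  0 < a -> a < b -> b < 1 -> 0 < e ->
  exists2 d : R, 0 < d & forall r, 0 < r -> r < d ->
    `|\int[mu]_(x in I01) (h x * (stepat a r x - stepat b r x))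
      - \int[mu]_(x in `]a, b]) h x| <= e.
Proof.
move=> hi a0 ab b1 e0.
have e2 : 0 < e / 2 by rewrite divr_gt0.
have [d [d0 hd]] := integral_normr_continuous hi e2.
(* the two balls have total length 4 r < d, and both lie in the unit interval *)
exists (Num.min (d / 5) (Num.min a (1 - b))).
  by rewrite !lt_min divr_gt0//= a0 subr_gt0.
move=> r r0; rewrite !lt_min => /andP[rd /andP[ra rb]].
have mI : measurable (I01 : set R) by [].
have mab : measurable (`]a, b]%classic : set R) by [].
pose B := ball a r `|` ball b r.
have mB : measurable B by rewrite /B !ball_itv; exact: measurableU.
have BI : B `<=` I01.
  by move=> x; rewrite /B !ball_itv /= !in_itv/= => -[]; lra.
(* the error of the cut-off, which vanishes off the two balls *)
pose q x := stepat a r x - stepat b r x - \1_(`]a, b]) x.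
have q2 x : `|q x| <= 2.
  have := stepat_bounds a r x; have := stepat_bounds b r x.
  rewrite /q indicE ler_norml; case: (_ \in _) => /=; lra.
have mq : measurable_fun setT q.
  apply: measurable_funB; last exact: measurable_indic.
  by apply: measurable_funB; apply: continuous_measurable => //;
    exact/rsmooth_continuous/rsmooth_stepat.
have qout x : ~ B x -> q x = 0.
  rewrite /B !ball_itv /= !in_itv/= => nB.
  rewrite /q indicE (_ : (x \in `]a, b]%classic) = (a < x <= b)); last first.
    by apply/idP/idP => [/set_mem|?]; [|apply/mem_set]; rewrite /= in_itv.
  have [xa|ax] := leP x (a - r).
    rewrite !stepat_left//; last by lra.
    by rewrite (_ : (a < x) = false) ?subrr// ltNge; apply/negbF; lra.
  have {}ax : a + r <= x.
    by rewrite leNgt; apply/negP => ?; apply: nB; left; rewrite ax.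
  rewrite (stepat_right r0 ax) (_ : (a < x) = true)/=; last by lra.
  have [xb|bx] := leP x (b - r).
    by rewrite stepat_left// (_ : x <= b) ?subr0 ?subrr//; lra.
  have {}bx : b + r <= x.
    by rewrite leNgt; apply/negP => ?; apply: nB; right; rewrite bx.
  by rewrite stepat_right// (_ : (x <= b) = false) ?subrr// leNgt; apply/negbF; lra.
have hiI : mu.-integrable I01 (EFin \o h) by exact: integrableS hi.
have hiB : mu.-integrable B (EFin \o h) by exact: integrableS hi.
have hqi D : measurable D -> mu.-integrable D (EFin \o (fun x => h x * q x)).
  move=> mD; apply: (@integrableS _ _ _ _ setT) => //.
  exact: integrable_mul_bounded hi mq (fun x _ => q2 x).
have -> : \int[mu]_(x in `]a, b]) h x = \int[mu]_(x in I01) (h x * \1_(`]a, b]) x).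
  transitivity (\int[mu]_(x in `]a, b]) (h x * \1_(`]a, b]) x)).
    by apply: eq_Rintegral => x xab; rewrite indicE xab mulr1.
  apply: Rintegral_change_domain => x /=; rewrite !in_itv/=; first by lra.
  move=> _ nx; rewrite indicE (_ : (x \in _) = false) ?mulr0//.
  by apply/negbTE/negP => /set_mem/=; rewrite in_itv.
rewrite -RintegralB//; last 2 first.
- apply: integrable_mul_bounded hiI _ (_ : forall x, _ -> _ <= 1) => //.
    by apply: measurable_funB; apply: continuous_measurable => //;
      exact/rsmooth_continuous/rsmooth_stepat.
  move=> x _; have := stepat_bounds a r x; have := stepat_bounds b r x.
  by rewrite ler_norml; lra.
- apply: integrable_mul_bounded hiI _ (_ : forall x, _ -> _ <= 1) => //.
  by move=> x _; rewrite indicE; case: (_ \in _); rewrite ?normr1 ?normr0.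
rewrite (_ : \int[mu]_(x in I01) _ = \int[mu]_(x in I01) (h x * q x)); last first.
  by apply: eq_Rintegral => x _; rewrite -mulrBr.
apply: (le_trans (le_normr_Rintegral (mu := mu) mI (hqi _ mI))).
rewrite (@Rintegral_change_domain _ _ B); last 2 first.
- by move=> x _ /qout ->; rewrite mulr0 normr0.
- by move=> x /BI.
apply: (@le_trans _ _ (\int[mu]_(x in B) (2 * `|h x|))).
  apply: le_Rintegral => //.
  - exact: integrable_norm (hqi _ mB).
  - apply: integrable_scale => //; exact: integrable_norm hiB.
  - by move=> x _; rewrite normrM mulrC ler_wpM2r.
rewrite RintegralZl//; last exact: integrable_norm hiB.
rewrite mulrC -ler_pdivlMr//; apply/ltW/hd => //.
apply: (@le_lt_trans _ _ (mu (ball a r) + mu (ball b r))%E).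
  by apply: measureU2; rewrite ball_itv.
rewrite !lebesgue_measure_ball ?(ltW r0)// -EFinD lte_fin.
by rewrite !mulr2n; lra.
Qed.

End WeakDerivative.

Section WeakPrimitive.
Context {R : realType}.
Local Notation mu := (@lebesgue_measure R).
Local Notation I01 := `](0:R), (1:R)[%classic.

Definition cutoff (chi : R -> R) : Prop :=
  rsmooth chi /\
  exists a b : R, [/\ 0 < a, b < 1 & forall x, chi x != 0 -> a <= x <= b].

Definition weak_derivative (v h : R -> R) : Prop := forall chi, cutoff chi ->
  \int[mu]_(x in I01) (h x * chi x) = - \int[mu]_(x in I01) (v x * chi^`()%classic x).

Lemma lebesgue_pt_davg (v : R -> R) (a e : R) : lebesgue_pt v a -> 0 < e ->
  exists2 d : R, 0 < d & forall r, 0 < r -> r < d -> (davg v a r <= e%:E)%E.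
Proof.
move=> va e0.
have [d /= d0 hd] : \forall r \near 0^'+, (davg v a r < e%:E)%E.
  exact: (va [set y | (y < e%:E)%E] (@nbhs_open_ereal_lt _ 0 (fun=> e) e0)).
exists d => // r r0 rd; apply/ltW/hd => //=.
by rewrite sub0r normrN gtr0_norm.
Qed.

(** Testing against a smooth version of the indicator of ]a, b]: its derivative
    is the difference of two mollifiers centred at a and b. *)
Lemma weak_derivative_increment (v h : R -> R) (a b : R) :
  mu.-integrable setT (EFin \o v) -> mu.-integrable setT (EFin \o h) ->
  weak_derivative v h -> 0 < a -> a < b -> b < 1 ->
  lebesgue_pt v a -> lebesgue_pt v b -> v b - v a = \int[mu]_(x in `]a, b]) h x.
Proof.
move=> vi hi vh a0 ab b1 va vb; apply/eqP; rewrite -subr_eq0 -normr_le0.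
apply/ler_addgt0Pr => e e0; rewrite add0r.
have arith (A B I x y : R) : `|A - x| <= e / 3 -> `|B - y| <= e / 3 ->
    `|- (A - B) - I| <= e / 3 -> `|y - x - I| <= e.
  by rewrite !ler_norml; lra.
have [C C0 hC] := @mollify_davg R.
have e3 : 0 < e / 3 by rewrite divr_gt0.
have eC : 0 < e / 3 / C by rewrite divr_gt0.
have [d1 d10 hd1] := lebesgue_pt_davg va eC.
have [d2 d20 hd2] := lebesgue_pt_davg vb eC.
have [d3 d30 hd3] := cutoff_integral hi a0 ab b1 e3.
pose d := Num.min (Num.min d1 d2) (Num.min d3 (Num.min a (1 - b))).
have d0 : 0 < d by rewrite !lt_min d10 d20 d30 a0 subr_gt0.
pose r := d / 2.
have r0 : 0 < r by rewrite divr_gt0.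
have : r < d by rewrite /r ltr_pdivrMr// ltr_pMr// ltr1n.
rewrite !lt_min => /andP[/andP[rd1 rd2] /andP[rd3 /andP[ra rb]]].
clearbody r => {d d0}.
have [ar0 ar1 br0 br1] : [/\ 0 < a - r, a + r < 1, 0 < b - r & b + r < 1].
  by clear -r0 a0 ab b1 ra rb; split; lra.
have mI : measurable (I01 : set R) by [].
have viI : mu.-integrable I01 (EFin \o v) by exact: integrableS vi.
have kmoll c : 0 < c - r -> c + r < 1 -> (davg v c r <= (e / 3 / C)%:E)%E ->
    `|\int[mu]_(x in I01) (v x * kernel c r x) - v c| <= e / 3.
  move=> c0 c1 hc; rewrite -lee_fin; apply: (le_trans (hC v c r _ r0 mI _ viI)).
    by move=> x; rewrite ball_itv /= !in_itv/=; lra.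
  apply: (le_trans (lee_wpmul2l _ hc)); first by rewrite lee_fin ltW.
  by rewrite -EFinM lee_fin mulrCA mulfV ?mulr1// gt_eqF.
have ka := kmoll a _ _ (hd1 _ r0 rd1).
have kb := kmoll b _ _ (hd2 _ r0 rd2).
have kint c : mu.-integrable I01 (EFin \o (fun x => v x * kernel c r x)).
  have [K [K0 hK]] := @rho_ubound R.
  apply: (@integrable_mul_bounded _ _ _ _ (r^-1 * K)) => //.
    exact: continuous_measurable (@kernel_continuous _ c r) mI.
  by move=> x _; rewrite ger0_norm ?kernel_ge0// ler_wpM2l// invr_ge0 ltW.
pose chi x := stepat a r x - stepat b r x.
have chic : cutoff chi.
  split; first by apply: rsmoothB; exact: rsmooth_stepat.
  exists (a - r), (b + r); split=> // x.
  apply: contra_neqT; rewrite /chi negb_and -!ltNge => /orP[xa|bx].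
    by rewrite !stepat_left ?subrr//; lra.
  by rewrite !stepat_right ?subrr//; lra.
have chi' : chi^`() = fun x => kernel a r x - kernel b r x.
  by apply: is_derive_derive1 => x; apply: is_deriveB; exact: stepat_is_derive.
have := vh _ chic; rewrite chi'.
rewrite (_ : \int[mu]_(x in I01) (v x * _) =
    \int[mu]_(x in I01) (v x * kernel a r x) - \int[mu]_(x in I01) (v x * kernel b r x)); last first.
  by rewrite -RintegralB//; apply: eq_Rintegral => x _; rewrite mulrBr.
move=> key; have := hd3 _ r0 rd3; rewrite key.
exact: arith (ka ar0 ar1) (kb br0 br1).
Qed.

Lemma ae_nonempty (P : set R) (l r : R) : l < r -> {ae mu, forall x, P x} ->
  exists x, [/\ l < x, x < r & P x].
Proof.
move=> lr aeP; apply: contrapT => nP.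
have ml : measurable (`]l, r[%classic : set R) by [].
have : mu.-negligible `]l, r[%classic.
  apply: negligibleS aeP => x /=; rewrite in_itv/= => /andP[lx xr] Px.
  by apply: nP; exists x.
move=> /(negligibleP mu ml) m0.
have := lebesgue_measure_itv (`]l, r[%R : interval R).
rewrite [LHS]m0 /= lte_fin lr -EFinD => /esym/eqP; rewrite eqe subr_eq0 => /eqP rl.
by rewrite rl ltxx in lr.
Qed.

Lemma Rintegral_increment (h : R -> R) (a b : R) : mu.-integrable setT (EFin \o h) ->
  a <= b ->
  \int[mu]_(x in `]a, b]) h x =
  \int[mu]_(x in `]-oo, b]) h x - \int[mu]_(x in `]-oo, a]) h x.
Proof. by move=> hi ab; rewrite Rintegral_itvB//; exact: integrableS hi. Qed.

Lemma Rintegral_increment_le (h : R -> R) (a b : R) : mu.-integrable setT (EFin \o h) ->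
  `|\int[mu]_(x in `]-oo, b]) h x - \int[mu]_(x in `]-oo, a]) h x|
    <= \int[mu]_x `|h x|.
Proof.
move=> hi; wlog ab : a b / a <= b => [H|].
  by have [/H//|/ltW/H] := leP a b; rewrite distrC.
have mab : measurable (`]a, b]%classic : set R) by [].
rewrite -Rintegral_increment//.
apply: (le_trans (le_normr_Rintegral (mu := mu) mab (integrableS _ _ _ hi))) => //.
have hn : mu.-integrable setT (EFin \o (fun x => `|h x|)) by exact: integrable_norm hi.
rewrite [leLHS]Rintegral_mkcond; apply: le_Rintegral => //.
  have hn' : mu.-integrable `]a, b] (EFin \o (fun x => `|h x|)) by exact: integrableS hn.
  have := (integrable_mkcond (mu := mu) (EFin \o (fun x => `|h x|)) mab).1 hn'.
  by rewrite restrict_EFin.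
by move=> x _; rewrite /patch; case: ifPn => _ //; exact: normr_ge0.
Qed.

(** Absolute continuity of the integral. *)
Lemma primitive_continuous (h : R -> R) : mu.-integrable setT (EFin \o h) ->
  continuous (fun x => \int[mu]_(t in `]-oo, x]) h t).
Proof.
move=> hi x; apply/cvgrPdist_le => e e0.
have [d [d0 hd]] := integral_normr_continuous hi e0.
have key a b : a <= b -> b - a < d ->
    `|\int[mu]_(t in `]-oo, b]) h t - \int[mu]_(t in `]-oo, a]) h t| <= e.
  move=> ab bad; have mab : measurable (`]a, b]%classic : set R) by [].
  rewrite -Rintegral_increment//.
  apply: (le_trans (le_normr_Rintegral (mu := mu) mab (integrableS _ _ _ hi))) => //.
  apply/ltW/hd => //; rewrite [X in (X < _)%E](lebesgue_measure_itv (`]a, b]%R : interval R))/=.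
  by rewrite lte_fin; case: ifPn => _; rewrite ?lte_fin// -EFinD lte_fin.
near=> y; have xy : `|x - y| < d.
  by near: y; apply: cvgr_dist_lt => //; exact: cvg_id.
have [yx|/ltW yx] := leP y x.
  by apply: key => //; move: xy; rewrite ger0_norm// subr_ge0.
by rewrite distrC; apply: key => //; move: xy; rewrite distrC ger0_norm// subr_ge0.
Unshelve. all: by end_near. Qed.

(** Almost every point is a Lebesgue point of v, so the increments of v from one
    of them are known almost everywhere. *)
Lemma weak_derivative_primitive (v h : R -> R) :
  mu.-integrable setT (EFin \o v) -> mu.-integrable setT (EFin \o h) ->
  weak_derivative v h ->
  exists C : R, {ae mu, forall x, I01 x -> v x = C + \int[mu]_(t in `]-oo, x]) h t}.
Proof.
move=> vi hi vh.
have aev : {ae mu, forall x, lebesgue_pt v x}.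
  have vT : v \_ setT = v by apply/funext => x; rewrite patchT ?in_setT.
  apply: lebesgue_differentiation; rewrite -vT.
  exact: integrable_locally.
have [a [a0 a1 va]] := ae_nonempty ltr01 aev.
exists (v a - \int[mu]_(t in `]-oo, a]) h t).
apply: ae_imp aev => x vx /=; rewrite in_itv/= => /andP[x0 x1].
have [ax|xa|<-] := ltgtP a x; last by rewrite subrK.
- have := weak_derivative_increment vi hi vh a0 ax x1 va vx.
  by rewrite Rintegral_increment ?(ltW ax)//; lra.
- have := weak_derivative_increment vi hi vh x0 xa a1 vx va.
  by rewrite Rintegral_increment ?(ltW xa)//; lra.
Qed.

End WeakPrimitive.

(** * Fejér means of smooth periodic functions *)

Section Periodic.
Context {R : realType}.
Variable T : R.
Hypothesis T0 : 0 < T.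
Local Notation omega := (omega T).

Definition Tperiodic (f : R -> R) : Prop := forall t, f (t + T) = f t.

Lemma Tperiodic_int f : Tperiodic f -> forall (k : int) t, f (t + k%:~R * T) = f t.
Proof.
move=> fT; have fn : forall (n : nat) t, f (t + n%:R * T) = f t.
  elim=> [|n IH] t; first by rewrite mul0r addr0.
  by rewrite -natr1 mulrDl mul1r addrA fT.
case=> n t; first exact: fn.
by rewrite NegzE -[in RHS](subrK (n.+1%:R * T) t) fn mulrNz mulNr.
Qed.

(** The representative of t modulo T of least modulus. *)
Lemma Tperiodic_center t : exists k : int, `|t - k%:~R * T| <= T / 2.
Proof.
pose k := Num.floor (t / T + 1 / 2); exists k.
have h1 : k%:~R <= t / T + 1 / 2 by exact: ge_floor.
have h2 : t / T + 1 / 2 < k%:~R + 1.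
  by have := lt_succ_floor (t / T + 1 / 2); rewrite intrD.
have tE : t = (t / T) * T by rewrite divfK// gt_eqF.
rewrite ler_norml; set u := t / T in h1 h2 tE.
rewrite tE -mulrBl (_ : - (T / 2) = - (1 / 2) * T); last by ring.
rewrite (_ : T / 2 = (1 / 2) * T); last by ring.
by rewrite !ler_pM2r//; apply/andP; split; lra.
Qed.

Lemma omega_gt0 : 0 < omega.
Proof. by rewrite /Defs.omega divr_gt0// mulr_gt0// pi_gt0. Qed.

Lemma omegaT : omega * T = pi *+ 2.
Proof. by rewrite /Defs.omega divfK ?gt_eqF// mulr_natl. Qed.

Lemma cos_period (k : int) : Tperiodic (fun t => cos (k%:~R * omega * t)).
Proof.
move=> t /=; rewrite mulrDr -mulrA -mulrA omegaT; move: (k%:~R * _) => x.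
case: k => n.
  by rewrite -[n%:~R]/(n%:R) mulr_natl (periodicn (@cosD2pi R)).
rewrite NegzE mulrNz mulNr -[n.+1%:~R]/(n.+1%:R) mulr_natl.
by rewrite -[LHS](periodicn (@cosD2pi R) n.+1) subrK.
Qed.

Lemma sin_period (k : int) : Tperiodic (fun t => sin (k%:~R * omega * t)).
Proof.
move=> t /=; rewrite mulrDr -mulrA -mulrA omegaT; move: (k%:~R * _) => x.
case: k => n.
  by rewrite -[n%:~R]/(n%:R) mulr_natl (periodicn (@sinD2pi R)).
rewrite NegzE mulrNz mulNr -[n.+1%:~R]/(n.+1%:R) mulr_natl.
by rewrite -[LHS](periodicn (@sinD2pi R) n.+1) subrK.
Qed.

Lemma Tperiodic_bounded f : Tperiodic f -> continuous f ->
  exists2 M : R, 0 <= M & forall t, `|f t| <= M.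
Proof.
move=> fT cf; have T2 : - (T / 2) <= T / 2 by have := T0; lra.
have [c _ hc] : exists2 c, c \in `[- (T / 2), T / 2]%R &
    forall t, t \in `[- (T / 2), T / 2]%R -> `|f t| <= `|f c|.
  apply: (EVT_max (f := fun t => `|f t|) T2).
  by apply: continuous_subspaceT => x; apply: continuous_comp (cf x) _; exact: norm_continuous.
exists `|f c| => // t; have [k hk] := Tperiodic_center t.
rewrite -(Tperiodic_int fT (- k)) mulrNz mulNr; apply: hc.
by rewrite in_itv/= -ler_norml.
Qed.

Lemma Tperiodic_derive1 f : rsmooth f -> Tperiodic f -> Tperiodic f^`().
Proof.
move=> sf fT t.
have h := is_derive_comp_affine (a := 1) (b := T) (x := t) (rsmooth_is_derive (1 * t + T) sf).
have e : (fun x => f (1 * x + T)) = f by apply/funext => x; rewrite mul1r fT.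
rewrite e !mul1r in h; have [_ <-] := h.
by rewrite derive1E.
Qed.

Lemma Tperiodic_derive1n n f : rsmooth f -> Tperiodic f -> Tperiodic f^`(n).
Proof.
move=> sf fT; elim: n => [|n IH]; first by rewrite derive1n0.
by rewrite derive1nS; apply: Tperiodic_derive1 => //; exact: rsmooth_derive1n.
Qed.

Lemma Tperiodic_lipschitz f : rsmooth f -> Tperiodic f ->
  exists2 L : R, 0 <= L & forall s t, `|f t - f s| <= L * `|t - s|.
Proof.
move=> sf fT; have [L L0 hL] := Tperiodic_bounded (Tperiodic_derive1 sf fT)
  (rsmooth_continuous (rsmooth_derive1 sf)).
have key s t : s <= t -> `|f t - f s| <= L * `|t - s|.
  move=> st; have [||c _ ->] := @MVT_segment R f f^`() s t st.
  - by move=> x _; exact: rsmooth_is_derive.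
  - exact/continuous_subspaceT/rsmooth_continuous.
  by rewrite normrM ler_wpM2r.
exists L => // s t; have [st|ts] := leP s t; first exact: key.
by rewrite distrC [`|t - s|]distrC; apply: key; exact: ltW.
Qed.

(** Korovkin's estimate: off the diagonal of the circle 1 - cos is bounded below,
    and on the diagonal the function is continuous. *)
Lemma korovkin f (e : R) : rsmooth f -> Tperiodic f -> 0 < e ->
  exists2 C : R, 0 <= C & forall s t, `|f t - f s| <= e + C * (1 - cos (omega * (t - s))).
Proof.
move=> sf fT e0.
have [L L0 hL] := Tperiodic_lipschitz sf fT.
have [M M0 hM] := Tperiodic_bounded fT (rsmooth_continuous sf).
(* within d the Lipschitz bound gives e; beyond d, up to half a period, the cosine
   is at most cos (omega d) *)
pose d := Num.min (e / (L + 1)) (T / 2).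
have L1 : 0 < L + 1 by rewrite ltr_wpDl.
have d0 : 0 < d by rewrite lt_min !divr_gt0.
have w0 := omega_gt0.
have wT2 : omega * (T / 2) = pi by rewrite mulrA omegaT mulr2n; lra.
have dT : omega * d <= pi by rewrite -wT2 ler_pM2l// ge_min lexx orbT.
have c1 : 0 < 1 - cos (omega * d).
  rewrite subr_gt0 -[ltRHS]cos0 ltr_cos ?in_itv/= ?lexx ?pi_ge0//; last by rewrite dT mulr_ge0// ltW.
  by rewrite mulr_gt0.
exists (2 * M / (1 - cos (omega * d))); first by apply: divr_ge0; [exact: mulr_ge0|exact: ltW].
move=> s t; have [k hk] := Tperiodic_center (t - s).
rewrite -(Tperiodic_int fT k s); set s' := s + _.
have -> : cos (omega * (t - s)) = cos (omega * (t - s')).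
  have h := Tperiodic_int (cos_period 1) (- k) (t - s).
  rewrite !mul1r in h; rewrite -h; congr (cos (_ * _)).
  by rewrite /s' mulrNz; ring.
have {}hk : `|t - s'| <= T / 2 by rewrite /s' opprD addrA.
have [td|dt] := leP `|t - s'| d.
  have h1 : `|f t - f s'| <= e.
    apply: (le_trans (hL _ _)); apply: (@le_trans _ _ (L * (e / (L + 1)))).
      by rewrite ler_wpM2l// (le_trans td)// ge_min lexx.
    by rewrite mulrA ler_pdivrMr// mulrC ler_wpM2l ?(ltW e0)// lerDl.
  apply: (le_trans h1); rewrite lerDl; apply: mulr_ge0; last by rewrite subr_ge0 cos_le1.
  by apply: divr_ge0; [exact: mulr_ge0|exact: ltW].
have -> : cos (omega * (t - s')) = cos (omega * `|t - s'|).
  by have [h|h] := ger0P (t - s') => //; rewrite mulrN cosN.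
have h2 : cos (omega * `|t - s'|) <= cos (omega * d).
  have i1 : omega * d \in `[0, pi]%R by rewrite in_itv/= dT mulr_ge0// ltW.
  have i2 : omega * `|t - s'| \in `[0, pi]%R.
    by rewrite in_itv/= -[X in _ && (_ <= X)]wT2 ler_pM2l// hk mulr_ge0// ltW.
  by apply/ltW; rewrite ltr_cos// ltr_pM2l.
have h3 : `|f t - f s'| <= 2 * M.
  by rewrite (le_trans (ler_normB _ _))//; have := hM t; have := hM s'; lra.
apply: (le_trans h3); apply: (@le_trans _ _ (2 * M / (1 - cos (omega * d)) * (1 - cos (omega * d)))).
  by rewrite divfK// gt_eqF.
rewrite -[leLHS]add0r; apply: lerD; first exact: ltW.
apply: ler_wpM2l; last by rewrite lerD2l lerN2.
by apply: divr_ge0; [exact: mulr_ge0|exact: ltW].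
Qed.

(** ** Integration over one period *)

Local Notation mu := (@lebesgue_measure R).
Local Notation "'intT' f" := (\int[mu]_(s in `[0, T]) f s) (at level 10, f at level 9).

Let mT : measurable (`[0, T]%classic : set R). Proof. by []. Qed.

Lemma intTD f g : continuous f -> continuous g ->
  \int[mu]_(s in `[0, T]) (f s + g s) = intT f + intT g.
Proof. by move=> cf cg; apply: RintegralD => //; exact: integrable_continuous_itv. Qed.

Lemma intTZ f (a : R) : continuous f -> \int[mu]_(s in `[0, T]) (a * f s) = a * intT f.
Proof. by move=> cf; apply: RintegralZl => //; exact: integrable_continuous_itv. Qed.

Lemma intT_cst (a : R) : \int[mu]_(s in `[0, T]) a = a * T.
Proof.
rewrite Rintegral_cst// [X in fine X](lebesgue_measure_itv (`[0, T]%R : interval R))/=.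
by rewrite lte_fin T0 oppr0 adde0.
Qed.

Lemma intT_le f g : continuous f -> continuous g -> (forall s, f s <= g s) ->
  intT f <= intT g.
Proof. by move=> cf cg fg; apply: le_Rintegral => //; exact: integrable_continuous_itv. Qed.

Lemma intT_norm f : continuous f -> `|intT f| <= \int[mu]_(s in `[0, T]) `|f s|.
Proof. by move=> cf; apply: le_normr_Rintegral => //; exact: integrable_continuous_itv. Qed.

Lemma intT_sum (n : nat) (F : 'I_n -> R -> R) : (forall i, rsmooth (F i)) ->
  \int[mu]_(s in `[0, T]) (\sum_(i < n) F i s) = \sum_(i < n) intT (F i).
Proof.
elim: n F => [|n IH] F sF.
  rewrite big_ord0 (@eq_Rintegral _ _ _ _ _ (fun=> 0)) ?intT_cst ?mul0r//.
  by move=> s _; rewrite big_ord0.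
rewrite big_ord_recr/= -IH// -intTD.
- by apply: eq_Rintegral => s _; rewrite big_ord_recr.
- exact/rsmooth_continuous/rsmooth_sum.
- exact/rsmooth_continuous.
Qed.

Lemma intT_derive f : rsmooth f -> Tperiodic f -> \int[mu]_(s in `[0, T]) f^`()%classic s = 0.
Proof.
move=> sf fT.
have c' : continuous f^`()%classic by exact/rsmooth_continuous/rsmooth_derive1.
rewrite (Rintegral_FTC (ltW T0) c' (fun x => rsmooth_is_derive x sf)).
by rewrite -[T]add0r fT subrr.
Qed.

(** ** The Fejér mean *)

Definition trigc (c : R) f : R := \int[mu]_(s in `[0, T]) (f s * cos (c * s)).
Definition trigs (c : R) f : R := \int[mu]_(s in `[0, T]) (f s * sin (c * s)).
Definition mode (c : R) f (t : R) : R :=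
  trigc c f * cos (c * t) + trigs c f * sin (c * t).
(** The frequencies are indexed by pairs, as they arise in the squared modulus of
    the Dirichlet sum; k = j - l then has its weight n - |k| by multiplicity. *)
Definition freq (j l : nat) : R := (j%:Z - l%:Z)%:~R * omega.
Definition fejer (n : nat) f (t : R) : R :=
  (n%:R * T)^-1 * \sum_(j < n) \sum_(l < n) mode (freq j l) f t.
Definition fejer_kernel (n : nat) (x : R) : R :=
  \sum_(j < n) \sum_(l < n) cos ((j%:R - l%:R) * x).

Lemma trigc_derive1 (k : int) f : rsmooth f -> Tperiodic f ->
  trigc (k%:~R * omega) f^`()%classic = k%:~R * omega * trigs (k%:~R * omega) f.
Proof.
move=> sf fT; set c := _ * omega.
have sg : rsmooth (fun t => f t * cos (c * t)) by exact: rsmoothM sf (rsmooth_cos c).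
have gT : Tperiodic (fun t => f t * cos (c * t)).
  by move=> t; rewrite fT (cos_period k).
have := intT_derive sg gT.
have -> : (fun t => f t * cos (c * t))^`()%classic =
    fun t => f^`()%classic t * cos (c * t) + - c * (f t * sin (c * t)).
  apply: is_derive_derive1 => x.
  have := is_deriveM (rsmooth_is_derive x sf) (is_derive_cosM c x).
  by rewrite /GRing.scale/= (_ : _ + _ = f^`()%classic x * cos (c * x) + - c * (f x * sin (c * x)))//; ring.
have sfs : continuous (fun s => f s * sin (c * s)).
  exact: rsmooth_continuous (rsmoothM sf (rsmooth_sin c)).
rewrite intTD; last 2 first.
- by apply: rsmooth_continuous; apply: rsmoothM; [exact: rsmooth_derive1|exact: rsmooth_cos].
- by apply: rsmooth_continuous; apply: rsmoothM; [exact: rsmooth_cst|exact: (rsmoothM sf (rsmooth_sin c))].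
by rewrite intTZ// -/(trigc c _) -/(trigs c _); lra.
Qed.

Lemma trigs_derive1 (k : int) f : rsmooth f -> Tperiodic f ->
  trigs (k%:~R * omega) f^`()%classic = - (k%:~R * omega * trigc (k%:~R * omega) f).
Proof.
move=> sf fT; set c := _ * omega.
have sg : rsmooth (fun t => f t * sin (c * t)) by exact: rsmoothM sf (rsmooth_sin c).
have gT : Tperiodic (fun t => f t * sin (c * t)).
  by move=> t; rewrite fT (sin_period k).
have := intT_derive sg gT.
have -> : (fun t => f t * sin (c * t))^`()%classic =
    fun t => f^`()%classic t * sin (c * t) + c * (f t * cos (c * t)).
  apply: is_derive_derive1 => x.
  have := is_deriveM (rsmooth_is_derive x sf) (is_derive_sinM c x).
  by rewrite /GRing.scale/= (_ : _ + _ = f^`()%classic x * sin (c * x) + c * (f x * cos (c * x)))//; ring.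
have sfs : continuous (fun s => f s * cos (c * s)).
  by apply: rsmooth_continuous; apply: rsmoothM => //; exact: rsmooth_cos.
rewrite intTD; last 2 first.
- by apply: rsmooth_continuous; apply: rsmoothM; [exact: rsmooth_derive1|exact: rsmooth_sin].
- by apply: rsmooth_continuous; apply: rsmoothM; [exact: rsmooth_cst|exact: (rsmoothM sf (rsmooth_cos c))].
by rewrite intTZ// -/(trigc c _) -/(trigs c _); lra.
Qed.

Lemma is_derive_sumI (n : nat) (F G : 'I_n -> R -> R) (x : R) :
  (forall i, is_derive x (1 : R) (F i) (G i x)) ->
  is_derive x (1 : R) (fun t => \sum_(i < n) F i t) (\sum_(i < n) G i x).
Proof.
elim: n F G => [|n IH] F G FG.
  rewrite big_ord0 (_ : (fun _ => _) = fun=> 0); first exact: is_derive_cst.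
  by apply/funext => t; rewrite big_ord0.
rewrite big_ord_recr (_ : (fun _ => _) =
    fun t => \sum_(i < n) F (widen_ord (leqnSn n) i) t + F ord_max t).
  have h := IH _ (fun i => G (widen_ord (leqnSn n) i)) (fun i => FG _).
  exact: (is_deriveD h (FG ord_max)).
by apply/funext => t; rewrite big_ord_recr.
Qed.

Lemma rsmooth_mode c f : rsmooth (mode c f).
Proof. exact: rsmooth_trig. Qed.

Lemma rsmooth_fejer n f : rsmooth (fejer n f).
Proof.
apply: rsmoothM; first exact: rsmooth_cst.
by apply: rsmooth_sum => j; apply: rsmooth_sum => l; exact: rsmooth_mode.
Qed.

Lemma Tperiodic_fejer n f : Tperiodic (fejer n f).
Proof.
move=> t; congr (_ * _); apply: eq_bigr => j _; apply: eq_bigr => l _.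
by rewrite /mode (cos_period (j%:Z - l%:Z)) (sin_period (j%:Z - l%:Z)).
Qed.

(** Integrating by parts, convolution with a trigonometric polynomial commutes
    with differentiation; so uniform convergence passes to all derivatives. *)
Lemma fejer_derive1n n m f : rsmooth f -> Tperiodic f ->
  (fejer n f)^`(m) = fejer n f^`(m).
Proof.
move=> sf fT; elim: m => [|m IH]; first by rewrite !derive1n0.
rewrite !derive1nS IH; set g := f^`(m).
have sg : rsmooth g by exact: rsmooth_derive1n.
have gT : Tperiodic g by exact: Tperiodic_derive1n.
apply: is_derive_derive1 => x.
have H (j l : 'I_n) : is_derive x (1 : R) (mode (freq j l) g) (mode (freq j l) g^`()%classic x).
  by rewrite /mode /freq trigc_derive1// trigs_derive1//; exact: is_derive_trig.
have H2 (j : 'I_n) := is_derive_sumI (G := fun l : 'I_n => mode (freq j l) g^`()%classic) (H j).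
exact: is_derive_scale (is_derive_sumI
  (G := fun j : 'I_n => fun x => \sum_(l < n) mode (freq j l) g^`()%classic x) H2).
Qed.

Lemma fejer_kernelE n (x : R) : fejer_kernel n x =
  (\sum_(j < n) cos (j%:R * x)) ^+ 2 + (\sum_(j < n) sin (j%:R * x)) ^+ 2.
Proof.
rewrite !expr2 !mulr_suml -big_split; apply: eq_bigr => j _ /=.
rewrite !mulr_sumr -big_split; apply: eq_bigr => l _ /=.
by rewrite mulrBl cosB.
Qed.

Lemma fejer_kernel_ge0 n x : 0 <= fejer_kernel n x.
Proof. by rewrite fejer_kernelE addr_ge0// sqr_ge0. Qed.

(** The kernel is the squared modulus of a geometric sum. *)
Lemma fejer_kernel_geometric n x :
  (1 - cos x) * fejer_kernel n x = 1 - cos (n%:R * x).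
Proof.
rewrite fejer_kernelE; set C := \sum_(j < n) cos _; set S := \sum_(j < n) sin _.
have [h1 h2] : (1 - cos x) * C + sin x * S = 1 - cos (n%:R * x) /\
    (1 - cos x) * S - sin x * C = - sin (n%:R * x).
  rewrite /C /S; elim: n {C S} => [|n [IH1 IH2]].
    by rewrite !big_ord0 mul0r cos0 sin0 !mulr0 subrr addr0 subr0 oppr0.
  have e : n.+1%:R * x = n%:R * x + x by rewrite -natr1; ring.
  rewrite !big_ord_recr/= e cosD sinD.
  by split; [move: IH1|move: IH2] => IH; lra.
have := cos2Dsin2 x; have := cos2Dsin2 (n%:R * x).
move: h1 h2; move: (cos x) (sin x) (cos (n%:R * x)) (sin (n%:R * x)) => c s d e h1 h2 h3 h4.
have h5 : d = 1 - ((1 - c) * C + s * S) by rewrite h1; ring.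
have h6 : e = - ((1 - c) * S - s * C) by rewrite h2; ring.
have : ((1 - c) ^+ 2 + s ^+ 2) * (C ^+ 2 + S ^+ 2) = (1 - d) ^+ 2 + e ^+ 2.
  by rewrite h5 h6; ring.
have -> : (1 - c) ^+ 2 + s ^+ 2 = 2 * (1 - c) by lra.
have -> : (1 - d) ^+ 2 + e ^+ 2 = 2 * (1 - d) by lra.
by rewrite -mulrA => /mulfI; apply; rewrite pnatr_eq0.
Qed.

Lemma rsmooth_cos_shift (c t : R) : rsmooth (fun s => cos (c * (t - s))).
Proof.
rewrite (_ : (fun _ => _) = fun s => cos (c * t) * cos (c * s) + sin (c * t) * sin (c * s)).
  exact: rsmooth_trig.
by apply/funext => s; rewrite mulrBr cosB.
Qed.

Lemma mode_convolution (c : R) f t : rsmooth f ->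
  mode c f t = \int[mu]_(s in `[0, T]) (f s * cos (c * (t - s))).
Proof.
move=> sf.
have s1 : rsmooth (fun s => f s * cos (c * s)) by exact: rsmoothM sf (rsmooth_cos c).
have s2 : rsmooth (fun s => f s * sin (c * s)) by exact: rsmoothM sf (rsmooth_sin c).
have c1 := rsmooth_continuous s1; have c2 := rsmooth_continuous s2.
have c3 := rsmooth_continuous (rsmoothM (rsmooth_cst (cos (c * t))) s1).
have c4 := rsmooth_continuous (rsmoothM (rsmooth_cst (sin (c * t))) s2).
rewrite /mode /trigc /trigs ![_ * cos (c * t)]mulrC ![_ * sin (c * t)]mulrC.
rewrite -!intTZ// -intTD//; apply: eq_Rintegral => s _.
by rewrite [c * (t - s)]mulrBr cosB; ring.
Qed.

Lemma rsmooth_fejer_kernel n t : rsmooth (fun s => fejer_kernel n (omega * (t - s))).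
Proof.
apply: rsmooth_sum => j; apply: rsmooth_sum => l.
rewrite (_ : (fun _ => _) = fun s => cos ((j%:R - l%:R) * omega * (t - s))).
  exact: rsmooth_cos_shift.
by apply/funext => s; rewrite mulrA.
Qed.

Lemma fejer_convolution n f t : rsmooth f -> fejer n f t =
  (n%:R * T)^-1 * \int[mu]_(s in `[0, T]) (f s * fejer_kernel n (omega * (t - s))).
Proof.
move=> sf; congr (_ * _).
have sm c : rsmooth (fun s => f s * cos (c * (t - s))).
  by apply: rsmoothM => //; exact: rsmooth_cos_shift.
have e1 (j : 'I_n) : \sum_(l < n) mode (freq j l) f t =
    \int[mu]_(s in `[0, T]) (\sum_(l < n) f s * cos (freq j l * (t - s))).
  rewrite (intT_sum (fun l : 'I_n => sm (freq j l))); apply: eq_bigr => l _.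
  exact: mode_convolution.
have s2 (j : 'I_n) : rsmooth (fun s => \sum_(l < n) f s * cos (freq j l * (t - s))).
  by apply: rsmooth_sum => l; exact: sm.
rewrite (eq_bigr _ (fun j _ => e1 j)) -(intT_sum s2).
apply: eq_Rintegral => s _; rewrite mulr_sumr; apply: eq_bigr => j _.
rewrite mulr_sumr; apply: eq_bigr => l _.
by rewrite /freq intrB -mulrA.
Qed.

Lemma mode_cst1 (k : int) t :
  mode (k%:~R * omega) (fun=> 1) t = if k == 0 then T else 0.
Proof.
have s1 : rsmooth (fun=> 1 : R) by exact: rsmooth_cst.
have p1 : Tperiodic (fun=> 1 : R) by [].
have [->|k0] := eqVneq k 0.
  rewrite /mode mulr0z !mul0r cos0 sin0 mulr0 addr0 mulr1 /trigc.
  rewrite (@eq_Rintegral _ _ _ _ _ (fun=> 1)) ?intT_cst ?mul1r//.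
  by move=> s _; rewrite mul0r cos0 mulr1.
have d0 : (fun=> 1 : R)^`()%classic = fun=> 0.
  by apply: is_derive_derive1 => x; exact: is_derive_cst.
have i0 g : \int[mu]_(s in `[0, T]) (0 * g s) = 0.
  rewrite (@eq_Rintegral _ _ _ _ _ (fun=> 0)) ?intT_cst ?mul0r//.
  by move=> s _; rewrite mul0r.
have c0 : k%:~R * omega != 0 by rewrite mulf_neq0 ?intr_eq0// gt_eqF// omega_gt0.
have := trigc_derive1 k s1 p1; have := trigs_derive1 k s1 p1.
rewrite d0 {1}/trigs {2}/trigc !i0 => /esym/eqP; rewrite oppr_eq0 mulf_eq0 (negbTE c0)/=.
move=> /eqP hc /esym/eqP; rewrite mulf_eq0 (negbTE c0)/= => /eqP hs.
by rewrite /mode hc hs !mul0r addr0.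
Qed.

(** Of the n^2 frequencies only the n diagonal ones have nonzero mean. *)
Lemma fejer_cst1 n t : (0 < n)%N -> fejer n (fun=> 1) t = 1.
Proof.
move=> n0; rewrite /fejer (eq_bigr (fun=> T)); last first.
  move=> j _; rewrite (bigD1 j)//= big1 ?addr0 => [|l lj]; rewrite mode_cst1 subr_eq0.
    by rewrite eqxx.
  by rewrite eqz_nat -val_eqE/= eq_sym in lj *; rewrite (negbTE lj).
rewrite sumr_const card_ord -[T *+ n]mulr_natl mulVf// mulf_neq0//.
  by rewrite pnatr_eq0 -lt0n.
by rewrite gt_eqF.
Qed.

Lemma fejer_kernel_mass n t : (0 < n)%N ->
  \int[mu]_(s in `[0, T]) fejer_kernel n (omega * (t - s)) = n%:R * T.
Proof.
move=> n0; have := fejer_cst1 t n0; rewrite fejer_convolution; last exact: rsmooth_cst.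
have nT : n%:R * T != 0 by rewrite mulf_neq0 ?pnatr_eq0 -?lt0n// gt_eqF.
move=> /(congr1 (fun x => n%:R * T * x)); rewrite mulVKf// mulr1 => <-.
by apply: eq_Rintegral => s _; rewrite mul1r.
Qed.

(** The kernel has mass n T, while its integral against 1 - cos is at most 2 T:
    Korovkin's estimate leaves an error e/2 + 2 C / n. *)
Lemma fejer_approx f (e : R) : rsmooth f -> Tperiodic f -> 0 < e ->
  exists N : nat, forall n t, (N <= n)%N -> `|f t - fejer n f t| <= e.
Proof.
move=> sf fT e0; have e2 : 0 < e / 2 by rewrite divr_gt0.
have [C C0 hC] := korovkin sf fT e2.
exists (Num.bound (4 * C / e)).+1 => n t Nn.
have n0 : (0 < n)%N by exact: leq_trans Nn.
have n0R : 0 < n%:R :> R by rewrite ltr0n.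
have nT : 0 < n%:R * T by rewrite mulr_gt0.
have hn : 2 * C / n%:R <= e / 2.
  have h1 : 4 * C / e < n%:R.
    apply: (lt_le_trans (archi_boundP _)); first by rewrite divr_ge0 ?mulr_ge0// ltW.
    by rewrite ler_nat ltnW.
  rewrite ler_pdivrMr//; move: h1; rewrite ltr_pdivrMr// => h1; nra.
have sK := rsmooth_fejer_kernel n t.
have cK := rsmooth_continuous sK.
have sfK : rsmooth (fun s => f s * fejer_kernel n (omega * (t - s))) by exact: rsmoothM.
have sd : rsmooth (fun s => (f t - f s) * fejer_kernel n (omega * (t - s))).
  by apply: rsmoothM => //; apply: rsmoothB => //; exact: rsmooth_cst.
have -> : f t - fejer n f t = (n%:R * T)^-1 *
    \int[mu]_(s in `[0, T]) ((f t - f s) * fejer_kernel n (omega * (t - s))).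
  rewrite fejer_convolution// -[f t in LHS](mulKf (lt0r_neq0 nT)) -mulrBr; congr (_ * _).
  rewrite -(fejer_kernel_mass t n0) mulrC -intTZ//.
  rewrite -[- \int[mu]_(x in _) _]mulN1r -intTZ; last exact: rsmooth_continuous.
  rewrite -intTD.
  - by apply: eq_Rintegral => s _; ring.
  - by apply/rsmooth_continuous/rsmoothM => //; exact: rsmooth_cst.
  - by apply/rsmooth_continuous/rsmoothM => //; exact: rsmooth_cst.
rewrite normrM gtr0_norm ?invr_gt0// mulrC ler_pdivrMr//.
apply: (le_trans (intT_norm (rsmooth_continuous sd))).
have sc : rsmooth (fun s => 1 - cos (n%:R * omega * (t - s))).
  by apply: rsmoothB; [exact: rsmooth_cst|exact: rsmooth_cos_shift].
apply: (@le_trans _ _ (\int[mu]_(s in `[0, T])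
    (e / 2 * fejer_kernel n (omega * (t - s)) + C * (1 - cos (n%:R * omega * (t - s)))))).
  apply: intT_le.
  - have cd := rsmooth_continuous sd.
    by move=> x; apply: continuous_comp (cd x) _; exact: norm_continuous.
  - apply/rsmooth_continuous/rsmoothD; apply: rsmoothM => //; exact: rsmooth_cst.
  move=> s; rewrite normrM [`|fejer_kernel _ _|]ger0_norm ?fejer_kernel_ge0//.
  have -> : 1 - cos (n%:R * omega * (t - s)) =
      (1 - cos (omega * (t - s))) * fejer_kernel n (omega * (t - s)).
    by rewrite fejer_kernel_geometric mulrA.
  rewrite mulrA -mulrDl.
  by rewrite ler_wpM2r ?fejer_kernel_ge0.
apply: (@le_trans _ _ (\int[mu]_(s in `[0, T]) (e / 2 * fejer_kernel n (omega * (t - s)) + 2 * C))).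
  apply: intT_le.
  - apply/rsmooth_continuous/rsmoothD; apply: rsmoothM => //; exact: rsmooth_cst.
  - apply/rsmooth_continuous/rsmoothD; last exact: rsmooth_cst.
    by apply: rsmoothM => //; exact: rsmooth_cst.
  move=> s; rewrite lerD2l mulrC ler_wpM2r//.
  by have := cos_geN1 (n%:R * omega * (t - s)); lra.
rewrite intTD; last 2 first.
- by apply/rsmooth_continuous/rsmoothM => //; exact: rsmooth_cst.
- exact/rsmooth_continuous/rsmooth_cst.
rewrite intTZ// fejer_kernel_mass// intT_cst.
have : 2 * C <= e / 2 * n%:R by rewrite -ler_pdivrMr.
move=> h; rewrite (_ : _ + _ = (e / 2 * n%:R + 2 * C) * T); last by ring.
by rewrite [leRHS]mulrA ler_pM2r//; lra.
Qed.

End Periodic.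

(** * Distributions on the circle are determined by their Fourier coefficients *)

Local Open Scope complex_scope.

Section ComplexNumbers.
Context {R : realType}.
Implicit Types z w : Cplx R.
Local Notation Re := (@complex.Re R).
Local Notation Im := (@complex.Im R).
Local Notation normc := (@Normc.normc R).

Lemma cplx_eq z w : Re z = Re w -> Im z = Im w -> z = w.
Proof. by case: z w => [a b] [c d] /= -> ->. Qed.
Lemma Re_add z w : Re (z + w) = Re z + Re w. Proof. by case: z w => [a b] []. Qed.
Lemma Im_add z w : Im (z + w) = Im z + Im w. Proof. by case: z w => [a b] []. Qed.
Lemma Re_opp z : Re (- z) = - Re z. Proof. by case: z. Qed.
Lemma Im_opp z : Im (- z) = - Im z. Proof. by case: z. Qed.
Lemma Re_mul z w : Re (z * w) = Re z * Re w - Im z * Im w.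
Proof. by case: z w => [a b] []. Qed.
Lemma Im_mul z w : Im (z * w) = Re z * Im w + Im z * Re w.
Proof. by case: z w => [a b] []. Qed.

Definition cplxE := (Re_add, Im_add, Re_opp, Im_opp, Re_mul, Im_mul).

Lemma normc_ge0 z : 0 <= normc z. Proof. by case: z => a b; exact: sqrtr_ge0. Qed.

Lemma normc_sqr z : normc z ^+ 2 = Re z ^+ 2 + Im z ^+ 2.
Proof. by case: z => a b /=; rewrite sqr_sqrtr// addr_ge0 ?sqr_ge0. Qed.

Lemma normc_Re z : `|Re z| <= normc z.
Proof. by case: z => a b /=; rewrite -sqrtr_sqr ler_wsqrtr// lerDl sqr_ge0. Qed.

Lemma normc_Im z : `|Im z| <= normc z.
Proof. by case: z => a b /=; rewrite -sqrtr_sqr ler_wsqrtr// lerDr sqr_ge0. Qed.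

Lemma normc_le z : normc z <= `|Re z| + `|Im z|.
Proof.
rewrite -ler_sqr ?nnegrE ?normc_ge0 ?addr_ge0// normc_sqr sqrrD !real_normK ?num_real//.
by rewrite -addrA lerD2l lerDr mulrn_wge0// mulr_ge0.
Qed.

Lemma normcD z w : normc (z + w) <= normc z + normc w.
Proof. exact: (@le_normcD R z w). Qed.

Lemma normc_opp z : normc (- z) = normc z.
Proof. by case: z => a b /=; rewrite !sqrrN. Qed.

Lemma normc_real (a : R) : normc a%:C = `|a|.
Proof. by rewrite /= expr0n addr0 sqrtr_sqr. Qed.

Lemma normcM z w : normc (z * w) = normc z * normc w.
Proof. exact: Normc.normcM. Qed.

Lemma normc_eq0 z : normc z = 0 -> z = 0.
Proof. exact: Normc.eq0_normc. Qed.

End ComplexNumbers.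

Section CircleDistributions.
Context {R : realType}.
Variable T : R.
Hypothesis T0 : 0 < T.
Local Notation Re := (@complex.Re R).
Local Notation Im := (@complex.Im R).
Local Notation normc := (@Normc.normc R).
Implicit Types (u v : functional R) (phi psi : R -> Cplx R).

Lemma smoothP phi : smooth phi <-> rsmooth (fun t => Re (phi t)) /\ rsmooth (fun t => Im (phi t)).
Proof.
split=> [h|[[h1] [h2]] n t]; last by split.
by split; constructor=> n t; have [] := h n t.
Qed.

Lemma testP phi : test T phi <->
  [/\ rsmooth (fun t => Re (phi t)), rsmooth (fun t => Im (phi t)),
      Tperiodic T (fun t => Re (phi t)) & Tperiodic T (fun t => Im (phi t))].
Proof.
split=> [[/smoothP[h1 h2] h3]|[h1 h2 h3 h4]]; first by split=> // t; rewrite h3.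
by split; [exact/smoothP|move=> t; apply: cplx_eq; [exact: h3|exact: h4]].
Qed.

Lemma test_real (f : R -> R) : rsmooth f -> Tperiodic T f -> test T (fun t => (f t)%:C).
Proof. by move=> sf fT; apply/testP; split=> //; exact: rsmooth_cst. Qed.

Lemma test0 : test T (fun=> 0).
Proof. by apply/testP; split=> //; exact: rsmooth_cst. Qed.

Lemma testD phi psi : test T phi -> test T psi -> test T (fun t => phi t + psi t).
Proof.
move=> /testP[h1 h2 h3 h4] /testP[g1 g2 g3 g4]; apply/testP.
rewrite (_ : (fun t => Re _) = fun t => Re (phi t) + Re (psi t)); last by apply/funext=> t; rewrite cplxE.
rewrite (_ : (fun t => Im _) = fun t => Im (phi t) + Im (psi t)); last by apply/funext=> t; rewrite cplxE.
by split; [exact: rsmoothD|exact: rsmoothD|move=> t; rewrite h3 g3|move=> t; rewrite h4 g4].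
Qed.

Lemma testZ (a : Cplx R) phi : test T phi -> test T (fun t => a * phi t).
Proof.
move=> /testP[h1 h2 h3 h4]; apply/testP.
rewrite (_ : (fun t => Re _) = fun t => Re a * Re (phi t) - Im a * Im (phi t)); last by apply/funext=> t; rewrite cplxE.
rewrite (_ : (fun t => Im _) = fun t => Re a * Im (phi t) + Im a * Re (phi t)); last by apply/funext=> t; rewrite cplxE.
have sc (b : R) f : rsmooth f -> rsmooth (fun t => b * f t).
  by move=> sf; apply: rsmoothM => //; exact: rsmooth_cst.
split; [by apply: rsmoothB; exact: sc|by apply: rsmoothD; exact: sc|..].
  by move=> t; rewrite h3 h4.
by move=> t; rewrite h3 h4.
Qed.

Lemma test_expfun k : test T (expfun T k).
Proof.
by apply/testP; split; [exact: rsmooth_cos|exact: rsmooth_sin|exact: cos_period|exact: sin_period].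
Qed.

Section Linear.
Variables (u : functional R) (ud : distribution T u).

Lemma distr0 : u (fun=> 0) = 0.
Proof.
have [ul _] := ud; have := ul 1 _ _ test0 test0.
rewrite (_ : (fun t => _) = fun=> 0); last by apply/funext=> t; rewrite mulr0 addr0.
by rewrite mul1r => /eqP; rewrite -subr_eq0 opprD addrA subrr sub0r oppr_eq0 => /eqP.
Qed.

Lemma distrZ (a : Cplx R) phi : test T phi -> u (fun t => a * phi t) = a * u phi.
Proof.
move=> tp; have [ul _] := ud; have := ul a _ _ tp test0; rewrite distr0 addr0 => <-.
by congr u; apply/funext=> t; rewrite addr0.
Qed.

Lemma distrD phi psi : test T phi -> test T psi -> u (fun t => phi t + psi t) = u phi + u psi.
Proof.
move=> tp ts; have [ul _] := ud; have := ul 1 _ _ tp ts; rewrite mul1r => <-.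
by congr u; apply/funext=> t; rewrite mul1r.
Qed.

Lemma distr_sum (n : nat) (F : 'I_n -> R -> Cplx R) : (forall i, test T (F i)) ->
  test T (fun t => \sum_(i < n) F i t) /\
  u (fun t => \sum_(i < n) F i t) = \sum_(i < n) u (F i).
Proof.
elim: n F => [|n IH] F tF.
  rewrite big_ord0 (_ : (fun _ => _) = fun=> 0); last by apply/funext=> t; rewrite big_ord0.
  by split; [exact: test0|exact: distr0].
have [h1 h2] := IH (fun i => F (widen_ord (leqnSn n) i)) (fun i => tF _).
rewrite big_ord_recr/= -h2.
rewrite (_ : (fun t => _) = fun t => \sum_(i < n) F (widen_ord (leqnSn n) i) t + F ord_max t); last first.
  by apply/funext=> t; rewrite big_ord_recr.
by split; [exact: testD|exact: distrD].
Qed.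

End Linear.

Lemma cderive_real j (g : R -> R) t : cderive j (fun t => (g t)%:C : Cplx R) t = (g^`(j)%classic t)%:C.
Proof.
apply: cplx_eq => //=.
have d0 : (fun=> 0 : R)^`()%classic = fun=> 0.
  by apply: is_derive_derive1 => x; exact: is_derive_cst.
rewrite (_ : derive1n j _ = fun=> 0)//; elim: j => [|j IH]; first by rewrite derive1n0.
by rewrite derive1nS IH.
Qed.

(** A real mode is a combination of two exponentials. *)
Lemma distribution_mode0 u (k : int) (a b : R) : distribution T u ->
  (forall k, u (expfun T k) = 0) ->
  test T (fun t => (a * cos (k%:~R * omega T * t) + b * sin (k%:~R * omega T * t))%:C) /\
  u (fun t => (a * cos (k%:~R * omega T * t) + b * sin (k%:~R * omega T * t))%:C) = 0.
Proof.
move=> ud u0; split.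
  apply: test_real; first exact: rsmooth_trig.
  by move=> t; rewrite (cos_period T0 k) (sin_period T0 k).
pose z : Cplx R := (a / 2) +i* (- (b / 2)).
pose w : Cplx R := (a / 2) +i* (b / 2).
rewrite (_ : (fun t => _) = fun t => z * expfun T k t + w * expfun T (- k) t).
  rewrite (distrD ud); [|by apply: testZ; exact: test_expfun..].
  by rewrite !(distrZ ud) ?u0 ?mulr0 ?addr0//; exact: test_expfun.
apply/funext => t; apply: cplx_eq; rewrite !cplxE /= mulrNz !mulNr cosN sinN; lra.
Qed.

(** Fejér means of a test function converge to it with all derivatives, and a
    distribution has finite order. *)
Lemma distribution_eq0_real u (f : R -> R) : distribution T u ->
  (forall k, u (expfun T k) = 0) -> rsmooth f -> Tperiodic T f ->
  u (fun t => (f t)%:C) = 0.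
Proof.
move=> ud u0 sf fT; apply: normc_eq0; apply/eqP; rewrite -normr_le0 ger0_norm ?normc_ge0//.
have [_ [K [N hK]]] := ud.
apply/ler_addgt0Pr => e e0; rewrite add0r.
have K1 : 0 < `|K| + 1 by rewrite ltr_wpDl.
have eK : 0 < e / (`|K| + 1) by rewrite divr_gt0.
have [n hn] : exists n : nat, forall j t, (j <= N)%N ->
    `|f^`(j)%classic t - fejer T n f^`(j)%classic t| <= e / (`|K| + 1).
  have /choice[M hM] : forall j, exists M : nat, forall n t, (M <= n)%N ->
      `|f^`(j)%classic t - fejer T n f^`(j)%classic t| <= e / (`|K| + 1).
    move=> j; apply: fejer_approx => //; first exact: rsmooth_derive1n.
    exact: Tperiodic_derive1n.
  exists (\max_(j < N.+1) M j)%N => j t jN; apply: hM.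
  by have := @leq_bigmax _ (fun j : 'I_N.+1 => M j) (Ordinal (jN : (j < N.+1)%N)).
have sF := @rsmooth_fejer _ T n f; have FT := @Tperiodic_fejer _ _ T0 n f.
have uF : u (fun t => (fejer T n f t)%:C) = 0.
  pose c : Cplx R := ((n%:R * T)^-1)%:C.
  pose g (j l : 'I_n) (t : R) : Cplx R := (mode T (freq T j l) f t)%:C.
  have hg j l := @distribution_mode0 u (j%:Z - l%:Z) (trigc T (freq T j l) f)
    (trigs T (freq T j l) f) ud u0.
  have hs j := distr_sum ud (fun l : 'I_n => (hg j l).1).
  have hss := distr_sum ud (fun j : 'I_n => (hs j).1).
  rewrite (_ : (fun t => _) = fun t => c * \sum_(j < n) \sum_(l < n) g j l t).
    rewrite (distrZ ud c hss.1) hss.2 big1 ?mulr0// => j _.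
    by rewrite (hs j).2 big1// => l _; exact: (hg j l).2.
  by apply/funext => t; rewrite /fejer rmorphM rmorph_sum; congr (_ * _);
    apply: eq_bigr => j _; rewrite rmorph_sum.
(* u does not see the Fejér mean, so only the small difference counts *)
pose d t := f t - fejer T n f t.
have sd : rsmooth d by exact: rsmoothB.
have dT : Tperiodic T d by move=> t; rewrite /d fT FT.
have uE : u (fun t => (f t)%:C) = u (fun t => (d t)%:C).
  rewrite -[RHS]addr0 -uF -(distrD ud); [|exact: test_real..].
  by congr u; apply/funext => t; rewrite -rmorphD /d subrK.
have hd j : d^`(j)%classic = fun t => f^`(j)%classic t - fejer T n f^`(j)%classic t.
  elim: j => [|j IH]; first by rewrite !derive1n0.
  rewrite !derive1nS IH; apply: is_derive_derive1 => x; apply: is_deriveB.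
    exact/rsmooth_is_derive/rsmooth_derive1n.
  have := @fejer_derive1n _ _ T0 n 1 _ (rsmooth_derive1n j sf) (Tperiodic_derive1n j sf fT).
  rewrite !derive1n1 => <-; apply: rsmooth_is_derive; exact: rsmooth_fejer.
rewrite uE; apply: (le_trans (hK _ (e / (`|K| + 1)) (test_real sd dT) _)).
  by move=> j t jN; rewrite cderive_real normc_real hd; exact: hn.
rewrite mulrA ler_pdivrMr// mulrC ler_wpM2l ?(ltW e0)//.
by rewrite (le_trans (ler_norm K))// lerDl.
Qed.

Lemma distribution_eq0 u : distribution T u -> (forall k, u (expfun T k) = 0) ->
  forall phi, test T phi -> u phi = 0.
Proof.
move=> ud u0 phi /testP[h1 h2 h3 h4].
pose i : Cplx R := 0 +i* 1.
have t1 := test_real h1 h3; have t2 := test_real h2 h4.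
rewrite (_ : phi = fun t => (Re (phi t))%:C + i * (Im (phi t))%:C).
  rewrite (distrD ud t1 (testZ i t2)) (distrZ ud i t2).
  rewrite (distribution_eq0_real ud u0 h1 h3) (distribution_eq0_real ud u0 h2 h4).
  by rewrite mulr0 addr0.
by apply/funext => t; apply: cplx_eq; rewrite !cplxE /=; ring.
Qed.

Lemma distributionB u v : distribution T u -> distribution T v ->
  distribution T (fun phi => u phi - v phi).
Proof.
move=> [ul [K1 [N1 h1]]] [vl [K2 [N2 h2]]]; split.
  by move=> a phi psi tp ts; rewrite ul// vl//; ring.
exists (K1 + K2), (maxn N1 N2) => phi M tp hM; rewrite mulrDl.
apply: (le_trans (normcD _ _)); rewrite normc_opp; apply: lerD.
  by apply: h1 => // j t jN; apply: hM; rewrite leq_max jN.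
by apply: h2 => // j t jN; apply: hM; rewrite leq_max jN orbT.
Qed.

Lemma distribution_ext u v : distribution T u -> distribution T v ->
  (forall k, u (expfun T k) = v (expfun T k)) -> eq_distr T u v.
Proof.
move=> ud vd uv phi tp; apply/eqP; rewrite -subr_eq0; apply/eqP.
by apply: (distribution_eq0 (distributionB ud vd)) => // k; rewrite uv subrr.
Qed.

(** ** Distributions defined by continuous functions *)

Definition ccontinuous (f : R -> Cplx R) : Prop :=
  continuous (fun t => Re (f t)) /\ continuous (fun t => Im (f t)).

Lemma test_ccontinuous phi : test T phi -> ccontinuous phi.
Proof. by move=> /testP[h1 h2 _ _]; split; exact: rsmooth_continuous. Qed.

Lemma ccontinuousM f g : ccontinuous f -> ccontinuous g ->
  ccontinuous (fun t => f t * g t).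
Proof.
move=> [f1 f2] [g1 g2]; split=> t.
  rewrite (_ : (fun t => _) = fun t => Re (f t) * Re (g t) - Im (f t) * Im (g t)); last first.
    by apply/funext => s; rewrite cplxE.
  by apply: cvgB; apply: cvgM; [exact: f1|exact: g1|exact: f2|exact: g2].
rewrite (_ : (fun t => _) = fun t => Re (f t) * Im (g t) + Im (f t) * Re (g t)); last first.
  by apply/funext => s; rewrite cplxE.
by apply: cvgD; apply: cvgM; [exact: f1|exact: g2|exact: f2|exact: g1].
Qed.

Lemma cintegral_lin (a : Cplx R) f g : ccontinuous f -> ccontinuous g ->
  cintegral `[0, T]%classic (fun t => a * f t + g t) =
  a * cintegral `[0, T]%classic f + cintegral `[0, T]%classic g.
Proof.
move=> [f1 f2] [g1 g2].
have cZ (b : R) (h : R -> R) : continuous h -> continuous (fun t => b * h t).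
  by move=> ch t; apply: cvgM; [exact: cvg_cst|exact: ch].
have cD (h k : R -> R) : continuous h -> continuous k -> continuous (fun t => h t + k t).
  by move=> ch ck t; apply: cvgD; [exact: ch|exact: ck].
apply: cplx_eq; rewrite !cplxE /=.
  rewrite -mulNr -!intTZ// -intTD; [|exact: cZ..].
  rewrite -intTD//; last by apply: cD; exact: cZ.
  by apply: eq_Rintegral => t _; rewrite !cplxE mulNr.
rewrite -!intTZ// -intTD; [|exact: cZ..].
rewrite -intTD//; last by apply: cD; exact: cZ.
by apply: eq_Rintegral => t _; rewrite !cplxE.
Qed.

Lemma cintegral_le f (M : R) : ccontinuous f ->
  (forall t, t \in `[0, T]%R -> normc (f t) <= M) ->
  normc (cintegral `[0, T]%classic f) <= 2 * T * M.
Proof.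
move=> [f1 f2] fM; apply: (le_trans (normc_le _)) => /=.
have key (g : R -> R) : continuous g -> (forall t, t \in `[0, T]%R -> `|g t| <= M) ->
    `|\int[lebesgue_measure]_(t in `[0, T]) g t| <= M * T.
  move=> cg gM; apply: (le_trans (intT_norm T cg)); rewrite -(intT_cst T0 M).
  apply: le_Rintegral => //.
  - apply: integrable_continuous_itv => t; apply: continuous_comp (cg t) _; exact: norm_continuous.
  - by apply: integrable_continuous_itv => t; exact: cvg_cst.
have h1 := key _ f1 (fun t tT => le_trans (normc_Re (f t)) (fM t tT)).
have h2 := key _ f2 (fun t tT => le_trans (normc_Im (f t)) (fM t tT)).
by rewrite -mulrA mulr_natl mulr2n mulrC; apply: lerD.
Qed.

Lemma ccontinuous_bounded f : ccontinuous f ->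
  exists2 B : R, 0 <= B & forall t, t \in `[0, T]%R -> normc (f t) <= B.
Proof.
move=> [f1 f2].
have key (g : R -> R) : continuous g -> exists2 B : R, 0 <= B & forall t, t \in `[0, T]%R -> `|g t| <= B.
  move=> cg; have [c _ hc] : exists2 c, c \in `[0, T]%R &
      forall t, t \in `[0, T]%R -> `|g t| <= `|g c|.
    apply: (EVT_max (f := fun t => `|g t|) (ltW T0)).
    by apply: continuous_subspaceT => x; apply: continuous_comp (cg x) _; exact: norm_continuous.
  by exists `|g c|.
have [B1 B10 h1] := key _ f1; have [B2 B20 h2] := key _ f2.
exists (B1 + B2); first exact: addr_ge0.
by move=> t tT; apply: (le_trans (normc_le _)); apply: lerD; [exact: h1|exact: h2].
Qed.

Lemma distr_of_distribution f : ccontinuous f -> distribution T (distr_of T f).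
Proof.
move=> cf; split.
  move=> a phi psi tp ts; rewrite /distr_of -cintegral_lin.
  - by congr cintegral; apply/funext => t; ring.
  - by apply: ccontinuousM => //; exact: test_ccontinuous.
  - by apply: ccontinuousM => //; exact: test_ccontinuous.
have [B B0 hB] := ccontinuous_bounded cf.
exists (2 * T * B), 0%N => phi M tp hM; rewrite -mulrA; apply: cintegral_le.
  by apply: ccontinuousM => //; exact: test_ccontinuous.
move=> t tT; rewrite normcM; apply: ler_pM; rewrite ?normc_ge0//; first exact: hB.
have := hM 0%N t (leqnn _); congr (_ <= _); congr normc.
by apply: cplx_eq.
Qed.

End CircleDistributions.

(** * Sums over the frequencies *)

Section Enumeration.
Context {R : realType}.

Definition nth_int (m : nat) : int := if odd m then Negz m./2 else Posz m./2.

Lemma nth_int_bij : set_bij [set: nat] [set: int] nth_int.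
Proof.
split=> //.
  move=> m n _ _; rewrite /nth_int; case: ifP => om; case: ifP => on //.
    by move=> [e]; rewrite -(odd_double_half m) -(odd_double_half n) om on e.
  by move=> [e]; rewrite -(odd_double_half m) -(odd_double_half n) om on e.
case=> k _; [exists k.*2 => //|exists k.*2.+1 => //].
  by rewrite /nth_int odd_double doubleK.
by rewrite /nth_int /= odd_double /= uphalf_double.
Qed.

Lemma nth_int_surj k : exists m, nth_int m = k.
Proof. by have [_ _ /(_ k I) [m _ <-]] := nth_int_bij; exists m. Qed.

Lemma esum_nth_int (a : int -> \bar R) N : (forall k, 0 <= a k)%E ->
  (\sum_(m < N) a (nth_int m) <= \esum_(k in [set: int]) a k)%E.
Proof.
move=> a0; rewrite (@reindex_esum R _ _ _ _ _ a nth_int_bij) -nneseries_esumT//.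
by rewrite -(big_mkord xpredT (fun m => a (nth_int m))); apply: nneseries_lim_ge.
Qed.

Lemma esum_ge_term (a : int -> \bar R) k : (forall k, 0 <= a k)%E ->
  (a k <= \esum_(k in [set: int]) a k)%E.
Proof.
move=> a0; have [m <-] := nth_int_surj k.
apply: le_trans (esum_nth_int m.+1 a0); rewrite big_ord_recr/=.
by apply: leeDr; apply: sume_ge0.
Qed.

Lemma sum_inv_sqr_le N : \sum_(m < N) (m.+1%:R ^+ 2)^-1 <= 2 :> R.
Proof.
suff h : \sum_(m < N.+1) (m.+1%:R ^+ 2)^-1 <= 2 - (N.+1%:R)^-1 :> R.
  apply: le_trans (_ : _ <= \sum_(m < N.+1) (m.+1%:R ^+ 2)^-1) _.
    by rewrite big_ord_recr/= lerDl invr_ge0 exprn_ge0.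
  by apply: (le_trans h); rewrite gerBl invr_ge0.
elim: N => [|N IH].
  by rewrite big_ord_recr big_ord0/= expr1n invr1; lra.
rewrite big_ord_recr/=; apply: (le_trans (lerD IH (lexx _))).
have -> : N.+2%:R = N.+1%:R + 1 :> R by rewrite natr1.
have x0 : 0 < N.+1%:R :> R by rewrite ltr0n.
move: (N.+1%:R) x0 => x x0 {IH}.
have x1 : 0 < x + 1 by rewrite addr_gt0.
have h1 : x != 0 by rewrite gt_eqF.
have h2 : x + 1 != 0 by rewrite gt_eqF.
rewrite -subr_ge0 (_ : _ - _ = (x * (x + 1) ^+ 2)^-1); last by field; rewrite h1 h2.
by rewrite invr_ge0 mulr_ge0 ?sqr_ge0// ltW.
Qed.

Variable gamma : R.
Hypothesis gamma1 : 3 / 2 < gamma.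

Lemma weight_gt0 k : 0 < weight gamma k.
Proof. by rewrite /weight powR_gt0// ltr_wpDr// sqr_ge0. Qed.

(** For the m-th integer k one has (1 + k^2)^gamma >= 1 + k^2 >= (m+1)^2 / 8. *)
Lemma weight_inv_le m : (weight gamma (nth_int m))^-1 <= 8 * (m.+1%:R ^+ 2)^-1.
Proof.
have h1 : 1 + (nth_int m)%:~R ^+ 2 <= weight gamma (nth_int m).
  have b1 : 1 <= 1 + (nth_int m)%:~R ^+ 2 :> R by rewrite lerDl sqr_ge0.
  rewrite -[leLHS]powRr1 ?(le_trans ler01)// /weight ler_powR//.
  by apply: ltW; apply: lt_trans gamma1; lra.
have h2 : m.+1%:R ^+ 2 <= 8 * (1 + (nth_int m)%:~R ^+ 2) :> R.
  have : (m.+1 ^ 2 <= 8 * (1 + `|nth_int m| ^ 2))%N.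
    rewrite -{1}(odd_double_half m) /nth_int; case: (odd m) => /=; nia.
  rewrite -(ler_nat R) natrX natrM natrD natrX natr_absz.
  by rewrite intr_norm real_normK ?num_real.
have p0 : 0 < m.+1%:R ^+ 2 :> R by rewrite exprn_gt0.
rewrite -[8 * _]invrK lef_pV2 ?posrE ?weight_gt0 ?invr_gt0 ?mulr_gt0 ?invr_gt0//.
by rewrite invfM invrK mulrC ler_pdivrMr// mulrC (le_trans h2)// ler_wpM2l.
Qed.

Lemma sum_weight_inv N : \sum_(m < N) (weight gamma (nth_int m))^-1 <= 16.
Proof.
apply: (@le_trans _ _ (8 * 2)); last by rewrite -natrM.
apply: (@le_trans _ _ (8 * \sum_(m < N) (m.+1%:R ^+ 2)^-1)).
  by rewrite mulr_sumr; apply: ler_sum => m _; exact: weight_inv_le.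
by rewrite ler_wpM2l// sum_inv_sqr_le.
Qed.

End Enumeration.

(** * The Fourier modes of a field *)

Section Modes.
Context {R : realType}.
Variables T gamma : R.
Hypothesis T0 : 0 < T.
Local Notation mu := (@lebesgue_measure R).
Local Notation I01 := `](0:R), (1:R)[%classic.
Local Notation Re := (@complex.Re R).
Local Notation Im := (@complex.Im R).
Local Notation normc := (@Normc.normc R).
Implicit Types u f : distr_field R.

(** The k-th Fourier coefficient of u(x), in the sign convention of the norms. *)
Definition umode u (k : int) (x : R) : Cplx R := u x (expfun T (- k)).
Definition energy u (k : int) : R := \int[mu]_(x in I01) (normc (umode u k x) ^+ 2).

Lemma Hnorm2_ge_mode (w : functional R) k :
  ((T^-1 * (weight gamma k * normc (w (expfun T (- k))) ^+ 2))%:E <= Hnorm2 T gamma w)%E.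
Proof.
rewrite /Hnorm2 EFinM lee_wpmul2l ?lee_fin ?invr_ge0 ?(ltW T0)//.
apply: (@esum_ge_term _ (fun k => (weight gamma k * normc (w (expfun T (- k))) ^+ 2)%:E)) => j.
by rewrite lee_fin mulr_ge0 ?sqr_ge0// ltW// weight_gt0.
Qed.

Lemma Hsimple_measurable (s : distr_field R) phi : Hsimple T gamma s ->
  measurable_fun I01 (fun x => Re (s x phi)) /\ measurable_fun I01 (fun x => Im (s x phi)).
Proof.
move=> [n [A [h [mA _ hs]]]].
have key (P : Cplx R -> R) : P 0 = 0 -> (forall z w, P (z + w) = P z + P w) ->
    measurable_fun I01 (fun x => P (s x phi)).
  move=> P0 PD; apply: (@eq_measurable_fun _ _ _ _ _
    (fun x => \sum_(i < n) P (h i phi) * \1_(A i) x)).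
    move=> x /set_mem xI; rewrite hs// (big_morph P PD P0) [RHS]big_mkcond/=.
    by apply: eq_bigr => i _; rewrite indicE; case: (_ \in _); rewrite ?mulr1 ?mulr0.
  apply: measurable_sum => i; apply: measurable_funM; first exact: measurable_cst.
  by apply: measurable_indic; exact: mA.
by split; apply: key => // z w; rewrite cplxE.
Qed.

(** Convergence in the Sobolev norm forces convergence of every mode. *)
Lemma umode_measurable u k : H0gamma T gamma u ->
  measurable_fun I01 (fun x => Re (umode u k x)) /\
  measurable_fun I01 (fun x => Im (umode u k x)).
Proof.
move=> [_ [s [ss su]] _].
have w0 : 0 < weight gamma k by exact: weight_gt0.
have cv x : I01 x -> forall e, 0 < e ->
    \forall n \near \oo, normc (umode u k x - s n x (expfun T (- k))) <= e.
  move=> xI e e0; have d0 : 0 < T^-1 * (weight gamma k * e ^+ 2).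
    by rewrite mulr_gt0 ?invr_gt0 ?mulr_gt0 ?exprn_gt0.
  have := su x xI [set y | (y < (T^-1 * (weight gamma k * e ^+ 2))%:E)%E].
  move=> /(_ (@nbhs_open_ereal_lt _ 0 (fun=> T^-1 * (weight gamma k * e ^+ 2)) d0)) h.
  near=> n; have := Hnorm2_ge_mode (fun phi => u x phi - s n x phi) k.
  have hn : (Hnorm2 T gamma (fun phi => (u x phi - s n x phi)%R)
      < (T^-1 * (weight gamma k * e ^+ 2))%:E)%E by near: n; exact: h.
  move=> /le_lt_trans/(_ hn); rewrite lte_fin ltr_pM2l ?invr_gt0// ltr_pM2l//.
  by rewrite ltr_pXn2r ?nnegrE ?normc_ge0 ?(ltW e0)// => /ltW.
have key (P : Cplx R -> R) : (forall z w, P (z + w) = P z + P w) ->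
    (forall z, P (- z) = - P z) -> (forall z, `|P z| <= normc z) ->
    (forall n, measurable_fun I01 (fun x => P (s n x (expfun T (- k))))) ->
    measurable_fun I01 (fun x => P (umode u k x)).
  move=> PD PN Ple mP; apply: measurable_fun_cvg mP _ => x xI.
  apply/cvgrPdist_le => e e0; apply: filterS (cv x xI e e0) => n.
  by apply: le_trans; rewrite -PN -PD.
split; apply: key => //; try by move=> *; rewrite cplxE.
- exact: normc_Re.
- by move=> n; have [] := Hsimple_measurable (expfun T (- k)) (ss n).
- exact: normc_Im.
- by move=> n; have [] := Hsimple_measurable (expfun T (- k)) (ss n).
Unshelve. all: by end_near. Qed.

Lemma normc2_umode_measurable u k : H0gamma T gamma u ->
  measurable_fun I01 (fun x => normc (umode u k x) ^+ 2).
Proof.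
move=> /(umode_measurable k)[m1 m2].
apply: (@eq_measurable_fun _ _ _ _ _ (fun x => Re (umode u k x) ^+ 2 + Im (umode u k x) ^+ 2)).
  by move=> x _; rewrite normc_sqr.
by apply: measurable_funD; apply: measurable_funX.
Qed.

(** Each energy is finite because its weighted value is below the finite norm; the
    real-valued integrals then sum like the extended ones. *)
Lemma energy_sum u N : H0gamma T gamma u ->
  (forall k, mu.-integrable I01 (EFin \o (fun x => normc (umode u k x) ^+ 2))) /\
  \sum_(m < N) weight gamma (nth_int m) * energy u (nth_int m) <= T * fine (H0norm2 T gamma u).
Proof.
move=> Hu; have [_ _ fin] := Hu.
pose E k := (\int[mu]_(x in I01) (normc (umode u k x) ^+ 2)%:E)%E.
have E0 k : (0 <= E k)%E by apply: integral_ge0 => x _; rewrite lee_fin sqr_ge0.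
pose S := (\esum_(k in [set: int]) ((weight gamma k)%:E * E k))%E.
have a0 k : (0 <= (weight gamma k)%:E * E k)%E.
  by rewrite mule_ge0// lee_fin ltW// weight_gt0.
have S0 : (0 <= S)%E by apply: esum_ge0.
have nE : H0norm2 T gamma u = ((T^-1)%:E * S)%E by [].
have Sfin : S \is a fin_num.
  rewrite ge0_fin_numE// ltey; apply/eqP => Soo; move: fin.
  by rewrite nE Soo gt0_muley ?lte_fin ?invr_gt0.
have Efin k : E k \is a fin_num.
  rewrite ge0_fin_numE// ltey; apply/eqP => Eoo.
  have := esum_ge_term k a0; rewrite -/S Eoo gt0_muley ?lte_fin ?weight_gt0//.
  by rewrite leye_eq => /eqP Soo; move: Sfin; rewrite Soo.
split.
  move=> k; apply/integrableP; split.
    by apply/measurable_EFinP; exact: normc2_umode_measurable.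
  rewrite (_ : (\int[mu]_(x in I01) _)%E = E k); first by have := Efin k; rewrite ge0_fin_numE.
  by apply: eq_integral => x _; rewrite /= ger0_norm// sqr_ge0.
have := esum_nth_int N a0; rewrite -/S -[in leRHS](fineK Sfin).
rewrite (eq_bigr (fun m : 'I_N => (weight gamma (nth_int m) * energy u (nth_int m))%:E)); last first.
  by move=> m _; rewrite EFinM /energy /Rintegral fineK//; exact: Efin.
rewrite sumEFin lee_fin => /le_trans; apply.
by rewrite nE fineM//= mulVKf// gt_eqF.
Qed.

Lemma energy_ge0 u k : 0 <= energy u k.
Proof. by apply: Rintegral_ge0 => x _; exact: sqr_ge0. Qed.

Lemma umode_integrable u k : H0gamma T gamma u ->
  mu.-integrable I01 (EFin \o (fun x => Re (umode u k x))) /\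
  mu.-integrable I01 (EFin \o (fun x => Im (umode u k x))).
Proof.
move=> Hu; have [m1 m2] := umode_measurable k Hu.
have [h _] := energy_sum 0 Hu; have {}h := h k.
have mI : measurable (I01 : set R) by [].
have h1 : mu.-integrable I01 (EFin \o (fun=> 1 : R)).
  apply: integrableS (integrable_continuous_itv 0 1 (f := fun=> 1) _) => //.
    by apply: subset_itv; rewrite bnd_simp.
  by move=> x; exact: cvg_cst.
have h2 : mu.-integrable I01 (EFin \o (fun x => 1 + normc (umode u k x) ^+ 2)).
  exact: integrable_add.
have key (g : R -> R) : measurable_fun I01 g -> (forall x, `|g x| <= normc (umode u k x)) ->
    mu.-integrable I01 (EFin \o g).
  move=> mg hg; apply: le_integrable h2 => //; first exact/measurable_EFinP.
  move=> x _ /=; rewrite lee_fin [leRHS]ger0_norm ?addr_ge0 ?sqr_ge0//.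
  by apply: (le_trans (hg x)); have := normc_ge0 (umode u k x); nra.
by split; apply: key => // x; [exact: normc_Re|exact: normc_Im].
Qed.

End Modes.

(** * The transport equation, mode by mode *)

Section TensorTests.
Context {R : realType}.
Variable T : R.
Hypothesis T0 : 0 < T.
Local Notation Re := (@complex.Re R).
Local Notation Im := (@complex.Im R).

Lemma is_derive_ext (f g : R -> R) (x df dg : R) : is_derive x (1 : R) f df ->
  (forall y, f y = g y) -> df = dg -> is_derive x (1 : R) g dg.
Proof. by move=> h /funext <- <-. Qed.

Lemma is_derive_comb (a b x df dg : R) (f g : R -> R) :
  is_derive x (1 : R) f df -> is_derive x (1 : R) g dg ->
  is_derive x (1 : R) (fun y => a * f y + b * g y) (a * df + b * dg).
Proof. by move=> hf hg; exact: is_deriveD (is_derive_scale a hf) (is_derive_scale b hg). Qed.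

Lemma Cn2_tensor n (f1 g1 f2 g2 : R -> R) : rsmooth f1 -> rsmooth g1 ->
  rsmooth f2 -> rsmooth g2 -> Cn2 n (fun x t => f1 x * g1 t + f2 x * g2 t).
Proof.
elim: n f1 g1 f2 g2 => [|n IH] f1 g1 f2 g2 s1 r1 s2 r2 /=.
  have cfst (h : R -> R) : rsmooth h -> continuous (fun p : R * R => h p.1).
    move=> sh p; apply: (continuous_comp (f := fst) (g := h)); first exact: cvg_fst.
    exact: rsmooth_continuous.
  have csnd (h : R -> R) : rsmooth h -> continuous (fun p : R * R => h p.2).
    move=> sh p; apply: (continuous_comp (f := snd) (g := h)); first exact: cvg_snd.
    exact: rsmooth_continuous.
  by move=> p; apply: cvgD; apply: cvgM; [exact: cfst|exact: csnd|exact: cfst|exact: csnd].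
have dx t : forall x : R, is_derive x (1 : R) (fun y => f1 y * g1 t + f2 y * g2 t)
    (f1^`()%classic x * g1 t + f2^`()%classic x * g2 t).
  move=> x; have h := is_derive_comb (g1 t) (g2 t)
    (rsmooth_is_derive x s1) (rsmooth_is_derive x s2).
  by apply: (is_derive_ext h) => [y|]; ring.
have dt x : forall t : R, is_derive t (1 : R) (fun t => f1 x * g1 t + f2 x * g2 t)
    (f1 x * g1^`()%classic t + f2 x * g2^`()%classic t).
  by move=> t; apply: is_derive_comb; exact: rsmooth_is_derive.
split.
- by move=> x t; split; [have [] := dx t x|have [] := dt x t].
- rewrite (_ : (fun x t => _) = fun x t => f1^`()%classic x * g1 t + f2^`()%classic x * g2 t).
    by apply: IH => //; exact: rsmooth_derive1.
  by apply/funext => x; apply/funext => t; rewrite (is_derive_derive1 (dx t)).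
- rewrite (_ : (fun x t => _) = fun x t => f1 x * g1^`()%classic t + f2 x * g2^`()%classic t).
    by apply: IH => //; exact: rsmooth_derive1.
  by apply/funext => x; apply/funext => t; rewrite (is_derive_derive1 (dt x)).
Qed.

Definition tensor (a : R -> Cplx R) (k : int) (x t : R) : Cplx R := a x * expfun T k t.

Definition csupport (a : R -> Cplx R) : Prop :=
  exists l r : R, [/\ 0 < l, r < 1 & forall x, a x != 0 -> l <= x <= r].

Lemma tensor_test2 a k : smooth a -> csupport a -> test2 T (tensor a k).
Proof.
move=> /smoothP[s1 s2] [l [r [l0 r1 supp]]]; split.
- have sc := rsmooth_cos (k%:~R * omega T); have ss := rsmooth_sin (k%:~R * omega T).
  move=> n; split.
    rewrite (_ : (fun x t => _) = fun x t => Re (a x) * cos (k%:~R * omega T * t) +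
        (- Im (a x)) * sin (k%:~R * omega T * t)).
      by apply: Cn2_tensor => //; exact: rsmoothN.
    by apply/funext => x; apply/funext => t; rewrite /tensor cplxE /= mulNr.
  rewrite (_ : (fun x t => _) = fun x t => Re (a x) * sin (k%:~R * omega T * t) +
      Im (a x) * cos (k%:~R * omega T * t)).
    exact: Cn2_tensor.
  by apply/funext => x; apply/funext => t; rewrite /tensor cplxE.
- move=> x t; congr (_ * _); have [_ h] := test_expfun T0 k; exact: h.
- exists l, r; split=> // x t h; apply: supp; apply: contra_neq h => ax0.
  by rewrite /tensor ax0 mul0r.
Qed.

Lemma cderive1E (g dg : R -> Cplx R) (t : R) :
  is_derive t (1 : R) (fun s => Re (g s)) (Re (dg t)) ->
  is_derive t (1 : R) (fun s => Im (g s)) (Im (dg t)) ->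
  cderive 1 g t = dg t.
Proof.
by move=> h1 h2; apply: cplx_eq => /=; rewrite derive1E; [have [_ ->] := h1|have [_ ->] := h2].
Qed.

Lemma pderive_t_tensor a k x : pderive_t (tensor a k) x =
  fun t => ((0 +i* (k%:~R * omega T)) * a x) * expfun T k t.
Proof.
apply/funext => t; set w := k%:~R * omega T.
apply: (@cderive1E _ (fun t => ((0 +i* w) * a x) * expfun T k t)).
  apply: (is_derive_ext (is_derive_trig (Re (a x)) (- Im (a x)) w t)) => [s|];
    by rewrite /tensor !cplxE /=; ring.
apply: (is_derive_ext (is_derive_trig (Im (a x)) (Re (a x)) w t)) => [s|];
  by rewrite /tensor !cplxE /=; ring.
Qed.

Lemma pderive_x_tensor a k x : smooth a -> pderive_x (tensor a k) x =
  fun t => cderive 1 a x * expfun T k t.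
Proof.
move=> /smoothP[s1 s2]; apply/funext => t.
apply: (@cderive1E _ (fun x => cderive 1 a x * expfun T k t)).
  have h := is_derive_comb (Re (expfun T k t)) (- Im (expfun T k t))
    (rsmooth_is_derive x s1) (rsmooth_is_derive x s2).
  by apply: (is_derive_ext h) => [s|]; rewrite /tensor !cplxE /= ?derive1n1; ring.
have h := is_derive_comb (Re (expfun T k t)) (Im (expfun T k t))
  (rsmooth_is_derive x s2) (rsmooth_is_derive x s1).
by apply: (is_derive_ext h) => [s|]; rewrite /tensor !cplxE /= ?derive1n1; ring.
Qed.

End TensorTests.

Section TransportModes.
Context {R : realType}.
Variables T gamma : R.
Hypothesis T0 : 0 < T.
Local Notation mu := (@lebesgue_measure R).
Local Notation I01 := `](0:R), (1:R)[%classic.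
Local Notation Re := (@complex.Re R).
Local Notation Im := (@complex.Im R).
Local Notation normc := (@Normc.normc R).
Implicit Types u f : distr_field R.

Definition cintegrable (m : R -> Cplx R) : Prop :=
  mu.-integrable I01 (EFin \o (fun x => Re (m x))) /\
  mu.-integrable I01 (EFin \o (fun x => Im (m x))).

Lemma cintegrable_mul (a m : R -> Cplx R) : ccontinuous a -> cintegrable m ->
  cintegrable (fun x => a x * m x).
Proof.
move=> [a1 a2] [m1 m2]; have mI : measurable (I01 : set R) by [].
have key (b g : R -> R) : continuous b -> mu.-integrable I01 (EFin \o g) ->
    mu.-integrable I01 (EFin \o (fun x => g x * b x)).
  move=> cb gi; have [c _ hc] : exists2 c, c \in `[0, 1]%R &
      forall t, t \in `[0, 1]%R -> `|b t| <= `|b c|.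
    apply: (EVT_max (f := fun t => `|b t|) ler01).
    by apply: continuous_subspaceT => x; apply: continuous_comp (cb x) _; exact: norm_continuous.
  apply: (integrable_mul_bounded mI gi (continuous_measurable cb mI)) => x xI.
  by apply: hc; move: xI; rewrite /= !in_itv/= => /andP[/ltW -> /ltW ->].
split.
  rewrite (_ : (fun x => _) = fun x => Re (m x) * Re (a x) + -1 * (Im (m x) * Im (a x))).
    by apply: integrable_add => //; [exact: key|apply: integrable_scale => //; exact: key].
  by apply/funext => x; rewrite cplxE; ring.
rewrite (_ : (fun x => _) = fun x => Im (m x) * Re (a x) + Re (m x) * Im (a x)).
  by apply: integrable_add => //; exact: key.
by apply/funext => x; rewrite cplxE; ring.
Qed.

Lemma cintegral_I01_lin (z : Cplx R) (m n : R -> Cplx R) : cintegrable m -> cintegrable n ->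
  cintegral I01 (fun x => m x + z * n x) = cintegral I01 m + z * cintegral I01 n.
Proof.
move=> [m1 m2] [n1 n2]; have mI : measurable (I01 : set R) by [].
have key (p q r : R -> R) (a b : R) : mu.-integrable I01 (EFin \o p) ->
    mu.-integrable I01 (EFin \o q) -> mu.-integrable I01 (EFin \o r) ->
    \int[mu]_(x in I01) (p x + (a * q x + b * r x)) =
    \int[mu]_(x in I01) p x + (a * \int[mu]_(x in I01) q x + b * \int[mu]_(x in I01) r x).
  move=> pi qi ri; have aq := integrable_scale a mI qi; have br := integrable_scale b mI ri.
  by rewrite RintegralD//; [rewrite RintegralD// !RintegralZl|exact: integrable_add].
apply: cplx_eq; rewrite !cplxE /=.
  rewrite -mulNr -key//; apply: eq_Rintegral => x _; rewrite !cplxE; ring.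
by rewrite -key//; apply: eq_Rintegral => x _; rewrite !cplxE; ring.
Qed.

Lemma cintegral_I01_eq (m n : R -> Cplx R) : (forall x, I01 x -> m x = n x) ->
  cintegral I01 m = cintegral I01 n.
Proof.
by move=> mn; apply: cplx_eq => /=; apply: eq_Rintegral => x /set_mem/mn ->.
Qed.

Lemma pairing2_tensor u (a : R -> Cplx R) k : H0gamma T gamma u ->
  pairing2 u (tensor T a (- k)) = cintegral I01 (fun x => a x * umode T u k x).
Proof.
move=> [Hu _ _]; apply: cintegral_I01_eq => x xI; have [[ud _]] := Hu x xI.
by move=> _; apply: (distrZ (Hu x xI).1); exact: test_expfun.
Qed.

Variables (c : R) (u f : distr_field R) (k : int).
Hypotheses (c2 : c ^+ 2 = 1) (Hu : H0gamma T gamma u) (Hf : H0gamma T gamma f).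
Hypothesis uf : is_transport T c u f.

(** The phase that straightens the characteristic curves of mode k. *)
Definition phase (x : R) : Cplx R := expfun T k (c * x).

Lemma smooth_phase : smooth phase.
Proof.
apply/smoothP; split.
  rewrite (_ : (fun t => _) = fun x => cos (k%:~R * omega T * c * x)); first exact: rsmooth_cos.
  by apply/funext => x; rewrite /= mulrA.
rewrite (_ : (fun t => _) = fun x => sin (k%:~R * omega T * c * x)); first exact: rsmooth_sin.
by apply/funext => x; rewrite /= mulrA.
Qed.

Lemma normc_phase x : normc (phase x) = 1.
Proof. by rewrite /phase /expfun /= cos2Dsin2 sqrtr1. Qed.

(** Testing the transport equation with a cut-off times the phase: the zeroth
    order terms cancel because c^2 = 1, and an ordinary weak derivative remains. *)
Lemma transport_mode (chi : R -> R) : cutoff chi ->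
  cintegral I01 (fun x => (chi x)%:C * (phase x * umode T f k x)) =
  - (c%:C * cintegral I01 (fun x => (chi^`()%classic x)%:C * (phase x * umode T u k x))).
Proof.
move=> [sc [l [r [l0 r1 supp]]]].
have [p1 p2] := (smoothP phase).1 smooth_phase.
pose a x : Cplx R := (chi x)%:C * phase x.
have aRe : (fun x => Re (a x)) = fun x => chi x * Re (phase x).
  by apply/funext => x; rewrite /a cplxE /= mul0r subr0.
have aIm : (fun x => Im (a x)) = fun x => chi x * Im (phase x).
  by apply/funext => x; rewrite /a cplxE /= mul0r addr0.
have sa : smooth a.
  by apply/smoothP; rewrite aRe aIm; split; exact: rsmoothM.
have suppa : csupport a.
  exists l, r; split=> // x; have [c0|c0] := eqVneq (chi x) 0; last by move=> _; exact: supp.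
  by rewrite /a c0 mul0r eqxx.
have := uf (tensor_test2 T0 (- k) sa suppa).
rewrite /gen_dt /gen_dx.
have -> : pderive_t (tensor T a (- k)) =
    tensor T (fun x => (0 +i* ((- k)%:~R * omega T)) * a x) (- k).
  by apply/funext => x; rewrite pderive_t_tensor.
have -> : pderive_x (tensor T a (- k)) = tensor T (cderive 1 a) (- k).
  by apply/funext => x; rewrite pderive_x_tensor.
rewrite !pairing2_tensor//; set w := k%:~R * omega T.
(* the second term below is what cancels against the time derivative *)
have a' x : cderive 1 a x = (chi^`()%classic x)%:C * phase x + (0 +i* (w * c)) * a x.
  have h1 : is_derive x (1 : R) (fun x => Re (phase x)) (- (w * c * Im (phase x))).
    apply: (is_derive_ext (is_derive_cosM (w * c) x)) => [y|];
      by rewrite /phase /= -/w [in RHS]mulrA.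
  have h2 : is_derive x (1 : R) (fun x => Im (phase x)) (w * c * Re (phase x)).
    apply: (is_derive_ext (is_derive_sinM (w * c) x)) => [y|];
      by rewrite /phase /= -/w [in RHS]mulrA.
  have hc := rsmooth_is_derive x sc.
  apply: (@cderive1E _ _ (fun x => (chi^`()%classic x)%:C * phase x + (0 +i* (w * c)) * a x)).
    rewrite aRe; apply: (is_derive_ext (is_deriveM hc h1)) => //.
    by rewrite /a /GRing.scale !cplxE; move: (phase x) => z /=; ring.
  rewrite aIm; apply: (is_derive_ext (is_deriveM hc h2)) => //.
  by rewrite /a /GRing.scale !cplxE; move: (phase x) => z /=; ring.
have ca : ccontinuous a.
  by have [s1 s2] := (smoothP a).1 sa; split; exact: rsmooth_continuous.
have scd : smooth (cderive 1 a).
  have [s1 s2] := (smoothP a).1 sa; apply/smoothP.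
  by split; exact: rsmooth_derive1.
have cda : ccontinuous (cderive 1 a).
  by have [s1 s2] := (smoothP _).1 scd; split; exact: rsmooth_continuous.
have iu : cintegrable (umode T u k) by exact: (umode_integrable T0 k Hu).
have iau := cintegrable_mul ca iu.
have idau := cintegrable_mul cda iu.
have caz : ccontinuous (fun x => (0 +i* (- w)) * a x).
  by apply: (ccontinuousM (f := fun=> 0 +i* (- w))) => //; split=> x; exact: cvg_cst.
have izau := cintegrable_mul caz iu.
rewrite mulrNz mulNr -/w => H.
transitivity (cintegral I01 (fun x => a x * umode T f k x)).
  by apply: cintegral_I01_eq => x _; rewrite mulrA.
rewrite H mulrN -opprD -cintegral_I01_lin//; congr (- _).
have i2 : cintegrable (fun x => (chi^`()%classic x)%:C * (phase x * umode T u k x)).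
  have cc : ccontinuous (fun x => (chi^`()%classic x)%:C).
    split; last by move=> x; exact: cvg_cst.
    exact/rsmooth_continuous/rsmooth_derive1.
  have cp : ccontinuous phase by split; exact: rsmooth_continuous.
  exact/cintegrable_mul/cintegrable_mul.
have i0 : cintegrable (fun=> 0 : Cplx R).
  by split; exact: integrable0.
rewrite -[RHS]add0r -[in RHS](_ : cintegral I01 (fun=> 0 : Cplx R) = 0); last first.
  by apply: cplx_eq; rewrite /= Rintegral_cst// mul0r.
rewrite -cintegral_I01_lin//; apply: cintegral_I01_eq => x _.
rewrite a' add0r !mulrDl !mulrDr /a.
have cc : c * c = 1 by rewrite -expr2.
have -> : c%:C * ((0 +i* (w * c)) * ((chi x)%:C * phase x) * umode T u k x) =
    (0 +i* w) * ((chi x)%:C * phase x) * umode T u k x.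
  rewrite !mulrA; congr (_ * _ * _ * _); apply: cplx_eq; rewrite !cplxE /=; first by ring.
  by rewrite mul0r addr0 mulrCA cc mulr1.
by apply: cplx_eq; rewrite !cplxE /=; ring.
Qed.

End TransportModes.

(** * Continuous representatives of the modes *)

Section ModeRepresentative.
Context {R : realType}.
Variables T gamma : R.
Hypothesis T0 : 0 < T.
Local Notation mu := (@lebesgue_measure R).
Local Notation I01 := `](0:R), (1:R)[%classic.
Local Notation Re := (@complex.Re R).
Local Notation Im := (@complex.Im R).
Local Notation normc := (@Normc.normc R).

Let mI : measurable (I01 : set R). Proof. by []. Qed.

Lemma Rintegral_I01_cst (a : R) : \int[mu]_(x in I01) a = a.
Proof.
rewrite Rintegral_cst// [X in fine X](lebesgue_measure_itv (`]0, 1[%R : interval R))/=.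
by rewrite lte_fin ltr01 oppr0 adde0 mulr1.
Qed.

Lemma integrable_I01_cst (a : R) : mu.-integrable I01 (EFin \o (fun=> a)).
Proof.
apply: integrableS (integrable_continuous_itv 0 1 (f := fun=> a) _) => //.
  by apply: subset_itv; rewrite bnd_simp.
by move=> x; exact: cvg_cst.
Qed.

Lemma integrable_patch (g : R -> R) : mu.-integrable I01 (EFin \o g) ->
  mu.-integrable setT (EFin \o (g \_ I01)).
Proof. by move=> gi; rewrite -restrict_EFin; exact: (integrable_mkcond (mu := mu) _ mI).1. Qed.

Lemma patch_I01 (g : R -> R) x : I01 x -> (g \_ I01) x = g x.
Proof. by move=> xI; rewrite patchE mem_set. Qed.

(** The functions are extended by 0, so that the primitive is taken from minus
    infinity and its increments are bounded by the integral of |h|. *)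
Lemma continuous_primitive (c : R) (v h : R -> R) : c ^+ 2 = 1 ->
  mu.-integrable I01 (EFin \o v) -> mu.-integrable I01 (EFin \o h) ->
  (forall chi, cutoff chi -> \int[mu]_(x in I01) (chi x * h x) =
     - (c * \int[mu]_(x in I01) (chi^`()%classic x * v x))) ->
  exists W : R -> R, [/\ continuous W, {ae mu, forall x, I01 x -> v x = W x} &
    forall x y, `|W x - W y| <= \int[mu]_(x in I01) `|h x|].
Proof.
move=> c2 vi hi vh.
have cc : c * c = 1 by rewrite -expr2.
have c1 : `|c| = 1.
  by apply/eqP; rewrite -(eqrXn2 (n := 2))// expr1n real_normK ?num_real// c2.
pose h1 := (fun x => c * h x) \_ I01.
have chi_ : mu.-integrable I01 (EFin \o (fun x => c * h x)) by exact: integrable_scale.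
have h1i : mu.-integrable setT (EFin \o h1) by exact: integrable_patch.
have wd : weak_derivative (v \_ I01) h1.
  move=> chi hchi.
  have mul_int (b : R -> R) (g : R -> R) : continuous b -> mu.-integrable I01 (EFin \o g) ->
      mu.-integrable I01 (EFin \o (fun x => b x * g x)).
    move=> cb gi; have cB : ccontinuous (fun x => (b x)%:C).
      by split=> // x; exact: cvg_cst.
    have cG : cintegrable (fun x => (g x)%:C) by split=> //; exact: integrable0.
    have [+ _] := cintegrable_mul cB cG.
    by rewrite (_ : (fun x => _) = fun x => b x * g x)//;
      apply/funext => x; rewrite cplxE /= mul0r subr0.
  have [schi _] := hchi.
  transitivity (c * \int[mu]_(x in I01) (chi x * h x)).
    rewrite -RintegralZl//; last exact: mul_int (rsmooth_continuous schi) hi.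
    by apply: eq_Rintegral => x /set_mem xI; rewrite /h1 patch_I01//; ring.
  rewrite vh// mulrN mulrA cc mul1r; congr (- _).
  by apply: eq_Rintegral => x /set_mem xI; rewrite patch_I01// mulrC.
have [C hC] := weak_derivative_primitive (integrable_patch vi) h1i wd.
exists (fun x => C + \int[mu]_(t in `]-oo, x]) h1 t); split.
- by move=> x; apply: cvgD; [exact: cvg_cst|exact: primitive_continuous].
- by apply: ae_imp hC => x hx xI; rewrite -hx// patch_I01.
- move=> x y; rewrite opprD addrACA subrr add0r.
  apply: (le_trans (Rintegral_increment_le _ _ h1i)).
  rewrite [leRHS]Rintegral_mkcond le_eqVlt; apply/orP; left; apply/eqP.
  apply: eq_Rintegral => t _; rewrite /h1 !patchE; case: ifPn => _; last exact: normr0.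
  by rewrite normrM c1 mul1r.
Qed.

(** The continuous W equals the phase times the mode almost everywhere, and
    |W x| <= |W y| + 2 int |f_k| for all x and y; this is integrated in y.
    For every scale s, Young's inequality trades the L1 bounds of the mode and of
    its derivative for the energies, which are the quantities that are summable. *)
Lemma mode_representative (c : R) (u f : distr_field R) (k : int) : c ^+ 2 = 1 ->
  H0gamma T gamma u -> H0gamma T gamma f -> is_transport T c u f ->
  exists g : R -> Cplx R, [/\ ccontinuous g,
    {ae mu, forall x, I01 x -> umode T u k x = g x} &
    forall s x, 0 < s ->
      normc (g x) <= 2 * s * (energy T u k + energy T f k) + 2 / s].
Proof.
move=> c2 Hu Hf uf.
have [p1 p2] := (smoothP (phase T c k)).1 (smooth_phase T c k).
have cp : ccontinuous (phase T c k) by split; exact: rsmooth_continuous.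
have iu : cintegrable (umode T u k) by exact: (umode_integrable T0 k Hu).
have jf : cintegrable (umode T f k) by exact: (umode_integrable T0 k Hf).
pose v x := phase T c k x * umode T u k x.
pose h x := phase T c k x * umode T f k x.
have [v1 v2] : cintegrable v by exact: cintegrable_mul.
have [h1 h2] : cintegrable h by exact: cintegrable_mul.
have key (P : Cplx R -> R) : (forall (a : R) z, P (a%:C * z) = a * P z) ->
    (forall z, P (- z) = - P z) ->
    (forall m, P (cintegral I01 m) = \int[mu]_(x in I01) P (m x)) ->
    forall chi, cutoff chi -> \int[mu]_(x in I01) (chi x * P (h x)) =
      - (c * \int[mu]_(x in I01) (chi^`()%classic x * P (v x))).
  move=> PZ PN PI chi hchi.
  have := transport_mode T0 k c2 Hu Hf uf hchi => /(congr1 P).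
  rewrite PN PZ !PI => H.
  rewrite (_ : \int[mu]_(x in I01) _ =
    \int[mu]_(x in I01) P ((chi x)%:C * (phase T c k x * umode T f k x))).
    by rewrite H; congr (- (_ * _)); apply: eq_Rintegral => x _; rewrite PZ.
  by apply: eq_Rintegral => x _; rewrite PZ.
have [W1 [W1c W1v W1h]] := continuous_primitive c2 v1 h1 (key Re
  ltac:(by move=> *; rewrite cplxE /= mul0r subr0) (@Re_opp R) ltac:(by [])).
have [W2 [W2c W2v W2h]] := continuous_primitive c2 v2 h2 (key Im
  ltac:(by move=> *; rewrite cplxE /= mul0r addr0) (@Im_opp R) ltac:(by [])).
pose W x : Cplx R := W1 x +i* W2 x.
have cW : ccontinuous W by split.
(* q is the conjugate of the phase and undoes the straightening *)
pose q x : Cplx R := phase T c (- k) x.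
have [q1 q2] := (smoothP q).1 (smooth_phase T c (- k)).
have cq : ccontinuous q by split; exact: rsmooth_continuous.
have qp x : q x * phase T c k x = 1.
  have := cos2Dsin2 (k%:~R * omega T * (c * x)) => e.
  apply: cplx_eq; rewrite cplxE /= mulrNz !mulNr cosN sinN; last by rewrite mulNr mulrC subrr.
  by rewrite mulNr opprK -!expr2.
have vW : {ae mu, forall x, I01 x -> v x = W x}.
  apply: ae_imp (ae_and W1v W2v) => x [e1 e2] xI.
  by apply: cplx_eq; [exact: e1|exact: e2].
exists (fun x => q x * W x); split.
- exact: ccontinuousM.
- apply: ae_imp vW => x hx xI; rewrite -hx// /v mulrA qp mul1r //.
move=> s x s0; rewrite normcM normc_phase mul1r.
have s1 : s != 0 by rewrite gt_eqF.
have young (r : R) : r <= s * r ^+ 2 + 4^-1 / s.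
  rewrite -subr_ge0 (_ : _ - _ = s * (r - 2^-1 / s) ^+ 2); last by field.
  by rewrite mulr_ge0 ?sqr_ge0// ltW.
have [ef _] := energy_sum T0 0 Hf; have {}ef := ef k.
have [eu _] := energy_sum T0 0 Hu; have {}eu := eu k.
have Dle (g : R -> R) : mu.-integrable I01 (EFin \o g) ->
    (forall y, `|g y| <= normc (umode T f k y)) ->
    \int[mu]_(y in I01) `|g y| <= s * energy T f k + 4^-1 / s.
  move=> gi hg; rewrite -[4^-1 / s in leRHS]Rintegral_I01_cst /energy.
  rewrite -RintegralZl// -RintegralD//; last 2 first.
  - exact: integrable_scale.
  - exact: integrable_I01_cst.
  apply: le_Rintegral => //.
  - exact: integrable_norm gi.
  - by apply: integrable_add => //; [exact: integrable_scale|exact: integrable_I01_cst].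
  - by move=> y _; apply: (le_trans (hg y)); exact: young.
have hn y : normc (h y) = normc (umode T f k y) by rewrite normcM normc_phase mul1r.
have hle y : normc (h y) <= normc (umode T f k y) by rewrite hn.
have D1 := Dle _ h1 (fun y => le_trans (normc_Re (h y)) (hle y)).
have D2 := Dle _ h2 (fun y => le_trans (normc_Im (h y)) (hle y)).
have Wxy y : normc (W x) <= normc (W y) + 2 * (s * energy T f k + 4^-1 / s).
  rewrite -[W x](subrK (W y)) addrC; apply: (le_trans (normcD _ _)); rewrite lerD2l.
  apply: (le_trans (normc_le _)); rewrite !cplxE /=.
  by have := le_trans (W1h x y) D1; have := le_trans (W2h x y) D2; lra.
have mW : measurable_fun I01 (fun y => normc (W y) ^+ 2).
  apply: (@eq_measurable_fun _ _ _ _ _ (fun y => W1 y ^+ 2 + W2 y ^+ 2)).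
    by move=> y _; rewrite normc_sqr.
  by apply: measurable_funD; apply: measurable_funX; exact: continuous_measurable.
have WE : \int[mu]_(y in I01) (normc (W y) ^+ 2) = energy T u k.
  rewrite /energy /Rintegral; congr fine; apply: ae_eq_integral => //.
  - exact/measurable_EFinP.
  - by apply/measurable_EFinP; exact: (normc2_umode_measurable T0 k Hu).
  - apply: ae_imp vW => y hy yI; rewrite -hy//.
    by rewrite normcM normc_phase mul1r.
have Wi : mu.-integrable I01 (EFin \o (fun y => normc (W y) ^+ 2)).
  apply: integrableS (_ : mu.-integrable `[0, 1] _) => //.
    by apply: subset_itv; rewrite bnd_simp.
  rewrite (_ : (fun y => _) = fun y => W1 y * W1 y + W2 y * W2 y).
    apply: integrable_continuous_itv => y.
    by apply: cvgD; apply: cvgM; [exact: W1c|exact: W1c|exact: W2c|exact: W2c].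
  by apply/funext => y; rewrite normc_sqr !expr2.
pose K := 4^-1 / s + 2 * (s * energy T f k + 4^-1 / s).
have : normc (W x) <= s * energy T u k + K.
  rewrite -[leLHS]Rintegral_I01_cst -[K in leRHS]Rintegral_I01_cst -WE.
  rewrite -RintegralZl// -RintegralD//; last 2 first.
  - exact: integrable_scale.
  - exact: integrable_I01_cst.
  apply: le_Rintegral => //.
  - exact: integrable_I01_cst.
  - by apply: integrable_add => //; [exact: integrable_scale|exact: integrable_I01_cst].
  - move=> y _; apply: (le_trans (Wxy y)); rewrite /K addrA lerD2r; exact: young.
move/le_trans; apply; rewrite /K.
have e1 := energy_ge0 T u k; have e2 := energy_ge0 T f k.
have sV : 0 < s^-1 by rewrite invr_gt0.
by have := mulr_ge0 (ltW s0) e1; have := mulr_ge0 (ltW s0) e2; nra.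
Qed.

End ModeRepresentative.

(** * Uniformly convergent series *)

Section MTest.
Context {R : realType} {X : topologicalType}.
Variables (a : nat -> X -> R) (A : nat -> R) (S : R).
Hypothesis aA : forall m p, `|a m p| <= A m.
Hypothesis AS : forall N, \sum_(m < N) A m <= S.

Definition psum (N : nat) (p : X) : R := \sum_(m < N) a m p.
Definition series_lim (p : X) : R := limn (psum^~ p).

Let A0 m : forall p : X, 0 <= A m.
Proof. by move=> p; exact: le_trans (aA m p). Qed.

Let sA N : R := \sum_(m < N) A m.

Let sA_cvg (p : X) : cvgn sA.
Proof.
apply: nondecreasing_is_cvgn; last by exists S => _ [N _ <-]; exact: AS.
apply/nondecreasing_seqP => N; rewrite /sA big_ord_recr/= lerDl; exact: A0.
Qed.

(** Weierstrass's M-test: the partial sums of A bound the increments. *)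
Lemma psum_cvg p : cvgn (psum^~ p).
Proof.
have e1 : psum^~ p = series (fun m => a m p).
  by apply/funext => N; rewrite /psum /series/= big_mkord.
have e2 : sA = series A by apply/funext => N; rewrite /sA /series/= big_mkord.
rewrite e1; apply: normed_cvg; apply: (series_le_cvg _ _ (fun m => aA m p)).
- by move=> m; exact: normr_ge0.
- by move=> m; exact: A0.
- by rewrite -e2; exact: sA_cvg.
Qed.

Lemma psum_sub N M p : (N <= M)%N -> `|psum M p - psum N p| <= sA M - sA N.
Proof.
move=> NM; rewrite -(subnKC NM); elim: (M - N)%N => [|d IH].
  by rewrite addn0 !subrr normr0.
rewrite addnS /psum /sA !big_ord_recr/= -!/(psum _ _) -!/(sA _).
rewrite addrAC [leRHS]addrAC; by apply: (le_trans (ler_normD _ _)); apply: lerD.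
Qed.

Lemma series_lim_bound p : `|series_lim p| <= S.
Proof.
apply/ler_addgt0Pr => e e0.
have /cvgrPdist_le/(_ e e0) [M _ hM] : psum^~ p @ \oo --> series_lim p by exact: psum_cvg.
have h1 := hM M (leqnn M); have h2 := psum_sub p (leq0n M).
move: h2; rewrite /psum /sA !big_ord0 !subr0 -/(psum M p) => h2; have h3 := AS M.
rewrite -[series_lim p](subrK (psum M p)) addrC.
by apply: (le_trans (ler_normD _ _)); apply: lerD => //; exact: le_trans h2 h3.
Qed.

Lemma series_lim_uniform e : 0 < e -> exists N0, forall N p, (N0 <= N)%N ->
  `|series_lim p - psum N p| <= e.
Proof.
move=> e0.
have [|/set0P[p0 _]] := eqVneq [set: X] set0.
  by move=> X0; exists 0%N => N p; have : [set: X] p by []; rewrite X0.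
have /cvgrPdist_le/(_ e e0) [N0 _ hN] : sA @ \oo --> limn sA by exact: sA_cvg.
exists N0 => N p NN0; apply/ler_addgt0Pr => d d0.
have /cvgrPdist_le/(_ d d0) [M _ hM] : psum^~ p @ \oo --> series_lim p by exact: psum_cvg.
have h1 := hM (maxn M N) (leq_maxl _ _).
have h2 := psum_sub p (leq_maxr M N).
have h3 : sA (maxn M N) <= limn sA.
  apply: nondecreasing_cvgn_le; last exact: sA_cvg.
  by apply/nondecreasing_seqP => n; rewrite /sA big_ord_recr/= lerDl; exact: A0.
have h4 : limn sA - sA N <= e by apply: le_trans (hN N NN0); rewrite ler_norm.
rewrite -[series_lim p](subrK (psum (maxn M N) p)) -addrA addrC.
by apply: (le_trans (ler_normD _ _)); apply: lerD => //; lra.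
Qed.

Lemma psum_continuous N : (forall m, continuous (a m)) -> continuous (psum N).
Proof.
move=> ca; elim: N => [|N IH].
  rewrite (_ : psum 0 = fun=> 0); first by move=> p; exact: cvg_cst.
  by apply/funext => p; rewrite /psum big_ord0.
rewrite (_ : psum N.+1 = fun p => psum N p + a N p).
  by move=> p; apply: cvgD; [exact: IH|exact: ca].
by apply/funext => p; rewrite /psum big_ord_recr.
Qed.

Lemma series_lim_continuous : (forall m, continuous (a m)) -> continuous series_lim.
Proof.
move=> ca p; apply/cvgrPdist_le => e e0; have e3 : 0 < e / 3 by rewrite divr_gt0.
have [N hN] := series_lim_uniform e3.
have /cvgrPdist_le/(_ _ e3) := @psum_continuous N ca p.
apply: filterS => q hq.
have h1 := hN N p (leqnn N); have h2 := hN N q (leqnn N).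
rewrite (_ : _ - _ = (series_lim p - psum N p) + (psum N p - psum N q)
  - (series_lim q - psum N q)); last by ring.
apply: (le_trans (ler_normB _ _)); apply: (le_trans (lerD (ler_normD _ _) h2)); lra.
Qed.

End MTest.

Section ComplexContinuity.
Context {R : realType} {X : topologicalType}.

Lemma continuous_cplx (f : X -> Cplx R) :
  continuous (fun p => complex.Re (f p)) -> continuous (fun p => complex.Im (f p)) ->
  continuous f.
Proof.
move=> c1 c2 p; apply/cvgrPdist_lt => e e0.
have [er ei] : 0 < complex.Re e /\ complex.Im e = 0.
  by move: e0; rewrite ltcE /= => /andP[/eqP -> ->].
have e2 : 0 < complex.Re e / 2 by rewrite divr_gt0.
have /cvgrPdist_lt/(_ _ e2) h1 := c1 p.
have /cvgrPdist_lt/(_ _ e2) h2 := c2 p.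
near=> q.
have g1 : `|complex.Re (f p) - complex.Re (f q)| < complex.Re e / 2 by near: q.
have g2 : `|complex.Im (f p) - complex.Im (f q)| < complex.Re e / 2 by near: q.
have := normc_le (f p - f q); rewrite !cplxE => h.
have h3 : Normc.normc (f p - f q) < complex.Re e by lra.
by rewrite ltcE /= ei eqxx.
Unshelve. all: by end_near. Qed.

End ComplexContinuity.

(** * The continuous representative of a field *)

Section ContinuousRepresentative.
Context {R : realType}.
Variables T gamma : R.
Hypothesis T0 : 0 < T.
Hypothesis gamma1 : 3 / 2 < gamma.
Local Notation mu := (@lebesgue_measure R).
Local Notation I01 := `](0:R), (1:R)[%classic.
Local Notation Re := (@complex.Re R).
Local Notation Im := (@complex.Im R).
Local Notation normc := (@Normc.normc R).
Implicit Types u f : distr_field R.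

Definition mode_rep u k (g : R -> Cplx R) : Prop :=
  ccontinuous g /\ {ae mu, forall x, I01 x -> umode T u k x = g x}.

(** Only the values on [0, 1] are determined by the mode. *)
Definition modefun u k : R -> Cplx R := xget (fun=> 0) (mode_rep u k).

Definition transported u : Prop := exists c f,
  [/\ c ^+ 2 = 1, H0gamma T gamma u, H0gamma T gamma f & is_transport T c u f].

(** A set of full measure in the interval is dense in [0, 1]. *)
Lemma ae_eq_continuous (g h : R -> R) : continuous g -> continuous h ->
  {ae mu, forall x, I01 x -> g x = h x} -> forall x, 0 <= x <= 1 -> g x = h x.
Proof.
move=> cg ch gh x /andP[x0 x1].
apply/eqP; rewrite -subr_eq0 -normr_le0; apply/ler_addgt0Pr => e e0; rewrite add0r.
have cd : continuous (fun y => g y - h y) by move=> y; apply: cvgB; [exact: cg|exact: ch].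
have /cvgrPdist_le/(_ e e0)[d /= d0 hd] := cd x.
have lr : Num.max 0 (x - d) < Num.min 1 (x + d).
  rewrite lt_min !gt_max ltr01 /=; apply/andP; split; first lra.
  by apply/andP; split; lra.
have [y [ly yr hy]] := ae_nonempty lr gh.
move: ly yr; rewrite lt_min gt_max => /andP[y0 xy] /andP[y1 yx].
have gy : g y = h y by apply: hy; rewrite /= in_itv/= y0 y1.
have := hd y; rewrite gy subrr subr0; apply.
by rewrite /ball/= ltr_norml; apply/andP; split; lra.
Qed.

Lemma mode_rep_unique u k g h : mode_rep u k g -> mode_rep u k h ->
  forall x, 0 <= x <= 1 -> g x = h x.
Proof.
move=> [[g1 g2] ug] [[h1 h2] uh] x xI.
have gh := ae_and ug uh.
apply: cplx_eq.
  apply: (ae_eq_continuous g1 h1 _ xI).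
  by apply: ae_imp gh => y [e1 e2] yI; rewrite -e1// e2.
apply: (ae_eq_continuous g2 h2 _ xI).
by apply: ae_imp gh => y [e1 e2] yI; rewrite -e1// e2.
Qed.

Lemma modefunP u k : transported u -> mode_rep u k (modefun u k).
Proof.
move=> [c [f [c2 Hu Hf uf]]].
have [g [cg ug _]] := mode_representative T0 k c2 Hu Hf uf.
by apply: (@xgetPex _ _ (mode_rep u k)); exists g.
Qed.

Lemma modefun_bound u f c k s x : c ^+ 2 = 1 -> H0gamma T gamma u -> H0gamma T gamma f ->
  is_transport T c u f -> 0 < s -> 0 <= x <= 1 ->
  normc (modefun u k x) <= 2 * s * (energy T u k + energy T f k) + 2 / s.
Proof.
move=> c2 Hu Hf uf s0 xI; have [g [cg ug gs]] := mode_representative T0 k c2 Hu Hf uf.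
have tu : transported u by exists c, f.
by rewrite (mode_rep_unique (modefunP k tu) (conj cg ug) xI); exact: gs.
Qed.

(** Retraction of the line onto [0, 1]: the modes are extended as constants, so
    that the bounds and the continuity below hold on the whole plane. *)
Definition clamp (x : R) : R := Num.max 0 (Num.min x 1).

Lemma clampP x : 0 <= clamp x <= 1.
Proof. by rewrite /clamp le_max lexx /= ge_max ler01 ge_min lexx orbT. Qed.

Lemma clamp_id x : 0 <= x <= 1 -> clamp x = x.
Proof. by move=> /andP[x0 x1]; rewrite /clamp (min_idPl _)// (max_idPr _). Qed.

Lemma clamp_continuous : continuous clamp.
Proof.
have c1 : continuous (fun x : R => Num.min x 1).
  move=> x; apply: (@continuous_min R R id (fun=> 1) x); first exact: cvg_id.
  exact: cvg_cst.
move=> x; apply: (@continuous_max R R (fun=> 0) (fun x => Num.min x 1) x); last exact: c1.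
exact: cvg_cst.
Qed.

Definition term u (m : nat) (p : R * R) : Cplx R :=
  modefun u (nth_int m) (clamp p.1) * expfun T (nth_int m) p.2.

Definition Jre u (p : R * R) : R := series_lim (fun m p => Re (term u m p)) p.
Definition Jim u (p : R * R) : R := series_lim (fun m p => Im (term u m p)) p.

Definition Jfun u (x t : R) : Cplx R := (T^-1)%:C * (Jre u (x, t) +i* Jim u (x, t)).

Lemma normc_expfun k t : normc (expfun T k t) = 1.
Proof. by rewrite /expfun /= cos2Dsin2 sqrtr1. Qed.

Definition energy2 u f : R := fine (H0norm2 T gamma u) + fine (H0norm2 T gamma f).

(** The scale in the bound of mode k is taken proportional to the weight of k:
    one part of the bound is then summable by the energies, the other by the
    inverse weights. *)
Lemma term_bound u f c : c ^+ 2 = 1 -> H0gamma T gamma u -> H0gamma T gamma f ->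
  is_transport T c u f -> forall l, 0 < l -> exists A : nat -> R,
  (forall m p, normc (term u m p) <= A m) /\
  forall N, \sum_(m < N) A m <= 2 * l * T * energy2 u f + 32 / l.
Proof.
move=> c2 Hu Hf uf l l0; pose w m := weight gamma (nth_int m).
have w0 m : 0 < w m by exact: weight_gt0.
exists (fun m => 2 * (l * w m) * (energy T u (nth_int m) + energy T f (nth_int m))
  + 2 / (l * w m)); split.
  move=> m p; rewrite /term normcM normc_expfun mulr1.
  by apply: (modefun_bound _ c2 Hu Hf uf); [rewrite mulr_gt0|exact: clampP].
move=> N.
have [_ h1] := energy_sum T0 N Hu; have [_ h2] := energy_sum T0 N Hf.
have h3 := sum_weight_inv gamma1 N.
rewrite big_split/=; apply: lerD.
  rewrite (eq_bigr (fun m : 'I_N => 2 * l * (w m * energy T u (nth_int m) + w m * energy T f (nth_int m)))).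
    rewrite -mulr_sumr -[2 * l * T * _]mulrA ler_wpM2l ?mulr_ge0 ?(ltW l0)//.
    by rewrite big_split /energy2 mulrDr; apply: lerD.
  by move=> m _; ring.
rewrite (eq_bigr (fun m : 'I_N => 2 / l * (w m)^-1)).
  rewrite -mulr_sumr (_ : 32 / l = 2 / l * 16); last by ring.
  by rewrite ler_wpM2l// divr_ge0// ltW.
by move=> m _; rewrite invfM mulrA.
Qed.

Lemma term_summable u : transported u -> exists (A : nat -> R) (S : R),
  (forall m p, normc (term u m p) <= A m) /\ forall N, \sum_(m < N) A m <= S.
Proof.
move=> [c [f [c2 Hu Hf uf]]].
have [A [h1 h2]] := term_bound c2 Hu Hf uf ltr01.
by exists A; eexists; split; [exact: h1|exact: h2].
Qed.

Lemma term_Re_le u A : (forall m p, normc (term u m p) <= A m) ->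
  forall m p, `|Re (term u m p)| <= A m.
Proof. by move=> h m p; exact: le_trans (normc_Re _) (h m p). Qed.

Lemma term_Im_le u A : (forall m p, normc (term u m p) <= A m) ->
  forall m p, `|Im (term u m p)| <= A m.
Proof. by move=> h m p; exact: le_trans (normc_Im _) (h m p). Qed.

Lemma Jfun_bound u f c : c ^+ 2 = 1 -> H0gamma T gamma u -> H0gamma T gamma f ->
  is_transport T c u f -> forall l x t, 0 < l ->
  normc (Jfun u x t) <= T^-1 * (2 * (2 * l * T * energy2 u f + 32 / l)).
Proof.
move=> c2 Hu Hf uf l x t l0; have [A [h1 h2]] := term_bound c2 Hu Hf uf l0.
have T1 : 0 <= T^-1 by rewrite invr_ge0 ltW.
rewrite /Jfun normcM normc_real ger0_norm// ler_wpM2l//.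
apply: (le_trans (normc_le _)); rewrite /= mulr_natl mulr2n; apply: lerD.
  exact: (series_lim_bound (term_Re_le h1) h2).
exact: (series_lim_bound (term_Im_le h1) h2).
Qed.

Lemma term_continuous u m : transported u ->
  continuous (fun p => Re (term u m p)) /\ continuous (fun p => Im (term u m p)).
Proof.
move=> tu; have [[g1 g2] _] := modefunP (nth_int m) tu.
have cx (g : R -> R) : continuous g -> continuous (fun p : R * R => g (clamp p.1)).
  move=> cg p; apply: (continuous_comp (f := fst) (g := g \o clamp)); first exact: cvg_fst.
  by apply: continuous_comp; [exact: clamp_continuous|exact: cg].
have ct (g : R -> R) : rsmooth g -> continuous (fun p : R * R => g p.2).
  move=> sg p; apply: (continuous_comp (f := snd) (g := g)); first exact: cvg_snd.
  exact: rsmooth_continuous.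
have cc := ct _ (rsmooth_cos ((nth_int m)%:~R * omega T)).
have cs := ct _ (rsmooth_sin ((nth_int m)%:~R * omega T)).
have c1 := cx _ g1; have c2 := cx _ g2.
split.
  rewrite (_ : (fun p => _) = fun p : R * R =>
    Re (modefun u (nth_int m) (clamp p.1)) * cos ((nth_int m)%:~R * omega T * p.2) -
    Im (modefun u (nth_int m) (clamp p.1)) * sin ((nth_int m)%:~R * omega T * p.2)).
    by move=> p; apply: cvgB; apply: cvgM; [exact: c1|exact: cc|exact: c2|exact: cs].
  by apply/funext => p; rewrite /term cplxE.
rewrite (_ : (fun p => _) = fun p : R * R =>
  Re (modefun u (nth_int m) (clamp p.1)) * sin ((nth_int m)%:~R * omega T * p.2) +
  Im (modefun u (nth_int m) (clamp p.1)) * cos ((nth_int m)%:~R * omega T * p.2)).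
  by move=> p; apply: cvgD; apply: cvgM; [exact: c1|exact: cs|exact: c2|exact: cc].
by apply/funext => p; rewrite /term cplxE.
Qed.

Lemma Jre_Jim_continuous u : transported u -> continuous (Jre u) /\ continuous (Jim u).
Proof.
move=> tu; have [A [S [h1 h2]]] := term_summable tu; split.
  apply: (series_lim_continuous (term_Re_le h1) h2) => m.
  by have [] := term_continuous m tu.
apply: (series_lim_continuous (term_Im_le h1) h2) => m.
by have [] := term_continuous m tu.
Qed.

Lemma Jfun_Re u x t : Re (Jfun u x t) = T^-1 * Jre u (x, t).
Proof. by rewrite /Jfun cplxE /= mul0r subr0. Qed.

Lemma Jfun_Im u x t : Im (Jfun u x t) = T^-1 * Jim u (x, t).
Proof. by rewrite /Jfun cplxE /= mul0r addr0. Qed.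

Lemma Jfun_ccontinuous u x : transported u -> ccontinuous (Jfun u x).
Proof.
move=> tu; have [c1 c2] := Jre_Jim_continuous tu.
have key (h : R * R -> R) : continuous h -> continuous (fun t : R => T^-1 * h (x, t)).
  move=> ch t; apply: cvgM; first exact: cvg_cst.
  apply: (continuous_comp (f := fun t => (x, t)) (g := h)); last exact: ch.
  exact: (cvg_pair (cvg_cst x) cvg_id).
split.
  rewrite (_ : (fun t => _) = fun t => T^-1 * Jre u (x, t)); first exact: key.
  by apply/funext => t; rewrite Jfun_Re.
rewrite (_ : (fun t => _) = fun t => T^-1 * Jim u (x, t)); first exact: key.
by apply/funext => t; rewrite Jfun_Im.
Qed.

Lemma Jfun_Cper u : transported u -> Cper T (Jfun u).
Proof.
move=> tu; have [c1 c2] := Jre_Jim_continuous tu; split.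
- apply: continuous_subspaceT; apply: continuous_cplx.
    rewrite (_ : (fun p => _) = fun p => T^-1 * Jre u p).
      by move=> p; apply: cvgM; [exact: cvg_cst|exact: c1].
    by apply/funext => -[x t]; rewrite Jfun_Re.
  rewrite (_ : (fun p => _) = fun p => T^-1 * Jim u p).
    by move=> p; apply: cvgM; [exact: cvg_cst|exact: c2].
  by apply/funext => -[x t]; rewrite Jfun_Im.
- move=> x t _.
  have tT m : term u m (x, t + T) = term u m (x, t).
    by congr (_ * _); have [_ h] := test_expfun T0 (nth_int m); exact: h.
  rewrite /Jfun /Jre /Jim /series_lim /psum; congr (_ * (_ +i* _)).
    by congr (limn _); apply/funext => N; apply: eq_bigr => m _; rewrite tT.
  by congr (limn _); apply/funext => N; apply: eq_bigr => m _; rewrite tT.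
- have [c [f [e2 Hu Hf uf]]] := tu.
  by eexists => x t _; exact: (Jfun_bound e2 Hu Hf uf x t ltr01).
Qed.

End ContinuousRepresentative.

(** * The embedding *)

Section Embedding.
Context {R : realType}.
Variables T gamma : R.
Hypothesis T0 : 0 < T.
Hypothesis gamma1 : 3 / 2 < gamma.
Local Notation mu := (@lebesgue_measure R).
Local Notation I01 := `](0:R), (1:R)[%classic.
Local Notation Re := (@complex.Re R).
Local Notation Im := (@complex.Im R).
Local Notation normc := (@Normc.normc R).
Local Notation transported := (transported T gamma).
Implicit Types u f : distr_field R.

Lemma cintegral_expfun (k : int) :
  cintegral `[0, T]%classic (expfun T k) = (if k == 0 then T else 0)%:C.
Proof.
have s1 : rsmooth (fun=> 1 : R) by exact: rsmooth_cst.
have p1 : Tperiodic T (fun=> 1 : R) by [].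
have hc : trigc T (k%:~R * omega T) (fun=> 1) = if k == 0 then T else 0.
  by rewrite -(mode_cst1 T0 k 0) /mode mulr0 cos0 sin0 mulr1 mulr0 addr0.
have hs : trigs T (k%:~R * omega T) (fun=> 1) = 0.
  have [->|k0] := eqVneq k 0.
    rewrite /trigs (@eq_Rintegral _ _ _ _ _ (fun=> 0)) ?intT_cst ?mul0r//.
    by move=> s _; rewrite !mul0r sin0 mulr0.
  have d0 : (fun=> 1 : R)^`()%classic = fun=> 0.
    by apply: is_derive_derive1 => x; exact: is_derive_cst.
  have := trigc_derive1 T0 k s1 p1; rewrite d0 {1}/trigc.
  rewrite (@eq_Rintegral _ _ _ _ _ (fun=> 0)) ?intT_cst ?mul0r//; last by move=> s _; rewrite mul0r.
  move=> /esym/eqP; rewrite mulf_eq0 => /orP[|/eqP //].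
  by rewrite mulf_eq0 intr_eq0 (negbTE k0)/= gt_eqF// omega_gt0.
apply: cplx_eq => /=; [rewrite -[RHS]hc /trigc|rewrite -[RHS]hs /trigs];
  by apply: eq_Rintegral => s _; rewrite mul1r.
Qed.

Lemma expfunM (j k : int) t : expfun T j t * expfun T k t = expfun T (j + k) t.
Proof.
by apply: cplx_eq; rewrite cplxE /= intrD !mulrDl ?cosD ?sinD; ring.
Qed.

Lemma expfun_ccontinuous k : ccontinuous (expfun T k).
Proof. exact/(test_ccontinuous (T := T))/test_expfun. Qed.

Lemma cintegral_trig_sum (N : nat) (z : nat -> Cplx R) (k : int) :
  ccontinuous (fun t => \sum_(m < N) z m * expfun T (nth_int m) t) /\
  cintegral `[0, T]%classic
    (fun t => (\sum_(m < N) z m * expfun T (nth_int m) t) * expfun T (- k) t) =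
  \sum_(m < N) z m * (if nth_int m == k then T else 0)%:C.
Proof.
elim: N => [|N [IH1 IH2]].
  rewrite big_ord0 (_ : (fun t => \sum_(m < 0) _) = fun=> 0); last by apply/funext => t; rewrite big_ord0.
  split; first by split=> t; exact: cvg_cst.
  rewrite (_ : (fun t => _) = fun=> 0); last by apply/funext => t; rewrite big_ord0 mul0r.
  by apply: cplx_eq; rewrite /= intT_cst ?mul0r.
have ez : ccontinuous (fun t => z N * expfun T (nth_int N) t).
  apply: (ccontinuousM (f := fun=> z N)); last exact: expfun_ccontinuous.
  by split=> t; exact: cvg_cst.
split.
  have [i1 i2] := IH1; have [e1 e2] := ez; split=> t.
    rewrite (_ : (fun t => _) = fun t => Re (\sum_(m < N) z m * expfun T (nth_int m) t) +
      Re (z N * expfun T (nth_int N) t)).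
      by apply: cvgD; [exact: i1|exact: e1].
    by apply/funext => s; rewrite big_ord_recr /= Re_add.
  rewrite (_ : (fun t => _) = fun t => Im (\sum_(m < N) z m * expfun T (nth_int m) t) +
    Im (z N * expfun T (nth_int N) t)).
    by apply: cvgD; [exact: i2|exact: e2].
  by apply/funext => s; rewrite big_ord_recr /= Im_add.
have eP : ccontinuous (fun t => (\sum_(m < N) z m * expfun T (nth_int m) t) * expfun T (- k) t).
  by apply: ccontinuousM => //; exact: expfun_ccontinuous.
rewrite big_ord_recr /= -IH2 addrC -[nth_int N == k]subr_eq0.
rewrite -cintegral_expfun -cintegral_lin//; last exact: expfun_ccontinuous.
congr cintegral; apply/funext => t.
by rewrite big_ord_recr /= mulrDl -mulrA expfunM addrC.
Qed.

(** The Fourier coefficients of the uniformly convergent series are read off from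
    its partial sums. *)
Lemma Jfun_coefficient u x k : transported u -> 0 <= x <= 1 ->
  distr_of T (Jfun T u x) (expfun T (- k)) = modefun T u k x.
Proof.
move=> tu xI; apply/eqP; rewrite -subr_eq0; apply/eqP/normc_eq0/eqP.
rewrite eq_le normc_ge0 andbT; apply/ler_addgt0Pr => e e0; rewrite add0r.
have [A [S [h1 h2]]] := term_summable T0 gamma1 tu.
have e4 : 0 < e / 4 by rewrite divr_gt0.
have [N1 hN1] := series_lim_uniform (term_Re_le h1) h2 e4.
have [N2 hN2] := series_lim_uniform (term_Im_le h1) h2 e4.
have [j jk] := nth_int_surj k.
(* large enough for the error, and for the frequency k to occur *)
pose N := (maxn (maxn N1 N2) j.+1).
have N1N : (N1 <= N)%N by rewrite /N !leq_max leqnn.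
have N2N : (N2 <= N)%N by rewrite /N !leq_max leqnn orbT.
have jN : (j < N)%N by rewrite /N leq_max leqnn orbT.
pose z m : Cplx R := (T^-1)%:C * modefun T u (nth_int m) x.
pose P t : Cplx R := \sum_(m < N) z m * expfun T (nth_int m) t.
have [cP iP] := cintegral_trig_sum N z k; rewrite -/P in cP iP.
have coefP : cintegral `[0, T]%classic (fun t => P t * expfun T (- k) t) = modefun T u k x.
  rewrite iP (bigD1 (Ordinal jN))//= jk eqxx big1 ?addr0.
    rewrite /z jk mulrAC -rmorphM mulVf ?gt_eqF// mul1r //.
  move=> m mj; rewrite (_ : (nth_int m == k) = false) ?mulr0//.
  apply/negbTE/eqP => mk; move: mj; rewrite -val_eqE/= => /eqP; apply.
  have [_ inj _] := nth_int_bij; apply: inj; rewrite ?in_setE//.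
  by rewrite mk jk.
have PE t : P t = (T^-1)%:C * (psum (fun m p => Re (term T u m p)) N (x, t)
    +i* psum (fun m p => Im (term T u m p)) N (x, t)).
  rewrite /P /psum; elim: (N) => [|n IH].
    by rewrite !big_ord0; apply: cplx_eq; rewrite cplxE /= mulr0 ?mul0r ?subrr ?addr0.
  rewrite !big_ord_recr /= IH /z /term /= clamp_id//.
  by apply: cplx_eq; rewrite !cplxE /=; ring.
have cJ := Jfun_ccontinuous T0 gamma1 x tu.
have cD : ccontinuous (fun t => Jfun T u x t - P t).
  have [j1 j2] := cJ; have [p1 p2] := cP; split=> t.
    rewrite (_ : (fun t => _) = fun t => Re (Jfun T u x t) - Re (P t)).
      by apply: cvgB; [exact: j1|exact: p1].
    by apply/funext => s; rewrite !cplxE.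
  rewrite (_ : (fun t => _) = fun t => Im (Jfun T u x t) - Im (P t)).
    by apply: cvgB; [exact: j2|exact: p2].
  by apply/funext => s; rewrite !cplxE.
have cDe : ccontinuous (fun t => (Jfun T u x t - P t) * expfun T (- k) t).
  by apply: ccontinuousM => //; exact: expfun_ccontinuous.
have -> : distr_of T (Jfun T u x) (expfun T (- k)) - modefun T u k x =
    cintegral `[0, T]%classic (fun t => (Jfun T u x t - P t) * expfun T (- k) t).
  rewrite -coefP addrC.
  have := @cintegral_lin R T (-1) _ _ (ccontinuousM cP (expfun_ccontinuous (- k)))
    (ccontinuousM cJ (expfun_ccontinuous (- k))).
  rewrite mulN1r => <-; congr cintegral.
  by apply/funext => t; ring.
apply: (@le_trans _ _ (2 * T * (T^-1 * (e / 4 + e / 4)))); last first.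
  by rewrite mulrA mulfK ?gt_eqF//; lra.
apply: cintegral_le => // t _; rewrite normcM normc_expfun mulr1.
rewrite PE /Jfun -mulrBr normcM normc_real ger0_norm ?invr_ge0 ?(ltW T0)//.
rewrite ler_wpM2l ?invr_ge0 ?(ltW T0)//.
apply: (le_trans (normc_le _)); rewrite !cplxE /=; apply: lerD.
  exact: hN1.
exact: hN2.
Qed.

(** Almost every x is good for all of the countably many modes at once. *)
Lemma Jfun_represents u : transported u -> represents T (Jfun T u) u.
Proof.
move=> tu; have [c [f [_ [Hu _ _] _ _]]] := tu.
have h m : {ae mu, forall x, I01 x ->
    umode T u (nth_int m) x = modefun T u (nth_int m) x}.
  by have [_] := modefunP T0 (nth_int m) tu.
apply: ae_imp (ae_forall_nat h) => x hx xI.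
have xI' : 0 <= x <= 1 by move: xI; rewrite /= in_itv/= => /andP[/ltW -> /ltW ->].
have [ux _] := Hu x xI.
apply: (distribution_ext T0 ux) => [|k].
  exact/(distr_of_distribution T0)/(Jfun_ccontinuous T0 gamma1).
have [m mk] := nth_int_surj (- k).
by rewrite -[k in RHS]opprK Jfun_coefficient// -mk -hx// /umode mk opprK.
Qed.

Lemma Jfun_ext u u' : (forall k x, 0 <= x <= 1 -> modefun T u k x = modefun T u' k x) ->
  Jfun T u = Jfun T u'.
Proof.
move=> uu'; have e : term T u = term T u'.
  apply/funext => m; apply/funext => p; rewrite /term uu'//; exact: clampP.
by rewrite /Jfun /Jre /Jim e.
Qed.

Lemma Jfun_eq_field u u' : transported u -> transported u' -> eq_field T u u' ->
  Jfun T u = Jfun T u'.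
Proof.
move=> tu tu' uu'; apply: Jfun_ext => k.
apply: (mode_rep_unique (modefunP T0 k tu)); have [cg ug] := modefunP T0 k tu'.
split=> //; apply: ae_imp (ae_and uu' ug) => x [e1 e2] xI.
by rewrite -e2// /umode; apply: (e1 xI); exact: test_expfun.
Qed.

Lemma eq_field_Jfun u u' : transported u -> transported u' ->
  eq_strip (Jfun T u) (Jfun T u') -> eq_field T u u'.
Proof.
move=> tu tu' JJ; have h := Jfun_represents tu; have h' := Jfun_represents tu'.
apply: ae_imp (ae_and h h') => x [e1 e2] xI phi tphi.
rewrite (e1 xI _ tphi) (e2 xI _ tphi); congr cintegral; apply/funext => t.
by rewrite JJ//; move: xI; rewrite /= in_itv/= => /andP[/ltW -> /ltW ->].
Qed.

(** Linear combinations of continuous representatives are the continuous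
    representatives, by uniqueness on [0, 1]; the clamp is what lets this pass to
    the series. *)
Lemma Jfun_linear (a : Cplx R) u u' : transported u -> transported u' -> forall x t,
  Jfun T (fun x phi => a * u x phi + u' x phi) x t = a * Jfun T u x t + Jfun T u' x t.
Proof.
move=> tu tu' x t; set v := fun x => _.
have mv k : forall y, 0 <= y <= 1 ->
    modefun T v k y = a * modefun T u k y + modefun T u' k y.
  have [[g1 g2] ug] := modefunP T0 k tu; have [[h1 h2] uh] := modefunP T0 k tu'.
  have rep : mode_rep T v k (fun y => a * modefun T u k y + modefun T u' k y).
    split; last first.
      by apply: ae_imp (ae_and ug uh) => y [e1 e2] yI; rewrite -e1// -e2.
    have [k1 k2] := ccontinuousM (f := fun=> a) (conj (fun y => cvg_cst _) (fun y => cvg_cst _))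
      (conj g1 g2); split=> y.
      rewrite (_ : (fun y => _) = fun y => Re (a * modefun T u k y) + Re (modefun T u' k y)).
        by apply: cvgD; [exact: k1|exact: h1].
      by apply/funext => s; rewrite Re_add.
    rewrite (_ : (fun y => _) = fun y => Im (a * modefun T u k y) + Im (modefun T u' k y)).
      by apply: cvgD; [exact: k2|exact: h2].
    by apply/funext => s; rewrite Im_add.
  apply: (fun h => mode_rep_unique h rep).
  by apply: (@xgetPex _ _ (mode_rep T v k)); eexists; exact: rep.
have tv m p : term T v m p = a * term T u m p + term T u' m p.
  by rewrite /term mv ?clampP// mulrDl mulrA.
have [A [S [A1 A2]]] := term_summable T0 gamma1 tu.
have [B [S' [B1 B2]]] := term_summable T0 gamma1 tu'.
have c1 := @psum_cvg _ _ _ _ _ (term_Re_le A1) A2 (x, t); have c2 := @psum_cvg _ _ _ _ _ (term_Im_le A1) A2 (x, t).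
have d1 := @psum_cvg _ _ _ _ _ (term_Re_le B1) B2 (x, t); have d2 := @psum_cvg _ _ _ _ _ (term_Im_le B1) B2 (x, t).
have hre : Jre T v (x, t) = Re a * Jre T u (x, t) - Im a * Jim T u (x, t) + Jre T u' (x, t).
  apply: cvg_lim => //.
  rewrite (_ : (fun N => _) = fun N => Re a * psum (fun m p => Re (term T u m p)) N (x, t)
    - Im a * psum (fun m p => Im (term T u m p)) N (x, t)
    + psum (fun m p => Re (term T u' m p)) N (x, t)).
    by apply: cvgD d1; apply: cvgB; [apply: cvgM c1|apply: cvgM c2]; exact: cvg_cst.
  apply/funext => N; rewrite /psum !mulr_sumr -sumrB -big_split; apply: eq_bigr => m _ /=.
  by rewrite tv Re_add Re_mul.
have him : Jim T v (x, t) = Re a * Jim T u (x, t) + Im a * Jre T u (x, t) + Jim T u' (x, t).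
  apply: cvg_lim => //.
  rewrite (_ : (fun N => _) = fun N => Re a * psum (fun m p => Im (term T u m p)) N (x, t)
    + Im a * psum (fun m p => Re (term T u m p)) N (x, t)
    + psum (fun m p => Im (term T u' m p)) N (x, t)).
    by apply: cvgD d2; apply: cvgD; [apply: cvgM c2|apply: cvgM c1]; exact: cvg_cst.
  apply/funext => N; rewrite /psum !mulr_sumr -!big_split; apply: eq_bigr => m _ /=.
  by rewrite tv Im_add Im_mul.
apply: cplx_eq.
  by rewrite Re_add !Jfun_Re Re_mul !Jfun_Re !Jfun_Im hre; ring.
by rewrite Im_add !Jfun_Im Im_mul !Jfun_Re !Jfun_Im him; ring.
Qed.

(** The scale l is still free in the bound: 1/V balances its two parts, and for
    V = 0 the scale tends to infinity. *)
Lemma Jfun_norm u f c (V : R) : c ^+ 2 = 1 -> H0gamma T gamma u -> H0gamma T gamma f ->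
  is_transport T c u f -> 0 <= V -> energy2 T gamma u f <= V ^+ 2 ->
  Cnorm (Jfun T u) <= (4 + 64 / T) * V.
Proof.
move=> c2 Hu Hf uf V0 qV.
have bound l x t : 0 < l -> normc (Jfun T u x t) <= 4 * l * V ^+ 2 + 64 / T / l.
  move=> l0; apply: (le_trans (Jfun_bound T0 gamma1 c2 Hu Hf uf x t l0)).
  apply: (@le_trans _ _ (T^-1 * (2 * (2 * l * T * V ^+ 2 + 32 / l)))).
    rewrite ler_wpM2l ?invr_ge0 ?(ltW T0)// ler_wpM2l// lerD2r ler_wpM2l//.
    by rewrite !mulr_ge0 ?(ltW l0) ?(ltW T0).
  rewrite le_eqVlt; apply/orP; left; apply/eqP; field.
  by rewrite !gt_eqF.
apply: sup_le_ub.
  by exists (normc (Jfun T u 0 0)); exists (0, 0) => //=; rewrite lexx ler01.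
move=> _ [[x t] _ <-] /=.
have [Vp|Vn] := ltP 0 V.
  apply: (le_trans (bound V^-1 x t _)); first by rewrite invr_gt0.
  rewrite le_eqVlt; apply/orP; left; apply/eqP; field.
  by rewrite !gt_eqF.
have VE : V = 0 by apply/eqP; rewrite eq_le Vn V0.
rewrite VE mulr0; apply/ler_addgt0Pr => e e0; rewrite add0r.
(* for V = 0 the bound is 64 / (T l), and this l makes it equal to e *)
have l0 : 0 < 64 / T / e by rewrite !divr_gt0.
apply: (le_trans (bound _ x t l0)); rewrite VE expr0n mulr0 add0r.
rewrite le_eqVlt; apply/orP; left; apply/eqP; field.
by rewrite !gt_eqF.
Qed.

Lemma H0norm2_fin u : H0gamma T gamma u ->
  H0norm2 T gamma u \is a fin_num /\ 0 <= fine (H0norm2 T gamma u).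
Proof.
move=> [_ _ fin]; have h0 : (0 <= H0norm2 T gamma u)%E.
  rewrite mule_ge0 ?lee_fin ?invr_ge0 ?(ltW T0)//; apply: esum_ge0 => k _.
  rewrite mule_ge0 ?lee_fin ?(ltW (weight_gt0 _ _))//.
  by apply: integral_ge0 => x _; rewrite lee_fin sqr_ge0.
by split; [rewrite ge0_fin_numE|exact: fine_ge0].
Qed.

Lemma fine_add4 (a b c d : \bar R) : a \is a fin_num -> b \is a fin_num ->
  c \is a fin_num -> d \is a fin_num ->
  fine ((a + b) + (c + d))%E = (fine a + fine c) + (fine b + fine d).
Proof. by case: a => // a; case: b => // b; case: c => // c; case: d => // d _ _ _ _; exact: addrACA. Qed.

Lemma transportP c u f : H0gamma T gamma f -> is_transport T c u f ->
  H0gamma T gamma (transport T gamma c u) /\ is_transport T c u (transport T gamma c u).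
Proof.
move=> Hf uf.
by apply: (@xgetPex _ _ [set f | H0gamma T gamma f /\ is_transport T c u f]); exists f.
Qed.

End Embedding.

Local Close Scope complex_scope.
Local Close Scope classical_set_scope.

Theorem corollary7 (R : realType) (T gamma : R)
  (hT : 0 < T) (hgamma : 3 / 2 < gamma) :
  V_continuously_embedded_in_C2 T gamma.
Proof.
exists (fun w => (Jfun T w.1, Jfun T w.2)).
have one : (1 : R) ^+ 2 = 1 by rewrite expr1n.
have mone : (-1 : R) ^+ 2 = 1 by rewrite sqrrN expr1n.
have tV w : Vgamma T gamma w -> transported T gamma w.1 /\ transported T gamma w.2.
  move=> [[H1 H2] [z [[Z1 Z2] t1 t2]]].
  by split; [exists 1, z.1|exists (-1), z.2].
split.
- move=> w /tV[t1 t2]; split; [exact: Jfun_Cper t1|exact: Jfun_Cper t2|..].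
    exact: Jfun_represents t1.
  exact: Jfun_represents t2.
- move=> a w w' /tV[t1 t2] /tV[t1' t2'].
  by split=> x t _; apply: (Jfun_linear hT hgamma).
- move=> w w' /tV[t1 t2] /tV[t1' t2']; split=> [[e1 e2]|[e1 e2]].
    by split; [exact: (eq_field_Jfun hT hgamma t1 t1')|exact: (eq_field_Jfun hT hgamma t2 t2')].
  by split=> x t _; rewrite /= ?(Jfun_eq_field hT t1 t1' e1) ?(Jfun_eq_field hT t2 t2' e2).
- exists (4 + 64 / T) => w [[H1 H2] [z [[Z1 Z2] t1 t2]]].
  have [F1 f1] := transportP Z1 t1; have [F2 f2] := transportP Z2 t2.
  have [a1 b1] := H0norm2_fin hT H1; have [a2 b2] := H0norm2_fin hT H2.
  have [a3 b3] := H0norm2_fin hT F1; have [a4 b4] := H0norm2_fin hT F2.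
  have V2 : Vnorm T gamma w ^+ 2 = energy2 T gamma w.1 (transport T gamma 1 w.1) +
      energy2 T gamma w.2 (transport T gamma (-1) w.2).
    have E : (Wnorm2 T gamma w + Wnorm2 T gamma (transport T gamma 1 w.1, transport T gamma (-1) w.2) =
        (H0norm2 T gamma w.1 + H0norm2 T gamma w.2) +
        (H0norm2 T gamma (transport T gamma 1 w.1) + H0norm2 T gamma (transport T gamma (-1) w.2)))%E.
      exact: erefl.
    rewrite /Vnorm E (fine_add4 a1 a2 a3 a4).
    rewrite (sqr_sqrtr (addr_ge0 (addr_ge0 b1 b3) (addr_ge0 b2 b4))) /energy2.
    exact: erefl.
  have V0 : 0 <= Vnorm T gamma w by exact: sqrtr_ge0.
  rewrite ge_max; apply/andP; split.
    by apply: (Jfun_norm hT hgamma one H1 F1 f1 V0); rewrite V2 lerDl; exact: addr_ge0 b2 b4.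
  by apply: (Jfun_norm hT hgamma mone H2 F2 f2 V0); rewrite V2 lerDr; exact: addr_ge0 b1 b3.
Qed.
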